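(* Let $S$ be a complex manifold of dimension $n$ and $D\subseteq S$ a divisor. Suppose that locally at a point $p\in S$ the divisor $(D,p)$ has a decomposition into irreducible components $(D,p)=\bigcup_{i=1}^m(D_i,p)$ such that each $(D_i,p)$ is smooth. Let $h=h_1\cdots h_m$ be the corresponding equation of $D$ at $p$. If $D$ is free at $p$ and $J_h=\sqrt{J_h}$, then $D$ has normal crossings at $p$.
   Context: Work in the complex analytic category. $\mathcal{O}_{S,p}\cong\mathbb{C}\{x_1,\dots,x_n\}$ is the local ring of germs of holomorphic functions at $p$, with $(x_1,\dots,x_n)$ complex coordinates of $S$ at $p$. A divisor is a hypersurface; its local defining equations are always taken reduced (square-free). Here $h_i$ is a defining equation of $(D_i,p)$. For $f\in\mathcal{O}_{S,p}$, the Jacobian ideal is $J_f=(\partial_{x_1}f,\dots,\partial_{x_n}f)\subseteq\mathcal{O}_{S,p}$. $\operatorname{Der}_{S,p}$ is the module of germs at $p$ of holomorphic vector fields on $S$, and $\operatorname{Der}_{S,p}(\log D)=\{\delta\in\operatorname{Der}_{S,p}:\delta(h)\in(h)\}$ is the module of logarithmic derivations along $D=\{h=0\}$. $D$ is free at $p$ if $\operatorname{Der}_{S,p}(\log D)$ is a free $\mathcal{O}_{S,p}$-module. $D$ has normal crossings at $p$ if there are complex coordinates $(x_1,\dots,x_n)$ at $p$ such that $D$ is defined at $p$ by $x_1\cdots x_k=0$ for some $k\le n$. *)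

(* Defs.v *)
(* MathComp / MathComp-Analysis; the field of complex numbers is [R[i]] for
   [R : realType].  Everything is written over a field [K] with an absolute
   value, because the canonical topologies on ['rV[K]_n] and [K] are inferred
   for such a [K]; only [K := R[i]] is meant. *)
From HB Require Import structures.
From mathcomp Require Import all_boot all_order all_algebra.
From mathcomp Require Import complex.
From mathcomp Require Import all_classical all_reals all_analysis.

Set Implicit Arguments.
Unset Strict Implicit.
Unset Printing Implicit Defensive.

Import Order.TTheory GRing.Theory Num.Theory.
Import numFieldNormedType.Exports.

Local Open Scope classical_set_scope.
Local Open Scope ring_scope.

Section PowerSeries.
Variables (K : numFieldType) (n : nat).

Definition multi_index := {ffun 'I_n -> nat}.

Definition monomial (v : 'rV[K]_n) (al : multi_index) : K :=
  \prod_(i < n) v 0 i ^+ al i.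

(* The sum over the multi-indices all of whose entries are < N. *)
Definition partial_sum (c : multi_index -> K) (v : 'rV[K]_n) (N : nat) : K :=
  \sum_(al : {ffun 'I_n -> 'I_N})
    let al' : multi_index := [ffun i => nat_of_ord (al i)] in
    c al' * monomial v al'.

(* f is, on some polydisc centred at a, the sum of an absolutely convergent
   power series in v = z - a.  A function is holomorphic on an open set iff
   this holds at every point of it, and a function with this property at a has
   it at every point near a. *)
Definition analytic_at (f : 'rV[K]_n -> K) (a : 'rV[K]_n) : Prop :=
  exists (c : multi_index -> K) (rho : K),
    [/\ 0 < rho,
        exists M : K, forall N : nat,
          partial_sum (fun al => `|c al|) (const_mx rho) N <= M
      & forall v : 'rV[K]_n, (forall i, `|v 0 i| <= rho) ->
          partial_sum c v N @[N --> \oo] --> f (a + v)].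

End PowerSeries.

Section Manifolds.
Variables (K : numFieldType) (n : nat).

(* A homeomorphism [coord] from the open set [cdom] of T onto an open set of
   K^n; [coord_inv] is only relevant on [coord @` cdom]. *)
Record chart (T : topologicalType) := Chart {
  cdom : set T;
  coord : T -> 'rV[K]_n;
  coord_inv : 'rV[K]_n -> T;
  cdom_open : open cdom;
  ccod_open : open (coord @` cdom);
  coordK : forall q, cdom q -> coord_inv (coord q) = q;
  coord_continuous : forall q, cdom q -> {for q, continuous coord};
  coord_inv_continuous :
    forall q, cdom q -> {for coord q, continuous coord_inv}
}.

Definition analytic_transition (T : topologicalType) (x y : chart T) : Prop :=
  forall q, cdom x q -> cdom y q ->
    forall i, analytic_at (fun v => coord y (coord_inv x v) 0 i) (coord x q).

Definition compatible (T : topologicalType) (x y : chart T) : Prop :=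
  analytic_transition x y /\ analytic_transition y x.

Record manifold := Manifold {
  space :> topologicalType;
  manifold_hausdorff : hausdorff_space space;
  manifold_second_countable : @second_countable space;
  atlas : set (chart space);
  atlas_cover : forall q, exists2 x, atlas x & cdom x q;
  atlas_compatible : forall x y, atlas x -> atlas y -> compatible x y
}.

End Manifolds.

Section Germs.
Variables (K : numFieldType) (n : nat) (S : manifold K n) (p : S).

(* Complex coordinates of S at p, vanishing at p. *)
Definition coordinates_at (x : chart K n S) : Prop :=
  [/\ cdom x p, coord x p = 0 & forall c, atlas c -> compatible x c].

(* Germs at p are handled through representatives S -> K, taken up to
   [germ_eq]; those satisfying [holo_at] represent the elements of O_{S,p}. *)
Definition holo_at (f : S -> K) : Prop :=
  forall c, atlas c -> cdom c p ->
    analytic_at (fun v => f (coord_inv c v)) (coord c p).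

Definition germ_eq (f g : S -> K) : Prop := \forall q \near p, f q = g q.

Definition set_germ_eq (A B : set S) : Prop :=
  \forall q \near p, A q <-> B q.

Definition germ_unit (f : S -> K) : Prop :=
  exists2 g, holo_at g & germ_eq (fun q => f q * g q) (fun=> 1).

Definition square_free (h : S -> K) : Prop :=
  ~ germ_eq h (fun=> 0) /\
  forall g k, holo_at g -> holo_at k ->
    germ_eq h (fun q => g q ^+ 2 * k q) -> germ_unit g.

(* h is a (reduced) defining equation of the germ (D, p). *)
Definition defining_equation (D : set S) (h : S -> K) : Prop :=
  [/\ holo_at h, square_free h & set_germ_eq D [set q | h q = 0]].

Definition analytic_germ (A : set S) : Prop :=
  exists (r : nat) (f : 'I_r -> S -> K),
    (forall j, holo_at (f j)) /\
    set_germ_eq A [set q | forall j, f j q = 0].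

Definition irreducible_germ (A : set S) : Prop :=
  [/\ analytic_germ A, A p
    & forall B C, analytic_germ B -> analytic_germ C ->
        set_germ_eq A (B `|` C) -> set_germ_eq A B \/ set_germ_eq A C].

Definition irreducible_components (D : set S) (m : nat)
    (D_ : 'I_m -> set S) : Prop :=
  [/\ forall i, irreducible_germ (D_ i),
      forall i j, (\forall q \near p, D_ i q -> D_ j q) -> i = j
    & set_germ_eq D (\bigcup_i D_ i)].

(* The hypersurface germ (D, p) is a submanifold of codimension 1. *)
Definition smooth_hypersurface_at (D : set S) : Prop :=
  exists (y : chart K n S) (i : 'I_n),
    coordinates_at y /\ defining_equation D (fun q => coord y q 0 i).

Definition normal_crossings_at (D : set S) : Prop :=
  exists (y : chart K n S) (k : nat),
    [/\ coordinates_at y, (k <= n)%N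
      & defining_equation D (fun q => \prod_(i < n | (i < k)%N) coord y q 0 i)].

Definition radical (I : set (S -> K)) : set (S -> K) :=
  [set g | holo_at g /\ exists k : nat, I (fun q => g q ^+ k)].

Section Coordinates.
Variable x : chart K n S.

Definition pderiv (i : 'I_n) (f : S -> K) (q : S) : K :=
  'D_(delta_mx 0 i) ((fun v => f (coord_inv x v)) : 'rV[K]_n -> K^o) (coord x q).

Definition jacobian_ideal (f : S -> K) : set (S -> K) :=
  [set g | holo_at g /\
    exists a : 'I_n -> S -> K, (forall i, holo_at (a i)) /\
      germ_eq g (fun q => \sum_(i < n) a i q * pderiv i f q)].

(* The family a stands for the vector field \sum_i a_i d/dx_i. *)
Definition vector_field_at (a : 'I_n -> S -> K) : Prop :=
  forall i, holo_at (a i).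

Definition log_derivation (h : S -> K) (a : 'I_n -> S -> K) : Prop :=
  vector_field_at a /\
  exists2 b, holo_at b &
    germ_eq (fun q => \sum_(i < n) a i q * pderiv i h q)
            (fun q => b q * h q).

(* Der(log D), for D = {h = 0}, has a basis; a basis is necessarily finite,
   as Der(log D) is a submodule of a free module of rank n over the domain
   O_{S,p}. *)
Definition free_divisor_at (h : S -> K) : Prop :=
  exists (r : nat) (delta : 'I_r -> 'I_n -> S -> K),
    [/\ forall j, log_derivation h (delta j),
        forall a, log_derivation h a ->
          exists c : 'I_r -> S -> K, (forall j, holo_at (c j)) /\
            forall i, germ_eq (a i) (fun q => \sum_(j < r) c j q * delta j i q)
      & forall c : 'I_r -> S -> K, (forall j, holo_at (c j)) ->
          (forall i,
            germ_eq (fun q => \sum_(j < r) c j q * delta j i q) (fun=> 0)) ->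
          forall j, germ_eq (c j) (fun=> 0)].

End Coordinates.
End Germs.

Definition is_divisor (K : numFieldType) (n : nat) (S : manifold K n)
    (D : set S) : Prop :=
  forall p, exists f : S -> K,
    [/\ holo_at p f, ~ germ_eq p f (fun=> 0)
      & set_germ_eq p D [set q | f q = 0]].

Definition complex_manifold (R : realType) (n : nat) := manifold R[i] n.

(* Main.v *)
(* The equation [h_i] of a smooth branch is a coordinate times a unit, so it is
   prime in the local ring and has a nonzero differential at [p].  A germ
   vanishing at [p] has a power in its Jacobian ideal: otherwise some prime would
   contain all its derivatives but not the germ, whereas a function whose
   tangential derivatives vanish on a subvariety is constant there.  Hence
   [h ^ N] lies in [J_h] for some [N].  With [g_i] the product of the [h_k], k <> i, the
   identity [g_i ^ 2 * d_j h_i = g_i * d_j h - h * d_j g_i] then puts [g_i] in the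
   radical of [J_h], hence in [J_h] itself: [g_i = delta_i h] for some vector
   field [delta_i].  Comparing modulo [h_i] and modulo [h_k], which are distinct
   primes, gives [delta_i h_i (p) = 1] and [delta_i h_k (p) = 0], so the
   differentials of the [h_i] at [p] are linearly independent and the [h_i] are
   part of a coordinate system. *)

Require Import Defs.
From HB Require Import structures.
From mathcomp Require Import all_boot all_order all_algebra.
From mathcomp Require Import complex.
From mathcomp Require Import all_classical all_reals all_analysis.
From mathcomp Require Import ring lra zify.

Set Implicit Arguments.
Unset Strict Implicit.
Unset Printing Implicit Defensive.

Import Order.TTheory GRing.Theory Num.Theory.
Import numFieldNormedType.Exports.

Local Open Scope classical_set_scope.
Local Open Scope ring_scope.

(** * Power series *)

(** The delicate point is constancy along a subvariety that may be singular and is known only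
    through a prime ideal. It is turned into algebra: a morphism [f] from germs to a field has that
    prime as kernel, and a quotient [f a / f b] killed by all vector fields preserving the kernel is
    shown to be a complex constant, by induction on the number of variables. When the kernel is not
    zero, Weierstrass division makes every [f s] integral over the germs in one variable less, so
    the quotient has a minimal relation; tangent fields lift up to a nonzero factor, differentiating
    the relation shows its coefficients to be proportional to constants, and the quotient is a root
    of a complex polynomial. Quotients are treated, not single germs, because the coefficients
    become constant only after division by the leading one. The main analytic input is Weierstrass
    division, a contraction for the majorant norm. This is why a series in several variables is a
    series in the last one over series in the others, and why germs form an abstract ring, tied to
    functions by evaluation near 0 and the identity theorem. *)

Record ps (A : Type) := Ps { psc : nat -> A }.

Lemma psP (A : Type) (s t : ps A) : (forall k, psc s k = psc t k) -> s = t.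
Proof. by case: s => s; case: t => t /= /funext ->. Qed.

HB.instance Definition _ (A : Type) := gen_eqMixin (ps A).
HB.instance Definition _ (A : Type) := gen_choiceMixin (ps A).

Section PsRing.
Variable A : comNzRingType.
Implicit Types s t u : ps A.

Definition ps0 : ps A := Ps (fun=> 0).
Definition psopp s : ps A := Ps (fun k => - psc s k).
Definition psadd s t : ps A := Ps (fun k => psc s k + psc t k).

Lemma psaddA : associative psadd.
Proof. by move=> s t u; apply: psP => k /=; rewrite addrA. Qed.
Lemma psaddC : commutative psadd.
Proof. by move=> s t; apply: psP => k /=; rewrite addrC. Qed.
Lemma psadd0 : left_id ps0 psadd.
Proof. by move=> s; apply: psP => k /=; rewrite add0r. Qed.
Lemma psaddN : left_inverse ps0 psopp psadd.
Proof. by move=> s; apply: psP => k /=; rewrite addNr. Qed.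

HB.instance Definition _ := GRing.isZmodule.Build (ps A) psaddA psaddC psadd0 psaddN.

Definition ps1 : ps A := Ps (fun k => (k == 0)%:R).
Definition psmul s t : ps A :=
  Ps (fun k => \sum_(j < k.+1) psc s j * psc t (k - j)).

Definition pstrunc N s : {poly A} := \poly_(i < N) psc s i.

(** A coefficient of a product involves no coefficient of higher index, so it may be computed on
    polynomial truncations; associativity, commutativity and the Leibniz rule are inherited from
    polynomials this way. *)
Lemma psmul_trunc N s t k :
  (k < N)%N -> psc (psmul s t) k = (pstrunc N s * pstrunc N t)`_k.
Proof.
move=> kN; rewrite coefM; apply: eq_bigr => j _ /=; rewrite !coef_poly.
have jk : (j <= k)%N by rewrite -ltnS.
by rewrite (leq_ltn_trans jk kN) (leq_ltn_trans (leq_subr j k) kN).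
Qed.

Lemma psmulA : associative psmul.
Proof.
move=> s t u; apply: psP => k.
transitivity ((pstrunc k.+1 s * pstrunc k.+1 t * pstrunc k.+1 u)`_k).
  rewrite -mulrA coefM; apply: eq_bigr => j _.
  rewrite (@psmul_trunc k.+1) ?ltnS ?leq_subr// !coef_poly.
  by rewrite (leq_ltn_trans _ (ltnSn k)) // -ltnS.
rewrite coefM; apply: eq_bigr => j _.
by rewrite (@psmul_trunc k.+1)// !coef_poly ltnS leq_subr.
Qed.

Lemma psmulC : commutative psmul.
Proof.
by move=> s t; apply: psP => k; rewrite !(@psmul_trunc k.+1)// mulrC.
Qed.

Lemma psmul1 : left_id ps1 psmul.
Proof.
move=> s; apply: psP => k /=; rewrite big_ord_recl /= mul1r subn0.
by rewrite big1 ?addr0// => i _; rewrite mul0r.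
Qed.

Lemma psmulDl : left_distributive psmul +%R.
Proof.
move=> s t u; apply: psP => k /=; rewrite -big_split /=.
by apply: eq_bigr => j _; rewrite mulrDl.
Qed.

Lemma ps1_neq0 : ps1 != 0.
Proof. by apply/eqP => /(congr1 (fun s => psc s 0)) /= /eqP; rewrite oner_eq0. Qed.

HB.instance Definition _ := GRing.Zmodule_isComNzRing.Build (ps A)
  psmulA psmulC psmul1 psmulDl ps1_neq0.

Lemma pscD s t k : psc (s + t) k = psc s k + psc t k. Proof. by []. Qed.
Lemma pscM s t k : psc (s * t) k = \sum_(j < k.+1) psc s j * psc t (k - j).
Proof. by []. Qed.
Lemma psc_sum I (r : seq I) (P : pred I) (f : I -> ps A) k :
  psc (\sum_(i <- r | P i) f i) k = \sum_(i <- r | P i) psc (f i) k.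
Proof. by apply: (big_morph (fun s => psc s k)). Qed.

Definition psC (a : A) : ps A := Ps (fun k => if k == 0 then a else 0).
Definition psX : ps A := Ps (fun k => (k == 1)%:R).
Definition psshift s : ps A := Ps (fun k => psc s k.+1).

Lemma psCM_coef a s k : psc (psC a * s) k = a * psc s k.
Proof.
rewrite pscM big_ord_recl /= subn0 big1 ?addr0// => i _.
by rewrite mul0r.
Qed.

Lemma psC_zmod : zmod_morphism psC.
Proof. by move=> a b; apply: psP => -[|k] //=; rewrite subrr. Qed.
Lemma psC_monoid : monoid_morphism psC.
Proof.
by split=> [|a b]; apply: psP => k; rewrite ?psCM_coef //=; case: eqP => //; rewrite mulr0.
Qed.
HB.instance Definition _ := GRing.isZmodMorphism.Build A (ps A) psC psC_zmod.
HB.instance Definition _ := GRing.isMonoidMorphism.Build A (ps A) psC psC_monoid.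

Lemma psXM_coef s k : psc (psX * s) k = if k is k'.+1 then psc s k' else 0.
Proof.
rewrite pscM; case: k => [|k]; first by rewrite big_ord1 /= mul0r.
rewrite big_ord_recl /= mul0r add0r big_ord_recl /= mul1r subSS subn0.
by rewrite big1 ?addr0// => i _; rewrite mul0r.
Qed.

Lemma psXnM_coef d s k :
  psc (psX ^+ d * s) k = if (k < d)%N then 0 else psc s (k - d).
Proof.
elim: d k => [|d IH] k; first by rewrite expr0 mul1r subn0.
by rewrite exprS -mulrA psXM_coef; case: k => [|k] //; rewrite IH.
Qed.

Lemma ps_split s : s = psC (psc s 0) + psX * psshift s.
Proof.
by apply: psP => -[|k]; rewrite pscD psXM_coef /= ?addr0 ?add0r.
Qed.

Definition psderiv s : ps A := Ps (fun k => psc s k.+1 *+ k.+1).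

Lemma psderiv_zmod : zmod_morphism psderiv.
Proof. by move=> s t; apply: psP => k /=; rewrite mulrnBl. Qed.
HB.instance Definition _ := GRing.isZmodMorphism.Build (ps A) (ps A) psderiv psderiv_zmod.

Lemma psderiv_trunc N s : (pstrunc N.+1 s)^`() = pstrunc N (psderiv s).
Proof.
apply/polyP => k; rewrite coef_deriv !coef_poly ltnS.
by case: ifP; rewrite ?mul0rn.
Qed.

Lemma psderivM s t : psderiv (s * t) = psderiv s * t + s * psderiv t.
Proof.
apply: psP => k; rewrite pscD /=.
rewrite -[\sum_(j < k.+2) _]/(psc (psmul s t) k.+1) (@psmul_trunc k.+2)//.
rewrite -coef_deriv derivM coefD !psderiv_trunc; congr (_ + _).
  rewrite (_ : \sum_(j < k.+1) _ = psc (psmul (psderiv s) t) k)//.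
  rewrite (@psmul_trunc k.+1)// !coefM; apply: eq_bigr => j _.
  by rewrite !coef_poly !ltnS leq_subr (leq_trans (leq_subr _ _)).
rewrite (_ : \sum_(j < k.+1) _ = psc (psmul s (psderiv t)) k)//.
rewrite (@psmul_trunc k.+1)// !coefM; apply: eq_bigr => j _.
have jk : (j <= k)%N by rewrite -ltnS.
by rewrite !coef_poly !ltnS leq_subr jk (leq_trans jk).
Qed.

Lemma psderivC a : psderiv (psC a) = 0.
Proof. by apply: psP => k /=; rewrite mul0rn. Qed.
Lemma psderivX : psderiv psX = 1.
Proof. by apply: psP => -[|k] //=; rewrite mul0rn. Qed.

End PsRing.

(** The lowest nonzero coefficients, of indices [i] and [j], give the only surviving term of the
    coefficient [i + j] of the product. *)
Lemma ps_domain (A : comNzRingType) :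
  (forall a b : A, a * b = 0 -> a = 0 \/ b = 0) ->
  forall s t : ps A, s * t = 0 -> s = 0 \/ t = 0.
Proof.
move=> dom s t st0; apply: contrapT => /not_orP[s0 t0].
have ex (u : ps A) : u <> 0 -> exists k, psc u k != 0.
  move=> u0; apply: contrapT => H; apply: u0; apply: psP => k.
  by apply/eqP; apply/negPn/negP => uk; apply: H; exists k.
case/ex/ex_minnP: s0 => i si mini; case/ex/ex_minnP: t0 => j tj minj.
have : psc (s * t) (i + j) = 0 by rewrite st0.
have ile : (i < (i + j).+1)%N by rewrite ltnS leq_addr.
rewrite pscM (bigD1 (Ordinal ile)) //= addKn big1 ?addr0.
  by case/dom => /eqP; [rewrite (negPf si)|rewrite (negPf tj)].
move=> k /eqP kNi; case: (ltngtP k i) => [ki|ik|kei].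
- have [->|/mini] := eqVneq (psc s k) 0; rewrite ?mul0r// => ik.
  by rewrite ltnNge ik in ki.
- have [->|/minj] := eqVneq (psc t (i + j - k)) 0; rewrite ?mulr0// => jle.
  have kij : (k <= i + j)%N by rewrite -ltnS.
  rewrite leq_subRL // leq_add2r in jle.
  by rewrite ltnNge jle in ik.
- by case: kNi; apply: val_inj.
Qed.

Section Iterated.
Variable R : realType.
Local Notation C := R[i].

(* The coefficients of a series in [m.+1] variables, as a series in the last
   variable, are series in the first [m] variables. *)
Fixpoint F (n : nat) : comNzRingType :=
  if n is m.+1 then (ps (F m) : comNzRingType) else (C : comNzRingType).

Arguments F n : simpl never.

Lemma F_domain n (s t : F n) : s * t = 0 -> s = 0 \/ t = 0.
Proof.
elim: n s t => [|n IH] s t; last exact: (ps_domain IH).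
by move/eqP; rewrite mulf_eq0 => /orP[]/eqP; [left|right].
Qed.

End Iterated.
Arguments F R n : simpl never.

(** * The real-valued modulus and Cauchy sequences of complex numbers *)

Section Modulus.
Variable R : realType.
Local Notation C := R[i].
Implicit Types z : C.

(* The norm of [R[i]] takes its values in [R[i]]; this is its real version. *)
Definition nc z : R := ComplexField.Normc.normc z.

Lemma nc_norm z : `|z| = (nc z)%:C%C.
Proof. by case: z. Qed.
Lemma nc0 : nc 0 = 0. Proof. exact: ComplexField.Normc.normc0. Qed.
Lemma nc1 : nc 1 = 1. Proof. exact: ComplexField.Normc.normc1. Qed.
Lemma ncM z w : nc (z * w) = nc z * nc w. Proof. exact: ComplexField.Normc.normcM. Qed.
Lemma ncV z : nc z^-1 = (nc z)^-1. Proof. exact: ComplexField.Normc.normcV. Qed.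
Lemma ncD z w : nc (z + w) <= nc z + nc w. Proof. exact: le_normcD. Qed.
Lemma ncN z : nc (- z) = nc z. Proof. exact: normcN. Qed.
Lemma nc_ge0 z : 0 <= nc z. Proof. by case: z => a b; exact: sqrtr_ge0. Qed.
Lemma nc_eq0 z : nc z = 0 -> z = 0. Proof. exact: ComplexField.Normc.eq0_normc. Qed.
Lemma nc_gt0 z : z != 0 -> 0 < nc z.
Proof. by move=> z0; rewrite lt_def nc_ge0 andbT; apply: contra z0 => /eqP/nc_eq0/eqP. Qed.
Lemma ncB z w : nc (z - w) <= nc z + nc w. Proof. by rewrite -(ncN w) ncD. Qed.
Lemma nc_dist z w : nc (z - w) = nc (w - z). Proof. by rewrite -opprB ncN. Qed.
Lemma nc_dist3 a b c : nc (a - c) <= nc (a - b) + nc (b - c).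
Proof. by rewrite -[a - c](_ : (a - b) + (b - c) = _) ?ncD//; ring. Qed.
Lemma ncX z k : nc (z ^+ k) = nc z ^+ k.
Proof. by elim: k => [|k IH]; rewrite ?expr0 ?nc1// !exprS ncM IH. Qed.
Lemma nc_sum I (r : seq I) (P : pred I) (f : I -> C) :
  nc (\sum_(i <- r | P i) f i) <= \sum_(i <- r | P i) nc (f i).
Proof.
elim/big_ind2: _ => [|x1 x2 y1 y2 h1 h2|//]; first by rewrite nc0.
by rewrite (le_trans (ncD _ _))// lerD.
Qed.
Lemma nc_real (a : R) : nc a%:C%C = `|a|.
Proof. by rewrite /nc /= expr0n /= addr0 sqrtr_sqr. Qed.
Lemma nc_nat k : nc k%:R = k%:R.
Proof. by rewrite -(rmorph_nat (real_complex R)) nc_real ger0_norm. Qed.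
Lemma nc_Re z : `|complex.Re z| <= nc z.
Proof. by rewrite -sqrtr_sqr; case: z => a b /=; rewrite ler_wsqrtr// lerDl sqr_ge0. Qed.
Lemma nc_Im z : `|complex.Im z| <= nc z.
Proof. by rewrite -sqrtr_sqr; case: z => a b /=; rewrite ler_wsqrtr// lerDr sqr_ge0. Qed.
Lemma nc_ReIm z : nc z <= `|complex.Re z| + `|complex.Im z|.
Proof.
case: z => a b.
have {1}-> : (a +i* b)%C = a%:C%C + (0 +i* b)%C.
  by apply/eqP; rewrite eq_complex /= addr0 add0r !eqxx.
rewrite (le_trans (ncD _ _))// nc_real /= lerD2l /nc /= expr0n /= add0r.
by rewrite sqrtr_sqr.
Qed.

(** The intervals of centre [a L] and radius [t L] meet pairwise, so the supremum of their left ends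
    lies in all of them. *)
Lemma real_cauchy (a t : nat -> R) :
  (forall L L', (L <= L')%N -> `|a L - a L'| <= t L) ->
  exists l, forall L, `|a L - l| <= t L.
Proof.
move=> at_; have cross L L' : a L - t L <= a L' + t L'.
  have [/at_|/ltnW/at_] := leqP L L'; rewrite ler_norml => /andP[h1 h2];
  have := le_trans (normr_ge0 _) (at_ L L (leqnn _));
  have := le_trans (normr_ge0 _) (at_ L' L' (leqnn _)); lra.
exists (sup [set a L - t L | L in setT]) => L.
have hs : has_sup [set a L - t L | L in setT].
  split; first by exists (a 0%N - t 0%N); exists 0%N.
  by exists (a 0%N + t 0%N) => _ [L' _ <-]; exact: cross.
have h1 : a L - t L <= sup [set a L - t L | L in setT].
  by apply: sup_upper_bound => //; exists L.
have h2 : sup [set a L - t L | L in setT] <= a L + t L.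
  by apply: ge_sup => [|_ [L' _ <-]]; [case: hs|exact: cross].
rewrite ler_norml; apply/andP; split; lra.
Qed.

Lemma le_lim_eps (a b : R) : (forall e, 0 < e -> a <= b + e) -> a <= b.
Proof.
move=> h; rewrite leNgt; apply/negP => ba.
have := h ((a - b) / 2) ltac:(by rewrite divr_gt0 ?subr_gt0). lra.
Qed.

(** The limits of the real and imaginary parts give only the bound [2 * t L]; comparison with a far
    index, where [t] is small, removes the factor 2. *)
Lemma complex_cauchy (a : nat -> C) (t : nat -> R) :
  (forall L L', (L <= L')%N -> nc (a L - a L') <= t L) ->
  (forall e, 0 < e -> exists2 N, forall L, (N <= L)%N -> t L <= e & True) ->
  exists l, forall L, nc (a L - l) <= t L.
Proof.
move=> at_ t0.
have [|x hx] := @real_cauchy (fun L => complex.Re (a L)) t.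
  move=> L L' LL'; rewrite (le_trans _ (at_ _ _ LL'))//.
  by rewrite (le_trans _ (nc_Re _))//; case: (a L) (a L') => ? ? [? ?].
have [|y hy] := @real_cauchy (fun L => complex.Im (a L)) t.
  move=> L L' LL'; rewrite (le_trans _ (at_ _ _ LL'))//.
  by rewrite (le_trans _ (nc_Im _))//; case: (a L) (a L') => ? ? [? ?].
have h2 L : nc (a L - (x +i* y)%C) <= 2 * t L.
  rewrite (le_trans (nc_ReIm _))// mulr2n mulrDl mul1r lerD//.
  - by rewrite (le_trans _ (hx L))//; case: (a L).
  - by rewrite (le_trans _ (hy L))//; case: (a L).
exists (x +i* y)%C => L; apply: le_lim_eps => e e0.
have [|N hN _] := t0 (e / 2); first by rewrite divr_gt0.
pose L' := maxn L N.
have := nc_dist3 (a L) (a L') (x +i* y)%C.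
have := at_ L L' (leq_maxl _ _); have := h2 L'; have := hN L' (leq_maxr _ _).
lra.
Qed.

End Modulus.

(** The antidiagonals of index below [N] fill the triangle [j + l < N]; this compares the truncation
    of a Cauchy product with the product of truncations. *)
Lemma sum_triangle (V : zmodType) N (f : nat -> nat -> V) :
  \sum_(k < N) \sum_(j < k.+1) f j (k - j)%N =
  \sum_(j < N) \sum_(l < N | (j + l < N)%N) f j l.
Proof.
transitivity (\sum_(j < N) \sum_(l < N - j) f j l); last first.
  apply: eq_bigr => j _; rewrite (big_ord_widen N) ?leq_subr//.
  by apply: eq_bigl => l; rewrite ltn_subRL.
elim: N => [|N IH]; first by rewrite !big_ord0.
rewrite big_ord_recr /= IH.
transitivity (\sum_(j < N.+1) (\sum_(l < N - j) f j l + f j (N - j)%N)).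
  by rewrite big_split /= [in RHS]big_ord_recr /= subnn big_ord0 addr0.
apply: eq_bigr => j _; have jN : (j <= N)%N by rewrite -ltnS.
by rewrite subSn// big_ord_recr.
Qed.

(** * Majorant norms on polydiscs *)

Section Norms.
Variable R : realType.
Local Notation C := R[i].
Local Notation F := (F R).
Implicit Types (n N : nat) (r : nat -> R).

Lemma FcM n (s t : F n.+1) k :
  psc (s * t) k = \sum_(j < k.+1) psc s j * psc t (k - j).
Proof. by []. Qed.

Lemma FcB n (s t : F n.+1) k : psc (s - t) k = psc s k - psc t k.
Proof. by []. Qed.

Lemma FcD n (s t : F n.+1) k : psc (s + t) k = psc s k + psc t k.
Proof. by []. Qed.

Lemma Fc_sum n I (rg : seq I) (P : pred I) (f : I -> F n.+1) k :
  psc (\sum_(i <- rg | P i) f i) k = \sum_(i <- rg | P i) psc (f i) k.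
Proof. exact: psc_sum. Qed.

(* Partial sums, over the multi-indices with entries < N, of the majorant
   series and of the series itself. *)
Fixpoint cs n N r : F n -> R :=
  match n return F n -> R with
  | 0 => fun s => nc s
  | m.+1 => fun s => \sum_(k < N) cs N r (psc s k) * r m ^+ k
  end.

Fixpoint pev n N (v : nat -> C) : F n -> C :=
  match n return F n -> C with
  | 0 => fun s => s
  | m.+1 => fun s => \sum_(k < N) pev N v (psc s k) * v m ^+ k
  end.

(** Absolute convergence on the closed polydisc of radii [r], with majorant norm at most [M];
    bounding every partial sum avoids mentioning the limit. *)
Definition bnd n r M (s : F n) := forall N, cs N r s <= M.

Section Fixed.
Variable r : nat -> R.
Hypothesis r0 : forall i, 0 < r i.

Let rX_ge0 i k : 0 <= r i ^+ k. Proof. by rewrite exprn_ge0// ltW. Qed.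
Let rX_gt0 i k : 0 < r i ^+ k. Proof. by rewrite exprn_gt0. Qed.
Hint Resolve rX_ge0 rX_gt0 : core.

Lemma cs_ge0 n N (s : F n) : 0 <= cs N r s.
Proof.
elim: n s => [|n IH] s /=; first exact: nc_ge0.
by apply: sumr_ge0 => k _; rewrite mulr_ge0.
Qed.
Hint Resolve cs_ge0 : core.

Lemma cs0 n N : cs N r (0 : F n) = 0.
Proof.
elim: n => [|n IH] /=; first exact: nc0.
by rewrite big1// => k _; rewrite IH mul0r.
Qed.

Lemma csN n N (s : F n) : cs N r (- s) = cs N r s.
Proof.
elim: n s => [|n IH] s /=; first exact: ncN.
by apply: eq_bigr => k _; rewrite IH.
Qed.

Lemma csD n N (s t : F n) : cs N r (s + t) <= cs N r s + cs N r t.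
Proof.
elim: n s t => [|n IH] s t /=; first exact: ncD.
by rewrite -big_split ler_sum// => k _ /=; rewrite -mulrDl ler_pM2r.
Qed.

Lemma cs_sum n N I (rg : seq I) (P : pred I) (f : I -> F n) :
  cs N r (\sum_(i <- rg | P i) f i) <= \sum_(i <- rg | P i) cs N r (f i).
Proof.
elim/big_ind2: _ => [|x1 x2 y1 y2 h1 h2|//]; first by rewrite cs0.
by rewrite (le_trans (csD _ _ _))// lerD.
Qed.

Lemma cs_mono n N N' (s : F n) : (N <= N')%N -> cs N r s <= cs N' r s.
Proof.
move=> NN'; elim: n s => [|n IH] s //=.
rewrite (big_ord_widen _ (fun k => cs N r (psc s k) * r n ^+ k) NN').
rewrite (bigID (fun k : 'I_N' => (k < N)%N) predT) /=.
rewrite ler_wpDr ?sumr_ge0// => [k _|]; first by rewrite mulr_ge0.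
by rewrite ler_sum// => k _; rewrite ler_pM2r.
Qed.

(** The truncated product keeps only the triangle [j + l < N] of the square of pairs that occurs on
    the right, and majorant terms are nonnegative. *)
Lemma csM n N (s t : F n) : cs N r (s * t) <= cs N r s * cs N r t.
Proof.
elim: n s t => [|n IH] s t; first by rewrite /= -ncM.
rewrite (@le_trans _ _
  (\sum_(k < N) \sum_(j < k.+1) (cs N r (psc s j) * r n ^+ j) *
    (cs N r (psc t (k - j)) * r n ^+ (k - j))))//.
  apply: ler_sum => k _; rewrite pscM.
  rewrite (le_trans (ler_wpM2r _ (cs_sum _ _ _ _)))// big_distrl /=.
  apply: ler_sum => j _; have jk : (j <= k)%N by rewrite -ltnS.
  by rewrite mulrACA -exprD subnKC// ler_pM2r.
rewrite (sum_triangle _ (fun j l => cs N r (psc s j) * r n ^+ j * (cs N r (psc t l) * r n ^+ l))).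
rewrite /= big_distrl /=; apply: ler_sum => j _; rewrite big_distrr /= big_mkcond.
by apply: ler_sum => l _; case: ifP => // _; rewrite !mulr_ge0.
Qed.

Lemma bnd_ge0 n M (s : F n) : bnd r M s -> 0 <= M.
Proof. by move=> /(_ 0%N); apply: le_trans. Qed.

Lemma bnd_le n M M' (s : F n) : M <= M' -> bnd r M s -> bnd r M' s.
Proof. by move=> MM' h N; rewrite (le_trans (h N)). Qed.

Lemma bnd0 n : bnd r 0 (0 : F n). Proof. by move=> N; rewrite cs0. Qed.
Lemma bndN n M (s : F n) : bnd r M s -> bnd r M (- s).
Proof. by move=> h N; rewrite csN. Qed.
Lemma bndD n M M' (s t : F n) : bnd r M s -> bnd r M' t -> bnd r (M + M') (s + t).
Proof. by move=> h h' N; rewrite (le_trans (csD _ _ _))// lerD. Qed.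
Lemma bndB n M M' (s t : F n) : bnd r M s -> bnd r M' t -> bnd r (M + M') (s - t).
Proof. by move=> h h'; apply: bndD => //; apply: bndN. Qed.
Lemma bndM n M M' (s t : F n) : bnd r M s -> bnd r M' t -> bnd r (M * M') (s * t).
Proof. by move=> h h' N; rewrite (le_trans (csM _ _ _))// ler_pM. Qed.

Lemma bnd_psC n M (s : F n) : bnd r M s -> bnd r M (psC s : F n.+1).
Proof.
move=> h [|N] /=; first by rewrite big_ord0 (bnd_ge0 h).
rewrite big_ord_recl /= expr0 mulr1 big1 ?addr0//= => k _.
by rewrite cs0 mul0r.
Qed.

Lemma bnd1 n : bnd r 1 (1 : F n).
Proof.
elim: n => [|n IH]; first by move=> N; rewrite -[leRHS](nc1 R); exact: lexx.
by rewrite -(rmorph1 (@psC (F n))); apply: bnd_psC.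
Qed.

Lemma bndX n M (s : F n) k : bnd r M s -> bnd r (M ^+ k) (s ^+ k).
Proof.
by move=> h; elim: k => [|k IH]; rewrite ?expr0 ?exprS; [exact: bnd1|exact: bndM].
Qed.

Lemma bnd_psX n : bnd r (r n) (psX (F n) : F n.+1).
Proof.
case=> [|[|N]] /=; first by rewrite big_ord0 ltW.
  by rewrite big_ord1 /= cs0 mul0r ltW.
rewrite 2!big_ord_recl /= cs0 mul0r add0r big1 ?addr0 => [|k _]; last by rewrite mul0r.
by rewrite expr1 -[leRHS]mul1r ler_pM2r// (bnd1 n N.+2).
Qed.

(** Cauchy's estimate: one term of a sum of nonnegative terms. The order [maxn N k.+1] is large
    enough for the [k]-th term to occur. *)
Lemma bnd_coef n M (s : F n.+1) k : bnd r M s -> bnd r (M / r n ^+ k) (psc s k).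
Proof.
move=> h N; rewrite ler_pdivlMr//.
have := h (maxn N k.+1); apply: le_trans; rewrite /= (bigD1 (Ordinal (leq_maxr N k.+1)))//=.
rewrite ler_wpDr ?sumr_ge0// => [l _|]; first by rewrite mulr_ge0.
by rewrite ler_pM2r// cs_mono// leq_maxl.
Qed.

Lemma bnd_eps n (s : F n) : (forall e, 0 < e -> bnd r e s) -> s = 0.
Proof.
elim: n s => [|n IH] s h.
  apply: nc_eq0; apply/eqP; rewrite eq_le nc_ge0 andbT.
  by apply: le_lim_eps => e e0; rewrite add0r; exact: (h e e0 0%N).
apply: psP => k; apply: IH => e e0.
have := bnd_coef k (h (e * r n ^+ k) ltac:(by rewrite mulr_gt0)).
by rewrite mulfK// lt0r_neq0.
Qed.

Definition nrm n (s : F n) : R := sup [set cs N r s | N in setT].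

Lemma nrm_bnd n M (s : F n) : bnd r M s -> bnd r (nrm s) s.
Proof.
move=> h N; apply: ub_le_sup; last by exists N.
by exists M => _ [N' _ <-]; apply: h.
Qed.

Lemma nrm_adh n M (s : F n) e : bnd r M s -> 0 < e -> exists N, nrm s - e < cs N r s.
Proof.
move=> h e0; have [|_ [N _ <-] lt] := @sup_adherent _ [set cs N r s | N in setT] _ e0.
  split; first by exists (cs 0%N r s); exists 0%N.
  by exists M => _ [N _ <-]; apply: h.
by exists N.
Qed.

(** Partial sums increase with their order, so finitely many suprema, one per coefficient, are
    approached at a common order [N]. *)
Lemma bnd_split n M (s : F n.+1) L :
  bnd r M s -> \sum_(k < L) nrm (psc s k) * r n ^+ k <= M.
Proof.
move=> h; apply: le_lim_eps => e e0.
have hc k := bnd_coef k h.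
(* Weighted by [r n ^+ k] and summed over [k < L], these errors stay below [e]; [L.+1] keeps the
   denominator nonzero for [L = 0]. *)
have [N hN] : exists N, forall k : 'I_L,
    nrm (psc s k) <= cs N r (psc s k) + e / (L.+1%:R * r n ^+ k).
  have e1 k : 0 < e / (L.+1%:R * r n ^+ k) by rewrite divr_gt0// mulr_gt0.
  have /choice[f hf] : forall k : 'I_L, exists N,
      nrm (psc s k) <= cs N r (psc s k) + e / (L.+1%:R * r n ^+ k).
    move=> k; have [N hN] := nrm_adh (hc k) (e1 k); exists N.
    by rewrite -lerBlDr ltW.
  exists (\max_k f k)%N => k; rewrite (le_trans (hf k))// lerD2r cs_mono//.
  exact: leq_bigmax.
rewrite (@le_trans _ _ (\sum_(k < L) (cs N r (psc s k) * r n ^+ k + e / L.+1%:R)))//.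
  apply: ler_sum => k _; rewrite (le_trans (ler_wpM2r _ (hN k)))// mulrDl lerD2l.
  by rewrite invfM [e * _]mulrA divfK ?lt0r_neq0.
rewrite big_split /= lerD//; last first.
  rewrite sumr_const card_ord -(mulr_natr _ L) mulrAC ler_pdivrMr// ler_pM2l//.
  by rewrite ler_nat.
have := h (maxn N L); apply: le_trans.
rewrite /= (big_ord_widen _ (fun k => cs N r (psc s k) * r n ^+ k) (leq_maxr N L)).
rewrite [leRHS](bigID (fun k : 'I_(maxn N L) => (k < L)%N) predT) /=.
rewrite ler_wpDr ?sumr_ge0// => [k _|]; first by rewrite mulr_ge0.
by rewrite ler_sum// => k _; rewrite ler_pM2r// cs_mono// leq_maxl.
Qed.

End Fixed.
End Norms.

(** * Convergence *)

Section ComplexLimits.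
Variable R : realType.
Local Notation C := R[i].
Implicit Types (a b : nat -> C) (l : C).

Definition clim a l :=
  forall e : R, 0 < e -> exists N0, forall N, (N0 <= N)%N -> nc (a N - l) <= e.

Lemma clim_le a l M : clim a l -> (exists N0, forall N, (N0 <= N)%N -> nc (a N) <= M) -> nc l <= M.
Proof.
move=> al [N1 aM]; apply: le_lim_eps => e /al[N0 h].
have := h _ (leq_maxl N0 N1); have := aM _ (leq_maxr N0 N1).
have := nc_dist3 l (a (maxn N0 N1)) 0; rewrite !subr0 (nc_dist l); lra.
Qed.

Lemma climB a b l l' : clim a l -> clim b l' -> clim (fun N => a N - b N) (l - l').
Proof.
move=> al bl e e0; have e20 : 0 < e / 2 by rewrite divr_gt0.
have [N0 h0] := al _ e20; have [N1 h1] := bl _ e20.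
exists (maxn N0 N1) => N; rewrite geq_max => /andP[/h0 + /h1].
have -> : a N - b N - (l - l') = (a N - l) - (b N - l') by ring.
have := ncB (a N - l) (b N - l'); lra.
Qed.

Lemma clim_cst l : clim (fun=> l) l.
Proof. by move=> e e0; exists 0%N => N _; rewrite subrr nc0 ltW. Qed.

Lemma climD a b l l' : clim a l -> clim b l' -> clim (fun N => a N + b N) (l + l').
Proof.
move=> al bl; have := climB al (climB (clim_cst 0) bl).
by rewrite sub0r opprK; under eq_fun do rewrite sub0r opprK.
Qed.

Lemma clim_uniq a l l' : clim a l -> clim a l' -> l = l'.
Proof.
move=> al al'; apply/eqP; rewrite -subr_eq0; apply/eqP/nc_eq0/eqP.
rewrite eq_le nc_ge0 andbT; apply: (clim_le (climB al al')).
by exists 0%N => N _; rewrite subrr nc0.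
Qed.

Lemma clim_near a b l : (exists N0, forall N, (N0 <= N)%N -> a N = b N) ->
  clim a l -> clim b l.
Proof.
move=> [N1 ab] al e /al[N0 h]; exists (maxn N0 N1) => N.
by rewrite geq_max => /andP[/h + /ab <-].
Qed.

Lemma clim_bounded a l : clim a l -> exists2 M, 0 < M & exists N0, forall N, (N0 <= N)%N -> nc (a N) <= M.
Proof.
move=> al; have [N0 h] := al 1 ltr01; exists (1 + nc l).
  by rewrite ltr_wpDr ?nc_ge0.
exists N0 => N /h; have := nc_dist3 (a N) l 0; rewrite !subr0; lra.
Qed.

Lemma climM a b l l' : clim a l -> clim b l' -> clim (fun N => a N * b N) (l * l').
Proof.
move=> al bl e e0; have [M M0 [N1 aM]] := clim_bounded al.
have [N0 h0] := al (e / (2 * (nc l' + 1))) ltac:(by rewrite divr_gt0// mulr_gt0// ltr_wpDl ?nc_ge0).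
have [N2 h2] := bl (e / (2 * M)) ltac:(by rewrite divr_gt0// mulr_gt0).
exists (maxn N0 (maxn N1 N2)) => N; rewrite !geq_max => /andP[/h0 h0N /andP[/aM aN /h2 h2N]].
have -> : a N * b N - l * l' = a N * (b N - l') + (a N - l) * l' by ring.
rewrite (le_trans (ncD _ _))// !ncM.
have h3 : nc (a N) * nc (b N - l') <= e / 2.
  rewrite (le_trans (ler_pM (nc_ge0 _) (nc_ge0 _) aN h2N))//.
  by rewrite invfM [e * _]mulrA mulrC divfK ?lt0r_neq0.
have h4 : nc (a N - l) * nc l' <= e / 2.
  rewrite (@le_trans _ _ (e / (2 * (nc l' + 1)) * (nc l' + 1)))//.
    by rewrite ler_pM ?nc_ge0// lerDl.
  by rewrite invfM [e * _]mulrA divfK// lt0r_neq0// ltr_wpDl ?nc_ge0.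
by rewrite [leRHS](splitr e) lerD.
Qed.

End ComplexLimits.

Lemma ex_pow2_lt (R : realType) (B e : R) : 0 < e -> exists L : nat, B / 2 ^+ L < e.
Proof.
move=> e0; pose L := Num.bound (`|B| / e); exists L.
rewrite ltr_pdivrMr ?exprn_gt0// (le_lt_trans (ler_norm B))// mulrC -ltr_pdivrMr//.
have : `|B| / e < L%:R by rewrite archi_boundP// divr_ge0// ltW.
by move/lt_le_trans; apply; rewrite -natrX ler_nat ltnW// ltn_expl.
Qed.

(** * Completeness and the contraction principle *)

Section Completeness.
Variable R : realType.
Local Notation C := R[i].
Local Notation F := (F R).
Implicit Types (n N : nat) (r : nat -> R).

Definition nnsum (m : nat -> R) S :=
  (forall L, \sum_(k < L) m k <= S) /\
  (forall e, 0 < e -> exists L, S - e < \sum_(k < L) m k).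

Lemma nnsum_ex (m : nat -> R) M : (forall L, \sum_(k < L) m k <= M) ->
  exists2 S, nnsum m S & S <= M.
Proof.
move=> mM; pose E := [set \sum_(k < L) m k | L in setT].
have hE : has_sup E.
  split; first by exists (\sum_(k < 0) m k); exists 0%N.
  by exists M => _ [L _ <-].
exists (sup E); last by apply: ge_sup => [|_ [L _ <-]//]; case: hE.
split=> [L|e e0]; first by apply: sup_upper_bound => //; exists L.
by have [_ [L _ <-] h] := sup_adherent e0 hE; exists L.
Qed.

Lemma nnsumZ (m : nat -> R) S c : 0 < c -> nnsum m S -> nnsum (fun k => m k / c) (S / c).
Proof.
move=> c0 [h1 h2]; split=> [L|e e0]; first by rewrite -mulr_suml ler_pM2r ?invr_gt0.
have [|L hL] := h2 (e * c); first by rewrite mulr_gt0.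
exists L; rewrite -mulr_suml ltr_pdivlMr// mulrBl divfK//.
by rewrite lt0r_neq0.
Qed.

Lemma nnsum_mono (m : nat -> R) S e : (forall k, 0 <= m k) -> nnsum m S -> 0 < e ->
  exists N, forall L, (N <= L)%N -> S - \sum_(k < L) m k <= e.
Proof.
move=> m0 [_ h] /h[N hN]; exists N => L NL.
rewrite lerBlDr -lerBlDl (le_trans (ltW hN))//.
rewrite (big_ord_widen _ m NL) [leRHS](bigID (fun k : 'I_L => (k < N)%N) predT) /=.
by rewrite lerDl sumr_ge0.
Qed.

Lemma bnd_sum_diff n r (u : nat -> F n) (m : nat -> R) L L' : (forall i, 0 < r i) ->
  (forall k, bnd r (m k) (u k)) -> (L <= L')%N ->
  bnd r (\sum_(k < L') m k - \sum_(k < L) m k) (\sum_(k < L') u k - \sum_(k < L) u k).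
Proof.
move=> r0 um; elim: L' => [|L' IH].
  by rewrite leqn0 => /eqP ->; rewrite !big_ord0 !subrr; exact: bnd0.
rewrite leq_eqVlt => /orP[/eqP ->|]; first by rewrite !subrr; exact: bnd0.
rewrite ltnS => LL'; rewrite !big_ord_recr /= -!(addrAC _ _ (m L')) -!(addrAC _ _ (u L')).
by apply: bndD => //; exact: IH.
Qed.

(** Coefficientwise limits bound the partial majorant of order [N] of the error only by [N] times
    the tail. Splitting the error at a far index [L'] leaves the sum of [m] between [L] and [L'],
    plus [N] times a tail that is arbitrarily small. *)
Lemma complete n r (u : nat -> F n) (m : nat -> R) S : (forall i, 0 < r i) ->
  (forall k, bnd r (m k) (u k)) -> nnsum m S ->
  exists U, forall L, bnd r (S - \sum_(k < L) m k) (U - \sum_(k < L) u k).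
Proof.
move=> r0; elim: n u m S => [|n IH] u m S um mS; have m0 k := bnd_ge0 r0 (um k).
  have [|e e0|l hl] := @complex_cauchy _ (fun L => \sum_(k < L) u k : C)
      (fun L => S - \sum_(k < L) m k).
  - move=> L L' LL'; rewrite nc_dist (le_trans (bnd_sum_diff r0 um LL' 0))//.
    by rewrite lerD2r; case: mS.
  - have [N hN] := nnsum_mono m0 mS e0.
    by exists N.
  - by exists l => L N; have := hl L; rewrite nc_dist; exact.
have rX j : 0 < r n ^+ j by rewrite exprn_gt0.
have /choice[U hU] : forall j, exists Uj : F n, forall L,
    bnd r ((S - \sum_(k < L) m k) / r n ^+ j) (Uj - \sum_(k < L) psc (u k) j).
  move=> j; have [|Uj h] := IH (fun k => psc (u k) j) _ _ _ (nnsumZ (rX j) mS).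
    by move=> k; apply: bnd_coef.
  by exists Uj => L; rewrite mulrBl mulr_suml; exact: h.
exists (Ps U) => L N; apply: le_lim_eps => e e0.
have [N0 hN0] := nnsum_mono m0 mS (e := e / N.+1%:R) ltac:(by rewrite divr_gt0).
pose L' := maxn L N0; have LL' : (L <= L')%N by rewrite leq_maxl.
have -> : (Ps U : F n.+1) - \sum_(k < L) u k =
    (Ps U - \sum_(k < L') u k) + (\sum_(k < L') u k - \sum_(k < L) u k) by ring.
rewrite (le_trans (csD r0 _ _ _))// addrC lerD//.
  rewrite (le_trans (bnd_sum_diff r0 um LL' N))// lerD2r.
  by case: mS.
rewrite (@le_trans _ _ (\sum_(k < N) (S - \sum_(k < L') m k)))//.
  apply: ler_sum => j _; rewrite -ler_pdivlMr//.
  by rewrite FcB Fc_sum; exact: hU j L' N.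
rewrite sumr_const card_ord -(mulr_natr _ N).
rewrite (le_trans (ler_wpM2r _ (hN0 L' (leq_maxr _ _))))//.
by rewrite mulrAC ler_pdivrMr// ler_pM2l// ler_nat.
Qed.

(** [Z] is the Neumann series of the iterates of [T] on [g], which are dominated by [B / 2 ^+ k] and
    sum up to at most [2 * B]. *)
Lemma fixpoint n r (T : F n -> F n) B g : (forall i, 0 < r i) ->
  zmod_morphism T -> (forall M Z, bnd r M Z -> bnd r (M / 2) (T Z)) -> bnd r B g ->
  exists2 Z, Z = g + T Z & exists M, bnd r M Z.
Proof.
move=> r0 TB Thalf gB.
have T0 : T 0 = 0 by have := TB 0 0; rewrite !subrr.
have TD x y : T (x + y) = T x + T y.
  by rewrite -[y in LHS]opprK TB -[- y]sub0r TB T0 sub0r opprK.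
pose u k := iter k T g; pose m k := B / 2 ^+ k.
have um k : bnd r (m k) (u k).
  elim: k => [|k IH]; first by rewrite /m expr0 divr1.
  by have := Thalf _ _ IH; rewrite /m exprSr invfM mulrA.
have sm L : \sum_(k < L) m k = 2 * B - 2 * B / 2 ^+ L.
  elim: L => [|L IH]; first by rewrite big_ord0 expr0 divr1 subrr.
  rewrite big_ord_recr /= IH /m exprSr invfM.
  by have : (2 : R) != 0 by []; move: (2 ^+ L)^-1 => x ?; field.
have B0 := bnd_ge0 r0 gB.
have mS : nnsum m (2 * B).
  split=> [L|e e0]; rewrite ?sm ?lerBlDl ?lerDr ?divr_ge0 ?mulr_ge0 ?exprn_ge0//.
  have [L hL] := ex_pow2_lt (2 * B) e0; exists L; rewrite sm ltrD2l ltrN2 //.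
have [U hU] := complete r0 um mS.
have Tsum L : T (\sum_(k < L) u k) = \sum_(k < L) u k.+1.
  by elim: L => [|L IH]; rewrite ?big_ord0// !big_ord_recr /= TD IH.
exists U; last by exists (2 * B); have := hU 0%N; rewrite !big_ord0 !subr0.
apply/eqP; rewrite -subr_eq0; apply/eqP; apply: (bnd_eps r0) => e e0.
(* The three summands are, up to [2 ^+ L], the norms of the tail of the series, of the image of that
   tail under [T], and of the iterate [u L]. *)
have [L hL] := ex_pow2_lt (2 * B + 2 * B / 2 + B) e0.
have -> : U - (g + T U) = (U - \sum_(k < L) u k) - T (U - \sum_(k < L) u k) - u L.
  rewrite TB Tsum.
  have : g + \sum_(k < L) u k.+1 = \sum_(k < L) u k + u L.
    by transitivity (\sum_(k < L.+1) u k); [rewrite big_ord_recl|rewrite big_ord_recr].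
  move: (T U) (\sum_(k < L) u k) (\sum_(k < L) u k.+1) => a b c h.
  have -> : g = b + u L - c by rewrite -h addrK.
  by ring.
apply: bnd_le (ltW hL) _; rewrite (mulrDl (2 * B + _)) (mulrDl (2 * B)); apply: bndB => //.
  have hUL := hU L; rewrite sm opprB addrC subrK in hUL.
  have := bndB r0 hUL (Thalf _ _ hUL).
  by rewrite [_ / 2 ^+ L / 2]mulrAC.
exact: um.
Qed.

End Completeness.

(** * Values of convergent series *)

Section Evaluation.
Variable R : realType.
Local Notation C := R[i].
Local Notation F := (F R).
Implicit Types (n N : nat).

(** Made total by the default value 0; meaningful at points of a polydisc where [s] is bounded in
    the sense of [bnd]. *)
Definition ev n (v : nat -> C) (s : F n) : C :=
  xget 0 [set l | clim (fun N => pev N v s) l].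

Lemma pevS n N v (s : F n.+1) : pev N v s = \sum_(k < N) pev N v (psc s k) * v n ^+ k.
Proof. by []. Qed.

Lemma FcCXn n (a : F n) j k :
  psc (psC a * psX (F n) ^+ j : F n.+1) k = if k == j then a else 0.
Proof.
transitivity (psc (psX (F n) ^+ j * psC a) k); first by rewrite mulrC.
rewrite psXnM_coef /=; case: ltngtP => [//|jk|->]; last by rewrite subnn.
by rewrite subn_eq0 leqNgt jk.
Qed.

Lemma pevB n N v (s t : F n) : pev N v (s - t) = pev N v s - pev N v t.
Proof.
elim: n s t => [|n IH] s t //=.
by rewrite -sumrB; apply: eq_bigr => k _; rewrite -mulrBl -IH.
Qed.

Lemma pev0 n N v : pev N v (0 : F n) = 0.
Proof. by have := pevB N v (0 : F n) 0; rewrite !subrr. Qed.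

Lemma pevD n N v (s t : F n) : pev N v (s + t) = pev N v s + pev N v t.
Proof. by rewrite -[t in LHS]opprK pevB -sub0r pevB pev0 sub0r opprK. Qed.

Lemma pev_sum n N v I (rg : seq I) (P : pred I) (f : I -> F n) :
  pev N v (\sum_(i <- rg | P i) f i) = \sum_(i <- rg | P i) pev N v (f i).
Proof. by apply: (big_morph _ (pevD N v) (pev0 n N v)). Qed.

Lemma pev1 n N v : (0 < N)%N -> pev N v (1 : F n) = 1.
Proof.
case: N => // N _; elim: n => [|n IH] //=.
by rewrite big_ord_recl /= IH mul1r big1 ?addr0// => k _; rewrite pev0 mul0r.
Qed.

Lemma pev_psC n N v (s : F n) : (0 < N)%N -> pev N v (psC s : F n.+1) = pev N v s.
Proof.
case: N => // N _ /=.
by rewrite big_ord_recl /= expr0 mulr1 big1 ?addr0// => k _; rewrite pev0 mul0r.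
Qed.

Lemma pev_psX n N v : (1 < N)%N -> pev N v (psX (F n) : F n.+1) = v n.
Proof.
case: N => [|[|N]] // _ /=.
rewrite 2!big_ord_recl /= pev0 mul0r add0r pev1// mul1r expr1.
by rewrite big1 ?addr0// => k _; rewrite mul0r.
Qed.

Section Fixed.
Variables (r : nat -> R) (v : nat -> C).
Hypothesis r0 : forall i, 0 < r i.
Hypothesis vr : forall i, nc (v i) <= r i.

Let rX_ge0 i k : 0 <= r i ^+ k. Proof. by rewrite exprn_ge0// ltW. Qed.
Let rX_gt0 i k : 0 < r i ^+ k. Proof. by rewrite exprn_gt0. Qed.
Let cs_ge0 n N (s : F n) : 0 <= cs N r s. Proof. exact: cs_ge0. Qed.
Let vX i k : nc (v i ^+ k) <= r i ^+ k.
Proof. by rewrite ncX lerXn2r// nnegrE ?nc_ge0// ltW. Qed.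
Hint Resolve rX_gt0 : core.
Hint Extern 0 (is_true (_ <= _)) =>
  solve [exact: nc_ge0 | exact: cs_ge0 | exact: rX_ge0 | exact: vX] : core.

Lemma pev_le n N (s : F n) : nc (pev N v s) <= cs N r s.
Proof.
elim: n s => [|n IH] s //=; rewrite (le_trans (nc_sum _ _ _))// ler_sum// => k _.
by rewrite ncM ler_pM.
Qed.

Lemma pev_diff n N N' (s : F n) : (N <= N')%N ->
  nc (pev N' v s - pev N v s) <= cs N' r s - cs N r s.
Proof.
move=> NN'; elim: n s => [|n IH] s /=; first by rewrite !subrr nc0.
rewrite (bigID (fun k : 'I_N' => (k < N)%N) predT) /=.
rewrite [X in _ <= X - _](bigID (fun k : 'I_N' => (k < N)%N) predT) /=.
rewrite (big_ord_widen _ (fun k => pev N v (psc s k) * v n ^+ k) NN').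
rewrite (big_ord_widen _ (fun k => cs N r (psc s k) * r n ^+ k) NN').
rewrite addrAC -sumrB [leRHS]addrAC -sumrB (le_trans (ncD _ _))// lerD//.
  rewrite (le_trans (nc_sum _ _ _))// ler_sum// => k _.
  by rewrite -!mulrBl ncM ler_pM.
rewrite (le_trans (nc_sum _ _ _))// ler_sum// => k _.
by rewrite ncM ler_pM// pev_le.
Qed.

(** As [h + h <= N], the square of side [h] lies inside the triangle [j + l < N]. Pairs missing from
    the triangle are therefore outside the square, and inside it the errors of the coefficients are
    bounded by induction. *)
Lemma pev_mul n N h (s t : F n) : (h + h <= N)%N ->
  nc (pev N v s * pev N v t - pev N v (s * t)) <=
  cs N r s * cs N r t - cs h r s * cs h r t.
Proof.
move=> hN; elim: n s t => [|n IH] s t.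
  by rewrite /= !subrr nc0.
have -> : pev N v (s * t) = \sum_(j < N) \sum_(l < N | (j + l < N)%N)
    pev N v (psc s j * psc t l) * (v n ^+ j * v n ^+ l).
  rewrite -(sum_triangle _ (fun j l => pev N v (psc s j * psc t l) * (v n ^+ j * v n ^+ l))).
  rewrite pevS; apply: eq_bigr => k _; rewrite FcM pev_sum mulr_suml.
  by apply: eq_bigr => j _; rewrite -exprD subnKC// -ltnS.
rewrite /= !big_distrlr /= -sumrB.
have hle : (h <= N)%N by rewrite (leq_trans _ hN)// leq_addr.
rewrite (big_ord_widen _ (fun j => \sum_(l < h) cs h r (psc s j) * r n ^+ j *
   (cs h r (psc t l) * r n ^+ l)) hle) [X in _ - X]big_mkcond /= -sumrB.
rewrite (le_trans (nc_sum _ _ _))// ler_sum// => j _.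
rewrite [X in _ - X]big_mkcond /= -sumrB (le_trans (nc_sum _ _ _))//.
rewrite (@le_trans _ _ (\sum_(l < N) (cs N r (psc s j) * r n ^+ j * (cs N r (psc t l) * r n ^+ l)
  - if (j < h)%N && (l < h)%N then
      cs h r (psc s j) * r n ^+ j * (cs h r (psc t l) * r n ^+ l) else 0)))//.
  apply: ler_sum => l _; case: ifP => jl; last first.
    rewrite subr0 ifF ?subr0 ?ncM.
      by rewrite !ler_pM// ?mulr_ge0// ?pev_le.
    by apply: contraFF jl => /andP[jh lh]; rewrite (leq_trans _ hN)// -addSn leq_add// ltnW.
  rewrite mulrACA -mulrBl ncM.
  apply: (@le_trans _ _ ((cs N r (psc s j) * cs N r (psc t l) - cs h r (psc s j) * cs h r (psc t l))
     * (r n ^+ j * r n ^+ l))).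
    by rewrite ler_pM// ncM ler_pM.
  rewrite mulrBl mulrACA lerD2l lerN2; case: ifP => _; first by rewrite mulrACA.
  by rewrite !mulr_ge0.
rewrite sumrB lerD2l lerN2; case: ifP => jh /=; last by rewrite big1.
by rewrite -big_mkcond /= -(big_ord_widen _ (fun l => cs h r (psc s j) * r n ^+ j *
   (cs h r (psc t l) * r n ^+ l)) hle).
Qed.



Lemma pev_cvg n M (s : F n) : bnd r M s ->
  exists l, forall N, nc (pev N v s - l) <= nrm r s - cs N r s.
Proof.
move=> h; have hb := nrm_bnd h; apply: complex_cauchy => [L L' LL'|e e0].
  by rewrite nc_dist (le_trans (pev_diff _ LL'))// lerD2r.
have [N hN] := nrm_adh h e0; exists N => // L NL.
by rewrite lerBlDr -lerBlDl (le_trans (ltW hN))// cs_mono.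
Qed.

Lemma evP n M (s : F n) : bnd r M s -> clim (fun N => pev N v s) (ev v s).
Proof.
move=> h; have [l hl] := pev_cvg h.
suff: [set l | clim (fun N => pev N v s) l] (ev v s) by [].
apply: (@xgetPex _ 0 [set l | clim (fun N => pev N v s) l]); exists l => e e0.
have [N hN] := nrm_adh h e0; exists N => L NL; rewrite (le_trans (hl L))//.
by rewrite lerBlDr -lerBlDl (le_trans (ltW hN))// cs_mono.
Qed.

Lemma ev_le n M (s : F n) : bnd r M s -> nc (ev v s) <= M.
Proof.
move=> h; apply: (clim_le (evP h)); exists 0%N => N _.
by rewrite (le_trans (pev_le _ _)).
Qed.

Lemma ev_eq n l (s : F n) M : bnd r M s -> clim (fun N => pev N v s) l -> ev v s = l.
Proof. by move=> h hl; apply: clim_uniq (evP h) hl. Qed.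

Lemma evB n M M' (s t : F n) : bnd r M s -> bnd r M' t -> ev v (s - t) = ev v s - ev v t.
Proof.
move=> h h'; apply: (ev_eq (bndB r0 h h')).
by under eq_fun do rewrite pevB; apply: climB; [exact: evP h|exact: evP h'].
Qed.

Lemma evD n M M' (s t : F n) : bnd r M s -> bnd r M' t -> ev v (s + t) = ev v s + ev v t.
Proof.
move=> h h'; apply: (ev_eq (bndD r0 h h')).
by under eq_fun do rewrite pevD; apply: climD; [exact: evP h|exact: evP h'].
Qed.

(** The product of the partial sums has the right limit. Its distance to the partial sum of the
    product is at most what the majorants gain between order [k] and order [N], which is small once
    [k] is large. *)
Lemma evM n M M' (s t : F n) : bnd r M s -> bnd r M' t -> ev v (s * t) = ev v s * ev v t.
Proof.
move=> h h'; apply: (ev_eq (bndM r0 h h')).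
have -> : (fun N => pev N v (s * t)) = (fun N => pev N v s * pev N v t -
   (pev N v s * pev N v t - pev N v (s * t))) by apply/funext => N; rewrite subKr.
rewrite -[X in clim _ X]subr0; apply: climB.
  by apply: climM; [exact: evP h|exact: evP h'].
move=> e e0; have hs := nrm_bnd h; have ht := nrm_bnd h'.
have s0 := bnd_ge0 r0 hs; have t0 := bnd_ge0 r0 ht.
(* Chosen so that [e / c] times the sum of the two norms is at most [e]; the 1 makes [c]
   positive. *)
pose c := nrm r s + nrm r t + 1; have c0 : 0 < c by rewrite ltr_wpDl ?addr_ge0.
have [N1 h1] := nrm_adh h (e := e / c) ltac:(by rewrite divr_gt0).
have [N2 h2] := nrm_adh h' (e := e / c) ltac:(by rewrite divr_gt0).
pose k := maxn N1 N2; exists (k + k)%N => N kN; rewrite subr0.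
rewrite (le_trans (pev_mul s t kN))//.
have h1' : nrm r s - e / c <= cs k r s by rewrite (le_trans (ltW h1))// cs_mono// leq_maxl.
have h2' : nrm r t - e / c <= cs k r t by rewrite (le_trans (ltW h2))// cs_mono// leq_maxr.
have a1 := hs N; have b1 := ht N; have a2 := hs k; have b2 := ht k.
have a3 := cs_ge0 k s; have b3 := cs_ge0 k t.
have : cs N r s * cs N r t <= nrm r s * nrm r t by rewrite ler_pM.
have : nrm r s * nrm r t - cs k r s * cs k r t <= e.
  have -> : nrm r s * nrm r t - cs k r s * cs k r t =
    (nrm r s - cs k r s) * nrm r t + (nrm r t - cs k r t) * cs k r s by ring.
  rewrite (@le_trans _ _ (e / c * nrm r t + e / c * nrm r s))// ?lerD//.
  - by rewrite ler_wpM2r// lerBlDr -lerBlDl.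
  - by rewrite ler_pM// ?subr_ge0// lerBlDr -lerBlDl.
  - rewrite -mulrDr -mulrA ler_piMr ?(ltW e0)// mulrC ler_pdivrMr// mul1r /c; lra.
lra.
Qed.

Lemma ev_psC n M (s : F n) : bnd r M s -> ev v (psC s : F n.+1) = ev v s.
Proof.
move=> h; apply: (ev_eq (bnd_psC r0 h)); apply: clim_near (evP h).
by exists 1%N => N N0; rewrite pev_psC.
Qed.

Lemma ev1 n : ev v (1 : F n) = 1.
Proof.
apply: (ev_eq (bnd1 r0 n)); apply: clim_near (clim_cst _).
by exists 1%N => N N0; rewrite pev1.
Qed.

Lemma ev0 n : ev v (0 : F n) = 0.
Proof. by have := evB (bnd0 r n) (bnd0 r n); rewrite !subrr. Qed.

Lemma ev_psX n : ev v (psX (F n) : F n.+1) = v n.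
Proof.
apply: (ev_eq (bnd_psX r0 n)); apply: clim_near (clim_cst _).
by exists 2%N => N N0; rewrite pev_psX.
Qed.

Lemma evX n M (s : F n) k : bnd r M s -> ev v (s ^+ k) = ev v s ^+ k.
Proof.
move=> h; elim: k => [|k IH]; first by rewrite !expr0 ev1.
by rewrite !exprS (evM h (bndX r0 k h)) IH.
Qed.

(** [ev] truncates all variables at once, whereas here the sum in the last variable comes last.
    Cutting [s] at degree [L] into a polynomial [H] in the last variable and a tail [T] of norm at
    most [e] compares the two. *)
Lemma ev_iter n M (s : F n.+1) : bnd r M s ->
  clim (fun L => \sum_(k < L) ev v (psc s k) * v n ^+ k) (ev v s).
Proof.
move=> h e e0; have [N0 hN0] := nrm_adh h e0; have hs := nrm_bnd h.
exists N0 => L N0L; have hc k := bnd_coef r0 k h.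
pose T : F n.+1 := Ps (fun k => if (k < L)%N then 0 else psc s k).
pose H : F n.+1 := \sum_(k < L) psC (psc s k) * psX (F n) ^+ k.
have sHT : s = H + T.
  apply: psP => k; rewrite FcD Fc_sum [psc T k]/=; have [kL|Lk] := ltnP k L.
    rewrite addr0 (bigD1 (Ordinal kL))// FcCXn eqxx big1 => [|j jk]; first exact/esym/addr0.
    by rewrite FcCXn ifN// eq_sym.
  rewrite big1 ?add0r// => j _; rewrite FcCXn ifN//.
  by rewrite gtn_eqF// (leq_trans (ltn_ord j) Lk).
have Te : bnd r e T.
  move=> N; apply: (le_trans (cs_mono r0 T (leq_maxl N L))); pose N' := maxn N L.
  rewrite -/N' /=.
  have LN' : (L <= N')%N by rewrite leq_maxr.
  have : \sum_(k < N') cs N' r (psc s k) * r n ^+ k <= nrm r s by exact: (hs N').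
  rewrite (bigID (fun k : 'I_N' => (k < L)%N) predT) /=.
  have : cs N0 r s <= \sum_(k < N' | (k < L)%N) cs N' r (psc s k) * r n ^+ k.
    apply: le_trans (cs_mono r0 s N0L) _.
    rewrite /= (big_ord_widen _ (fun k => cs L r (psc s k) * r n ^+ k) LN').
    by apply: ler_sum => k _; rewrite ler_pM2r// cs_mono.
  have -> : \sum_(k < N') cs N' r (psc T k) * r n ^+ k =
     \sum_(k < N' | ~~ (k < L)%N) cs N' r (psc s k) * r n ^+ k.
    rewrite [RHS]big_mkcond /=; apply: eq_bigr => k _; case: ifP => //= _.
    by rewrite cs0 mul0r.
  move: hN0; lra.
have Hb : exists M', bnd r M' H.
  rewrite /H; elim/big_ind: _ => [|x y [M1 h1] [M2 h2]|k _].
  - by exists 0; apply: bnd0.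
  - by exists (M1 + M2); apply: bndD.
  - by exists (M / r n ^+ k * r n ^+ k); apply: bndM => //; [exact: bnd_psC|apply: bndX => //; exact: bnd_psX].
have [M' hM'] := Hb.
have -> : \sum_(k < L) ev v (psc s k) * v n ^+ k = ev v H.
  rewrite /H; elim: L {N0L T H sHT Te Hb hM'} => [|L IH]; first by rewrite !big_ord0 ev0.
  have hX k := bndX r0 k (bnd_psX r0 n).
  rewrite !big_ord_recr /= IH.
  have [M'' hM''] : exists M', bnd r M' (\sum_(k < L) psC (psc s k) * psX (F n) ^+ k : F n.+1).
    elim/big_ind: _ => [|x y [M1 h1] [M2 h2]|k _].
    - by exists 0; apply: bnd0.
    - by exists (M1 + M2); apply: bndD.
    - by exists (M / r n ^+ k * r n ^+ k); apply: bndM => //; exact: bnd_psC.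
  rewrite (evD hM'' (bndM r0 (bnd_psC r0 (hc L)) (hX L))).
  rewrite (evM (bnd_psC r0 (hc L)) (hX L)) (evX _ (bnd_psX r0 n)) ev_psX.
  by rewrite (ev_psC (hc L)).
rewrite nc_dist [X in ev v X - _]sHT (evD hM' Te) addrC addKr.
exact: ev_le Te.
Qed.

End Fixed.
End Evaluation.

(** * Convergent series: shrinking polydiscs, identity theorem, composition *)

Section Convergence.
Variable R : realType.
Local Notation C := R[i].
Local Notation F := (F R).
Implicit Types (n N : nat) (r : nat -> R).

Lemma cs_monor n N r r' (s : F n) : (forall i, 0 < r i) ->
  (forall i, (i < n)%N -> r i <= r' i) -> cs N r s <= cs N r' s.
Proof.
move=> r0; elim: n s => [|n IH] s rr' //=; apply: ler_sum => k _.
rewrite ler_pM ?cs_ge0 ?exprn_ge0 ?(ltW (r0 _))//.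
  by apply: IH => i ni; apply: rr'; rewrite ltnW.
by rewrite lerXn2r ?nnegrE ?(ltW (r0 _)) ?rr'// (le_trans (ltW (r0 n)))// rr'.
Qed.

Lemma bnd_monor n M r r' (s : F n) : (forall i, 0 < r i) ->
  (forall i, (i < n)%N -> r i <= r' i) -> bnd r' M s -> bnd r M s.
Proof. by move=> r0 rr' h N; rewrite (le_trans (cs_monor _ _ r0 rr')). Qed.

Lemma pev_ext n N (v w : nat -> C) (s : F n) :
  (forall i, (i < n)%N -> v i = w i) -> pev N v s = pev N w s.
Proof.
elim: n s => [|n IH] s vw //=; apply: eq_bigr => k _.
by rewrite vw// IH// => i ni; rewrite vw// ltnW.
Qed.

Lemma ev_ext n (v w : nat -> C) (s : F n) :
  (forall i, (i < n)%N -> v i = w i) -> ev v s = ev w s.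
Proof.
move=> vw; rewrite /ev.
by have -> : (fun N => pev N v s) = (fun N => pev N w s)
  by apply/funext => N; exact: pev_ext.
Qed.

(** A single radius serves all variables, so two convergent series always share a polydisc, even in
    different numbers of variables. *)
Definition summ n (s : F n) := exists2 e : R, 0 < e & exists M, bnd (fun=> e) M s.

Lemma bnd_summ n r M (s : F n) : (forall i, 0 < r i) -> bnd r M s -> summ s.
Proof.
move=> r0 h; suff [e e0 he] : exists2 e, 0 < e & forall i, (i < n)%N -> e <= r i.
  by exists e => //; exists M; apply: bnd_monor h.
elim: {s h} n => [|n [e e0 he]]; first by exists 1.
exists (Num.min e (r n)); first by rewrite lt_min e0 r0.
move=> i; rewrite ltnS leq_eqVlt ge_min => /orP[/eqP ->|/he ->//].
by rewrite lexx orbT.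
Qed.

Lemma summ2 n m (s : F n) (t : F m) : summ s -> summ t ->
  exists2 e, 0 < e & exists2 M, bnd (fun=> e) M s & bnd (fun=> e) M t.
Proof.
move=> [e e0 [M h]] [e' e0' [M' h']]; exists (Num.min e e').
  by rewrite lt_min e0.
have m0 : forall i : nat, 0 < Num.min e e' by move=> _; rewrite lt_min e0.
exists (Num.max M M').
  apply: bnd_le (bnd_monor m0 _ h) => //; rewrite ?le_max ?lexx//.
  by move=> i _; rewrite ge_min lexx.
apply: bnd_le (bnd_monor m0 _ h') => //; rewrite ?le_max ?lexx ?orbT//.
by move=> i _; rewrite ge_min lexx orbT.
Qed.

Lemma summ1 n : summ (1 : F n).
Proof. by exists 1 => //; exists 1; apply: bnd1. Qed.

Lemma summB n (s t : F n) : summ s -> summ t -> summ (s - t).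
Proof.
move=> hs ht; have [e e0 [M h h']] := summ2 hs ht.
by exists e => //; exists (M + M); apply: bndB.
Qed.

Lemma summM n (s t : F n) : summ s -> summ t -> summ (s * t).
Proof.
move=> hs ht; have [e e0 [M h h']] := summ2 hs ht.
by exists e => //; exists (M * M); apply: bndM.
Qed.

Lemma summ_psC n (s : F n) : summ s -> summ (psC s : F n.+1).
Proof. by move=> [e e0 [M h]]; exists e => //; exists M; apply: bnd_psC. Qed.

Lemma summ_psX n : summ (psX (F n) : F n.+1).
Proof. by exists 1 => //; exists 1; apply: (@bnd_psX _ (fun=> 1)). Qed.

Lemma summ_coef n (s : F n.+1) k : summ s -> summ (psc s k).
Proof. by move=> [e e0 [M h]]; exists e => //; exists (M / e ^+ k); apply: bnd_coef. Qed.

Lemma bnd_shift n r M d (s : F n.+1) : (forall i, 0 < r i) ->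
  bnd r M s -> bnd r (M / r n ^+ d) (Ps (fun k => psc s (k + d)%N) : F n.+1).
Proof.
move=> r0 h N; rewrite ler_pdivlMr ?exprn_gt0//.
apply: le_trans (h (N + d)%N); rewrite /= mulr_suml.
have -> : (N + d)%N = (d + N)%N by rewrite addnC.
rewrite big_split_ord /= ler_wpDl ?sumr_ge0// => [k _|].
  by rewrite mulr_ge0 ?cs_ge0 ?exprn_ge0 ?ltW.
apply: ler_sum => k _; rewrite -mulrA -exprD [(k + d)%N]addnC.
by rewrite ler_pM2r ?exprn_gt0// cs_mono// leq_addl.
Qed.

Lemma summ_shift n d (s : F n.+1) : summ s -> summ (Ps (fun k => psc s (k + d)%N) : F n.+1).
Proof. by move=> [e e0 [M h]]; exists e => //; exists (M / e ^+ d); apply: bnd_shift. Qed.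

Fixpoint c0 n : F n -> C :=
  match n return F n -> C with
  | 0 => fun s => s
  | m.+1 => fun s => c0 (psc s 0)
  end.

Lemma c0B n (s t : F n) : c0 (s - t) = c0 s - c0 t.
Proof. by elim: n s t => [|n IH] s t //=; rewrite -IH. Qed.
Lemma c00 n : c0 (0 : F n) = 0.
Proof. by have := c0B (0 : F n) 0; rewrite !subrr. Qed.
Lemma c0M n (s t : F n) : c0 (s * t) = c0 s * c0 t.
Proof.
elim: n s t => [|n IH] s t //=; rewrite -IH; congr c0.
exact: big_ord1.
Qed.
Lemma c01 n : c0 (1 : F n) = 1.
Proof. by elim: n. Qed.

Fixpoint fcst n (c : C) : F n :=
  match n return F n with 0 => c | m.+1 => psC (fcst m c) end.

Lemma fcstB n a b : fcst n (a - b) = fcst n a - fcst n b.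
Proof. by elim: n => //= n ->; exact: (raddfB (psC (A := F n))). Qed.
Lemma fcstM n a b : fcst n (a * b) = fcst n a * fcst n b.
Proof. by elim: n => //= n ->; exact: (rmorphM (psC (A := F n))). Qed.
Lemma fcst1 n : fcst n 1 = 1.
Proof. by elim: n => //= n ->; exact: (rmorph1 (psC (A := F n))). Qed.
Lemma c0_fcst n c : c0 (fcst n c) = c.
Proof. by elim: n. Qed.
Lemma bnd_fcst n r c : (forall i, 0 < r i) -> bnd r (nc c) (fcst n c).
Proof. by move=> r0; elim: n => [|n IH] /=; [move=> N|apply: bnd_psC]. Qed.
Lemma summ_fcst n c : summ (fcst n c).
Proof. by exists 1 => //; exists (nc c); apply: bnd_fcst. Qed.
Lemma ev_fcst n (v : nat -> C) c : ev v (fcst n c) = c.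
Proof.
pose r i := nc (v i) + 1.
have r0 i : 0 < r i by rewrite ltr_wpDl ?nc_ge0.
have vr i : nc (v i) <= r i by rewrite lerDl.
elim: n => [|n IH] /=; last by rewrite (ev_psC r0 vr (bnd_fcst _ _ r0)).
by apply: (ev_eq r0 vr (bnd_fcst 0 c r0)) => e e0; exists 0%N => N _; rewrite subrr nc0 ltW.
Qed.

(** Without constant term, every monomial has degree at least 1 and so gains at least one factor
    [e <= 1] when all radii are scaled. *)
Lemma cs_scale n N r e (s : F n) : (forall i, 0 < r i) -> 0 < e -> e <= 1 ->
  c0 s = 0 -> cs N (fun i => e * r i) s <= e * cs N r s.
Proof.
move=> r0 e0 e1; have er0 : forall i, 0 < e * r i by move=> i; rewrite mulr_gt0.
elim: n s => [|n IH] s /= s0.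
  by rewrite s0 nc0 mulr0.
rewrite mulr_sumr; apply: ler_sum => -[[|k] kN] _ /=.
  by rewrite !expr0 !mulr1 IH.
rewrite exprMn.
have h1 : cs N (fun i => e * r i) (psc s k.+1) <= cs N r (psc s k.+1).
  by apply: cs_monor => // i _; rewrite ler_piMl// ltW.
rewrite [leRHS]mulrCA.
rewrite ler_pM ?mulr_ge0 ?cs_ge0 ?exprn_ge0 ?(ltW e0) ?(ltW (r0 _))//.
rewrite ler_pM2r ?exprn_gt0// exprS ler_piMr ?(ltW e0)//.
by rewrite exprn_ile1// ltW.
Qed.

Lemma bnd_scale n M r e (s : F n) : (forall i, 0 < r i) -> 0 < e -> e <= 1 ->
  c0 s = 0 -> bnd r M s -> bnd (fun i => e * r i) (e * M) s.
Proof.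
move=> r0 e0 e1 s0 h N; rewrite (le_trans (cs_scale _ r0 e0 e1 s0))//.
by rewrite ler_pM2l.
Qed.

(** Scaling by at most [eta / (M + 1)] suffices. This provides the contraction that inverts germs
    and makes substitutions of germs vanishing at 0 admissible. *)
Lemma small n (s : F n) eta : summ s -> c0 s = 0 -> 0 < eta ->
  exists2 e, 0 < e & forall e', 0 < e' -> e' <= e -> bnd (fun=> e') eta s.
Proof.
move=> [e e0 [M h]] s0 eta0; have M0 := bnd_ge0 (fun=> e0) h.
have d0 : 0 < Num.min 1 (eta / (M + 1)).
  by rewrite lt_min ltr01 divr_gt0// ltr_wpDl.
exists (Num.min 1 (eta / (M + 1)) * e); first by rewrite mulr_gt0.
move=> e' e'0 le; apply: (bnd_monor (r' := fun=> Num.min 1 (eta / (M + 1)) * e)) => //.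
have := bnd_scale (fun=> e0) d0 _ s0 h; rewrite ge_min lexx => /(_ isT).
apply: bnd_le; rewrite (@le_trans _ _ (eta / (M + 1) * M))//.
  by rewrite ler_wpM2r// ge_min lexx orbT.
by rewrite mulrAC ler_pdivrMr ?ltr_wpDl// ler_pM2l// lerDl.
Qed.

(** After division by a power of the last variable, the constant term in that variable is a nonzero
    series, which by induction is nonzero at some [v'] near 0. A small nonzero last entry [t] then
    changes its value too little to reach 0. *)
Lemma identity n (s : F n) : summ s -> s != 0 -> forall e, 0 < e ->
  exists2 v : nat -> C, forall i, nc (v i) <= e & ev v s != 0.
Proof.
elim: n s => [|n IH] s cs s0 e e0.
  exists (fun=> 0); first by move=> _; rewrite nc0 ltW.
  by have := ev_fcst 0 (fun=> 0) (s : C) => /= ->.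
have [d sd mind] : exists2 d, psc s d != 0 & forall k, (k < d)%N -> psc s k = 0.
  have : exists d, psc s d != 0.
    apply: contrapT => H; move/eqP: s0; apply; apply: psP => k.
    by apply/eqP; apply: contrapT => sk; apply: H; exists k; apply/negP.
  case/ex_minnP => d sd mind; exists d => // k kd; apply/eqP/negPn/negP => /mind.
  by rewrite leqNgt kd.
pose s' : F n.+1 := Ps (fun k => psc s (k + d)%N).
pose s'' : F n.+1 := Ps (fun k => psc s' (k + 1)%N).
have c' : summ s' := summ_shift d cs.
have c'' : summ s'' := summ_shift 1 c'.
have ss' : s = psX (F n) ^+ d * s'.
  apply: psP => k; rewrite psXnM_coef; case: ltnP => [/mind//|dk].
  by rewrite /= subnK.
have s's'' : s' = psC (psc s d) + psX (F n) * s''.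
  rewrite [LHS](ps_split (s' : ps (F n))); congr (_ + _ * _).
  by apply: psP => k /=; rewrite addn1.
have [e1 e10 [M h h']] := summ2 c'' (summ_coef d cs).
pose e2 := Num.min e e1.
have e20 : 0 < e2 by rewrite lt_min e0.
have [v' v'e evd] := IH _ (summ_coef d cs) sd _ e20.
have M0 := bnd_ge0 (fun=> e10) h.
pose a := nc (ev v' (psc s d)).
have a0 : 0 < a by rewrite nc_gt0.
(* With [M] bounding the values of [s''], the perturbation [t * s''] is at most [a / 2]. *)
pose t := Num.min e2 (a / (M + 1) / 2).
have t0 : 0 < t by rewrite lt_min e20 !divr_gt0// ltr_wpDl.
have te2 : t <= e2 by rewrite ge_min lexx.
pose v i := if i == n then t%:C%C else v' i.
have ve2 i : nc (v i) <= e2.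
  by rewrite /v; case: eqP => // _; rewrite nc_real ger0_norm// ltW.
have ve1 i : nc (v i) <= e1 by rewrite (le_trans (ve2 i))// ge_min lexx orbT.
exists v => [i|]; first by rewrite (le_trans (ve2 i))// ge_min lexx.
have r0 : forall i : nat, 0 < (fun=> e1) i :> R by [].
have hX := bnd_psX r0 n.
have hs' : bnd (fun=> e1) (M + e1 * M) s'.
  by rewrite s's''; apply: bndD => //; [exact: bnd_psC|exact: bndM].
rewrite ss' (evM r0 ve1 (bndX r0 d hX) hs') (evX r0 ve1 d hX) (ev_psX r0 ve1).
have vn : v n = t%:C%C by rewrite /v eqxx.
rewrite mulf_neq0//.
  by rewrite expf_neq0// vn (_ : 0 = 0%:C%C)// (inj_eq (@complexI _)) lt0r_neq0.
rewrite s's'' (evD r0 ve1 (bnd_psC r0 h') (bndM r0 hX h)).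
rewrite (ev_psC r0 ve1 h') (evM r0 ve1 hX h) (ev_psX r0 ve1) vn.
rewrite (@ev_ext _ v v'); last by move=> i ni; rewrite /v ltn_eqF.
apply/eqP => eq0; have : a = nc (t%:C%C * ev v s'').
  by rewrite -ncN /a; congr nc; apply/eqP; rewrite -addr_eq0; apply/eqP.
rewrite ncM nc_real (ger0_norm (ltW t0)) => aE.
have hM : nc (ev v s'') <= M := ev_le r0 ve1 h.
have : t * nc (ev v s'') <= a / (M + 1) / 2 * M.
  by rewrite ler_pM ?nc_ge0 ?(ltW t0)// ge_min lexx orbT.
have : a / (M + 1) / 2 * M <= a / 2.
  rewrite mulrAC ler_pM2r// mulrAC ler_pdivrMr ?ltr_wpDl// ler_pM2l//.
  by rewrite lerDl.
rewrite -aE => h1 h2; have := le_trans h2 h1.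
by rewrite leNgt ltr_pdivrMr// ltr_pMr// ltr1n.
Qed.

(** Majorants compose: since [g i] has norm at most [r i] on the polydisc [sg], the terms
    [c j * g n ^+ j] are dominated by the majorant of [s] in its last variable, and [complete] sums
    them. *)
Lemma comp_ex n (s : F n) r M k (g : nat -> F k) sg :
  (forall i, 0 < r i) -> (forall i, 0 < sg i) ->
  bnd r M s -> (forall i, bnd sg (r i) (g i)) ->
  exists2 c : F k, bnd sg M c &
    forall w : nat -> C, (forall i, nc (w i) <= sg i) ->
      ev w c = ev (fun i => ev w (g i)) s.
Proof.
move=> r0 sg0; elim: n s M => [|n IH] s M hs hg.
  exists (fcst k (s : C)); first by apply: bnd_le (bnd_fcst _ _ sg0); exact: (hs 0%N).
  by move=> w ws; rewrite ev_fcst; have := ev_fcst 0 (fun i => ev w (g i)) (s : C) => /= ->.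
have hc j := nrm_bnd (bnd_coef r0 j hs).
have /choice[c hcj] : forall j, exists c : F k, bnd sg (nrm r (psc s j)) c /\
    forall w : nat -> C, (forall i, nc (w i) <= sg i) ->
      ev w c = ev (fun i => ev w (g i)) (psc s j).
  by move=> j; have [c h1 h2] := IH _ _ (hc j) hg; exists c.
pose m j := nrm r (psc s j) * r n ^+ j.
pose u j := c j * g n ^+ j.
have um j : bnd sg (m j) (u j) by apply: bndM (hcj j).1 (bndX sg0 _ (hg n)).
have [S mS SM] : exists2 S, nnsum m S & S <= M.
  by apply: nnsum_ex => L; exact: bnd_split.
have [U hU] := complete sg0 um mS.
have hU0 : bnd sg S U by have := hU 0%N; rewrite !big_ord0 !subr0.
exists U => [|w ws]; first exact: bnd_le hU0.
have wr i : nc (ev w (g i)) <= r i := ev_le sg0 ws (hg i).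
apply: (@clim_uniq _ (fun L => \sum_(j < L) ev (fun i => ev w (g i)) (psc s j) * ev w (g n) ^+ j)).
  have m0 j := bnd_ge0 sg0 (um j).
  move=> e e0; have [N hN] := nnsum_mono m0 mS e0; exists N => L /hN; apply: le_trans.
  rewrite nc_dist.
  have [Mu hMu] : exists Mu, bnd sg Mu (\sum_(j < L) u j).
    by exists (\sum_(j < L) m j) => N'; rewrite (le_trans (cs_sum sg0 _ _ _ _))// ler_sum// => j _; apply: um.
  have -> : \sum_(j < L) ev (fun i => ev w (g i)) (psc s j) * ev w (g n) ^+ j =
      ev w (\sum_(j < L) u j).
    elim: L {Mu hMu} => [|L IHL]; first by rewrite !big_ord0 (ev0 sg0 ws).
    rewrite !big_ord_recr /= IHL.
    have hMu : bnd sg (\sum_(j < L) m j) (\sum_(j < L) u j).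
      by move=> N'; rewrite (le_trans (cs_sum sg0 _ _ _ _))// ler_sum// => j _; apply: um.
    rewrite (evD sg0 ws hMu (um L)) (evM sg0 ws (hcj L).1 (bndX sg0 _ (hg n))).
    by rewrite (evX sg0 ws _ (hg n)) (hcj L).2.
  rewrite -(evB sg0 ws hU0 hMu); apply: (ev_le sg0 ws); exact: hU.
exact: (ev_iter r0 wr hs).
Qed.

End Convergence.

(** * Partial derivatives *)

Section Derivation.
Variable R : realType.
Local Notation C := R[i].
Local Notation F := (F R).
Implicit Types (n N : nat) (r : nat -> R).

Fixpoint pd n (i : nat) : F n -> F n :=
  match n return F n -> F n with
  | 0 => fun=> 0
  | m.+1 => fun s => if i == m then psderiv s else Ps (fun k => pd i (psc s k))
  end.

Arguments pd : simpl never.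

Lemma pd_last n (s : F n.+1) : pd n s = psderiv s.
Proof. by rewrite /pd eqxx. Qed.

Lemma pd_coef n i (s : F n.+1) k : i != n -> psc (pd i s) k = pd i (psc s k).
Proof. by move=> ni; rewrite /pd -/pd (negPf ni). Qed.

Lemma pdB n i (s t : F n) : pd i (s - t) = pd i s - pd i t.
Proof.
elim: n s t => [|n IH] s t; first exact/esym/subrr.
have [->|ni] := eqVneq i n; first by rewrite !pd_last; exact: psderiv_zmod.
by apply: psP => k; rewrite FcB !pd_coef// FcB IH.
Qed.

Lemma pd0 n i : pd i (0 : F n) = 0.
Proof. by have := pdB i (0 : F n) 0; rewrite !subrr. Qed.

Lemma pdD n i (s t : F n) : pd i (s + t) = pd i s + pd i t.
Proof. by rewrite -[t in LHS]opprK pdB -[- t]sub0r pdB pd0 sub0r opprK. Qed.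

Lemma pd_sum n i I (rg : seq I) (P : pred I) (f : I -> F n) :
  pd i (\sum_(j <- rg | P j) f j) = \sum_(j <- rg | P j) pd i (f j).
Proof. by apply: (big_morph _ (pdD i) (pd0 n i)). Qed.

Lemma pdM n i (s t : F n) : pd i (s * t) = pd i s * t + s * pd i t.
Proof.
elim: n s t => [|n IH] s t.
  by rewrite (mul0r t) (mulr0 s) addr0.
have [->|ni] := eqVneq i n; first by rewrite !pd_last; exact: psderivM.
apply: psP => k; rewrite pd_coef// FcD !FcM pd_sum -big_split.
by apply: eq_bigr => j _; rewrite IH !pd_coef.
Qed.

Lemma pd1 n i : pd i (1 : F n) = 0.
Proof.
have := pdM i (1 : F n) 1; rewrite !mul1r mulr1 => /eqP.
by rewrite -subr_eq0 opprD addNKr oppr_eq0 => /eqP.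
Qed.

Lemma pd_psC n i (s : F n) : (i < n)%N -> pd i (psC s : F n.+1) = psC (pd i s).
Proof.
move=> ni; apply: psP => k; rewrite pd_coef ?ltn_eqF//=.
by case: eqP => // _; rewrite pd0.
Qed.

Lemma pd_psC_last n (s : F n) : pd n (psC s : F n.+1) = 0.
Proof. by rewrite pd_last; exact: psderivC. Qed.

Lemma pd_psX n i : (i < n)%N -> pd i (psX (F n) : F n.+1) = 0.
Proof.
move=> ni; apply: psP => k; rewrite pd_coef ?ltn_eqF//=.
by case: k => [|[|k]]; rewrite ?pd0 ?pd1.
Qed.

Lemma pd_psX_last n : pd n (psX (F n) : F n.+1) = 1.
Proof. by rewrite pd_last; exact: psderivX. Qed.

Lemma pd_fcst n i c : pd i (fcst n c) = 0.
Proof.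
elim: n => [|n IH] //; have [->|ni] := eqVneq i n.
  by rewrite pd_last; exact: psderivC.
apply: psP => k; rewrite pd_coef//=; case: eqP => _; last exact: pd0.
exact: IH.
Qed.

Lemma pd_out n i (s : F n) : (n <= i)%N -> pd i s = 0.
Proof.
elim: n s => [|n IH] s ni //.
by apply: psP => k; rewrite pd_coef ?gtn_eqF// IH// ltnW.
Qed.

(** Halving the radii absorbs the factor produced by differentiation, as [k.+1 <= 2 ^ k]. The order
    [N.+1] on the right makes up for the shift of degree. *)
Lemma cs_pd n N r i (s : F n) : (forall i, 0 < r i) -> (i < n)%N ->
  cs N (fun j => r j / 2) (pd i s) <= cs N.+1 r s / r i.
Proof.
move=> r0; elim: n s => [//|n IH] s ni.
have r20 : forall j, 0 < r j / 2 by move=> j; rewrite divr_gt0.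
have rr j : r j / 2 <= r j by rewrite ler_pdivrMr// ler_pMr// ler1n.
have mono k : cs N (fun j => r j / 2) (psc s k) <= cs N.+1 r (psc s k).
  by rewrite (le_trans (cs_mono r20 _ (leqnSn N)))// cs_monor.
have [->|nin] := eqVneq i n.
  rewrite pd_last ler_pdivlMr//= big_ord_recl /= ler_wpDl//.
    by rewrite mulr_ge0 ?cs_ge0 ?exprn_ge0 ?(ltW (r0 _)).
  rewrite mulr_suml; apply: ler_sum => k _.
  have le1 l (x : F n) : cs N (fun j => r j / 2) (x *+ l) <=
      cs N (fun j => r j / 2) x *+ l.
    elim: l => [|l IHl]; first by rewrite !mulr0n cs0.
    by rewrite (mulrS x) (mulrS (cs _ _ _)) (le_trans (csD r20 _ _ _))// lerD2l.
  rewrite (le_trans (ler_wpM2r _ (ler_wpM2r _ (le1 _ _)))) ?exprn_ge0 ?(ltW (r20 _)) ?(ltW (r0 _))//.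
  rewrite exprMn exprVn /bump /= add1n exprS.
  apply: (@le_trans _ _ (cs N.+1 r (psc s k.+1) *+ k.+1 * (r n ^+ k / 2 ^+ k) * r n)).
    by rewrite !ler_pM2r// ?divr_gt0 ?exprn_gt0// lerMn2r mono orbT.
  rewrite -[_ *+ k.+1]mulr_natr.
  have -> : cs N.+1 r (psc s k.+1) * k.+1%:R * (r n ^+ k / 2 ^+ k) * r n =
    cs N.+1 r (psc s k.+1) * (r n * r n ^+ k) * (k.+1%:R / 2 ^+ k) by ring.
  rewrite ler_piMr ?mulr_ge0 ?cs_ge0 ?exprn_ge0 ?(ltW (r0 _))//.
  by rewrite ler_pdivrMr ?exprn_gt0// mul1r -natrX ler_nat ltn_expl.
have {}ni : (i < n)%N by move: ni; rewrite ltnS leq_eqVlt (negPf nin).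
rewrite /= big_ord_recr mulrDl /= ler_wpDr//.
  by rewrite !mulr_ge0 ?cs_ge0 ?exprn_ge0 ?invr_ge0 ?(ltW (r0 _)).
rewrite mulr_suml; apply: ler_sum => k _; rewrite mulrAC pd_coef//.
rewrite ler_pM ?cs_ge0 ?exprn_ge0 ?(ltW (r20 _)) ?IH//.
by rewrite lerXn2r ?nnegrE ?(ltW (r20 _)) ?(ltW (r0 _)).
Qed.

Lemma bnd_pd n M r i (s : F n) : (forall i, 0 < r i) -> (i < n)%N ->
  bnd r M s -> bnd (fun j => r j / 2) (M / r i) (pd i s).
Proof.
by move=> r0 ni h N; rewrite (le_trans (cs_pd _ _ r0 ni))// ler_pM2r ?invr_gt0.
Qed.

Lemma summ_pd n i (s : F n) : summ s -> summ (pd i s).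
Proof.
have [ni|ni] := ltnP i n; last first.
  by move=> _; rewrite pd_out//; exists 1 => //; exists 0; apply: bnd0.
move=> [e e0 [M h]]; exists (e / 2); first by rewrite divr_gt0.
by exists (M / e); apply: bnd_pd ni h.
Qed.

(** The second-order remainder of a power is a polynomial with nonnegative coefficients all of whose
    terms have degree at least 2 in [t]; replacing [nc t] by [d] costs the factor [(nc t / d) ^+ 2].
    The proof follows the recursion of the remainder in [k]. *)
Lemma taylor_pow (a t : C) (d : R) k : 0 < d -> nc t <= d ->
  nc ((a + t) ^+ k - a ^+ k - t * (a ^+ k.-1 *+ k)) <=
  (nc t / d) ^+ 2 * ((nc a + d) ^+ k - nc a ^+ k - d * (nc a ^+ k.-1 *+ k)).
Proof.
move=> d0 td; pose th := nc t / d.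
have ntd : nc t = th * d by rewrite /th divfK// lt0r_neq0.
elim: k => [|k IH].
  by rewrite !expr0 !mulr0n !mulr0 !subr0 !subrr nc0 mulr0.
have -> : (a + t) ^+ k.+1 - a ^+ k.+1 - t * (a ^+ k *+ k.+1) =
  (a + t) * ((a + t) ^+ k - a ^+ k - t * (a ^+ k.-1 *+ k)) + t ^+ 2 * (a ^+ k.-1 *+ k).
  case: k {IH} => [|k]; first by rewrite !expr0 !mulr0n mulr1n !expr1; ring.
  by rewrite [k.+1.-1]/= -!(mulr_natr (_ ^+ _)) !exprS -!natr1; ring.
have -> : (nc a + d) ^+ k.+1 - nc a ^+ k.+1 - d * (nc a ^+ k *+ k.+1) =
  (nc a + d) * ((nc a + d) ^+ k - nc a ^+ k - d * (nc a ^+ k.-1 *+ k)) + d ^+ 2 * (nc a ^+ k.-1 *+ k).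
  case: k {IH} => [|k]; first by rewrite !expr0 !mulr0n mulr1n !expr1; ring.
  by rewrite [k.+1.-1]/= -!(mulr_natr (_ ^+ _)) !exprS -!natr1; ring.
rewrite (le_trans (ncD _ _))// [leRHS]mulrDr lerD//.
  rewrite ncM mulrCA ler_pM ?nc_ge0//.
  by rewrite (le_trans (ncD _ _))// lerD2l.
rewrite -/th ncM ncX ntd exprMn -mulrA ler_wpM2l ?sqr_ge0// ler_wpM2l ?sqr_ge0//.
by rewrite -!(mulr_natr (_ ^+ _)) ncM ncX nc_nat.
Qed.

(** Second-order Taylor estimate, summed term by term: for the last variable by [taylor_pow], for
    the others by induction on the coefficients. Its quadratic form yields the derivative of the
    sum. *)
Lemma ev_deriv n M r i (s : F n) (v : nat -> C) t : (forall i, 0 < r i) -> (i < n)%N ->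
  bnd r M s -> (forall j, nc (v j) <= r j / 2) -> nc t <= r i / 2 ->
  nc (ev (fun j => if j == i then v j + t else v j) s - ev v s - t * ev v (pd i s)) <=
  (nc t / (r i / 2)) ^+ 2 * M.
Proof.
move=> r0 ni h vr tr; pose r2 j := r j / 2; pose w j := if j == i then v j + t else v j.
have r20 j : 0 < r2 j by rewrite divr_gt0.
have wr j : nc (w j) <= r j.
  rewrite /w; case: eqP => [->|_].
    by rewrite (le_trans (ncD _ _))// [leRHS]splitr lerD.
  by rewrite (le_trans (vr j))// ler_pdivrMr// ler_pMr// ler1n.
have vr' j : nc (v j) <= r j.
  by rewrite (le_trans (vr j))// ler_pdivrMr// ler_pMr// ler1n.
rewrite -/w; set th := nc t / _.
elim: n s M ni h => [//|n IH] s M ni h.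
have hp := bnd_pd r0 ni h.
have hn k := nrm_bnd (bnd_coef r0 k h).
have lw := ev_iter r0 wr h; have lv := ev_iter r0 vr' h.
have lp := ev_iter r20 vr hp.
have := climB (climB lw lv) (climM (clim_cst t) lp).
have [nin|nin] := eqVneq i n.
  subst i => l3.
  (* One term more of [s] than of its derivative, so that each power of the last variable meets its
     own derivative. *)
  have {}l3 : clim (fun N => \sum_(k < N.+1) ev w (psc s k) * w n ^+ k
     - \sum_(k < N.+1) ev v (psc s k) * v n ^+ k
     - t * \sum_(k < N) ev v (psc (pd n s) k) * v n ^+ k)
     (ev w s - ev v s - t * ev v (pd n s)).
    apply: climB; last exact: climM (clim_cst t) lp.
    apply: climB => e e0.
      by have [N0 hN0] := lw e e0; exists N0 => N hN; apply: hN0; rewrite leqW.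
    by have [N0 hN0] := lv e e0; exists N0 => N hN; apply: hN0; rewrite leqW.
  apply: (clim_le l3); exists 0%N => N _.
  have -> : \sum_(k < N.+1) ev w (psc s k) * w n ^+ k
     - \sum_(k < N.+1) ev v (psc s k) * v n ^+ k
     - t * \sum_(k < N) ev v (psc (pd n s) k) * v n ^+ k =
     \sum_(k < N.+1) ev v (psc s k) * ((v n + t) ^+ k - v n ^+ k - t * (v n ^+ k.-1 *+ k)).
    have -> : t * \sum_(k < N) ev v (psc (pd n s) k) * v n ^+ k =
       \sum_(k < N.+1) ev v (psc s k) * (t * (v n ^+ k.-1 *+ k)).
      rewrite big_ord_recl /= mulr0n !mulr0 add0r mulr_sumr; apply: eq_bigr => k _.
      rewrite /bump /= add1n pd_last /=.
      have -> : ev v (psc s k.+1 *+ k.+1) = ev v (psc s k.+1) *+ k.+1.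
        have [M' hM'] : exists M', bnd r M' (psc s k.+1) by exists (nrm r (psc s k.+1)).
        have : forall m, bnd r (M' *+ m) (psc s k.+1 *+ m) /\
            ev v (psc s k.+1 *+ m) = ev v (psc s k.+1) *+ m.
          elim=> [|m [IH1 IH2]]; first by rewrite !mulr0n (ev0 r0 vr'); split => //; exact: bnd0.
          by rewrite !mulrS (evD r0 vr' hM' IH1) IH2; split => //; apply: bndD.
        by move=> /(_ k.+1)[].
      by rewrite mulrnAl !mulrnAr mulrCA.
    rewrite -!sumrB; apply: eq_bigr => k _.
    have -> : ev w (psc s k) = ev v (psc s k).
      by apply: ev_ext => j jn; rewrite /w ltn_eqF.
    by rewrite !mulrBr {1}/w eqxx.
  rewrite (le_trans (nc_sum _ _ _))// (@le_trans _ _ (\sum_(k < N.+1) th ^+ 2 * (nrm r (psc s k) * r n ^+ k)))//.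
    apply: ler_sum => k _; rewrite ncM mulrCA ler_pM ?nc_ge0//.
      exact: (ev_le r0 vr' (hn k)).
    apply: le_trans (taylor_pow _ _ _ tr) _; first exact: (r20 n).
    rewrite -/th ler_wpM2l ?sqr_ge0//.
    apply: (@le_trans _ _ ((nc (v n) + r n / 2) ^+ k)).
      rewrite -addrA gerDl -opprD oppr_le0 addr_ge0 ?exprn_ge0 ?nc_ge0//.
      by rewrite mulr_ge0 ?(ltW (r20 n))// mulrn_wge0// exprn_ge0// nc_ge0.
    rewrite lerXn2r ?nnegrE ?addr_ge0 ?nc_ge0 ?(ltW (r20 _)) ?(ltW (r0 _))//.
    by rewrite [leRHS]splitr lerD2r.
  by rewrite -mulr_sumr ler_wpM2l ?sqr_ge0// bnd_split.
have {}ni : (i < n)%N by move: ni; rewrite ltnS leq_eqVlt (negPf nin).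
move=> l3; apply: (clim_le l3); exists 0%N => N _.
have -> : \sum_(k < N) ev w (psc s k) * w n ^+ k
     - \sum_(k < N) ev v (psc s k) * v n ^+ k
     - t * \sum_(k < N) ev v (psc (pd i s) k) * v n ^+ k =
     \sum_(k < N) (ev w (psc s k) - ev v (psc s k) - t * ev v (pd i (psc s k))) * v n ^+ k.
  rewrite mulr_sumr -!sumrB; apply: eq_bigr => k _.
  by rewrite {2}/w eq_sym (negPf nin) pd_coef// !mulrBl mulrA.
rewrite (le_trans (nc_sum _ _ _))// (@le_trans _ _ (\sum_(k < N) th ^+ 2 * (nrm r (psc s k) * r n ^+ k)))//.
  apply: ler_sum => k _; rewrite ncM mulrA ler_pM ?nc_ge0//.
    exact: IH.
  by rewrite ncX lerXn2r ?nnegrE ?nc_ge0 ?(ltW (r0 _)).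
by rewrite -mulr_sumr ler_wpM2l ?sqr_ge0// bnd_split.
Qed.

End Derivation.

(** * Inversion and Weierstrass division *)

Section Division.
Variable R : realType.
Local Notation C := R[i].
Local Notation F := (F R).
Implicit Types (n N : nat) (r : nat -> R).

(** Divided by its constant term, [s] is [1 - e] with [e] vanishing at 0; on a small polydisc [e]
    has norm at most 1/2 and the Neumann series applies. *)
Lemma summ_inv n (s : F n) : summ s -> c0 s != 0 -> exists2 t, summ t & s * t = 1.
Proof.
move=> hs s0; pose e : F n := 1 - fcst n (c0 s)^-1 * s.
have he : summ e by apply: summB (summ1 _ _) _; apply: summM hs; exact: summ_fcst.
have e0 : c0 e = 0 by rewrite /e c0B c0M c01 c0_fcst mulVf// subrr.
have [d d0 hd] := @small _ _ e 2^-1 he e0 ltac:(by rewrite invr_gt0).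
have {}hd := hd d d0 (lexx _).
have [||||Z hZ [M hM]] := @fixpoint _ n (fun=> d) (fun Z => e * Z) 1 1.
- by [].
- by move=> x y; rewrite mulrBr.
- by move=> M Z hZ; rewrite mulrC; apply: bndM.
- exact: (@bnd1 _ (fun=> d) (fun=> d0)). 
exists (fcst n (c0 s)^-1 * Z).
  by apply: summM (summ_fcst _ _) _; exact: bnd_summ hM.
rewrite mulrA [s * _]mulrC; have -> : fcst n (c0 s)^-1 * s = 1 - e by rewrite subKr.
by rewrite mulrBl mul1r {1}hZ addrK.
Qed.

(** Here every coefficient with respect to the last variable vanishes at 0, so shrinking the first
    [n] radii is enough. Keeping the last radius fixed is what makes Weierstrass division a
    contraction, since dividing by a power of the last variable costs a power of that radius. *)
Lemma bnd_scale_last n M e d (s : F n.+1) : 0 < d -> 0 < e -> e <= 1 ->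
  (forall k, c0 (psc s k) = 0) -> bnd (fun=> d) M s ->
  bnd (fun i => if (i < n)%N then e * d else d) (e * M) s.
Proof.
move=> d0 e0 e1 s0 h N; apply: (@le_trans _ _ (e * cs N (fun=> d) s)); last by rewrite ler_pM2l.
rewrite /= ltnn mulr_sumr; apply: ler_sum => k _; rewrite mulrA ler_pM2r ?exprn_gt0//.
have := @cs_scale _ n N (fun=> d) e _ (fun=> d0) e0 e1 (s0 k); apply: le_trans.
apply: cs_monor => [i|i ->//]; by case: ifP => _; rewrite ?mulr_gt0.
Qed.

(** Let [al] keep the degrees below [d] in the last variable and [tau] divide the others by its
    [d]-th power; [tau w] has an inverse [u]. For [q = Z * u] the condition [tau (g - q * w) = 0]
    reads [Z = tau g - tau (A * Z)] with [A = al w * u]. This contracts on thin polydiscs because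
    the coefficients of [al w] vanish at 0. *)
Lemma division n d (w g : F n.+1) : summ w -> summ g ->
  (forall k, (k < d)%N -> c0 (psc w k) = 0) -> c0 (psc w d) != 0 ->
  exists2 q, summ q & forall k, (d <= k)%N -> psc (g - q * w) k = 0.
Proof.
move=> hw hg w0 wd.
pose al (f : F n.+1) : F n.+1 := Ps (fun k => if (k < d)%N then psc f k else 0).
pose tau (f : F n.+1) : F n.+1 := Ps (fun k => psc f (k + d)%N).
have tauB f f' : tau (f - f') = tau f - tau f' by apply: psP => k; rewrite FcB.
have tauD f f' : tau (f + f') = tau f + tau f' by apply: psP => k; rewrite FcD.
have tauX f : tau (psX (F n) ^+ d * f) = f.
  by apply: psP => k; rewrite [LHS]psXnM_coef ltnNge leq_addl /= addnK.
have wE : w = al w + psX (F n) ^+ d * tau w.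
  apply: psP => k; rewrite FcD [psc (psX _ ^+ d * _) k]psXnM_coef [psc (al w) k]/=.
  by case: ltnP => dk; rewrite ?addr0// add0r /= subnK.
have htw : summ (tau w) := summ_shift d hw.
have [u hu wu] := @summ_inv _ (tau w) htw wd.
have hal : summ (al w).
  have -> : al w = w - psX (F n) ^+ d * tau w by rewrite {2}wE addrK.
  apply: summB hw _; apply: summM htw; elim: (d) => [|k IH]; first exact: summ1.
  by rewrite exprS; apply: summM IH; exact: summ_psX.
pose A := al w * u.
have [e e0 [M hM1 hM2]] := summ2 hal hu.
have [e' e'0 [M' hM' _]] := summ2 hg hg.
have [e1 [e10 le1 le1']] : exists e1, [/\ 0 < e1, e1 <= e & e1 <= e'].
  by exists (Num.min e e'); rewrite ?lt_min ?e0 ?ge_min ?lexx ?orbT//.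
have {}hM1 : bnd (fun=> e1) M (al w) by apply: bnd_monor hM1.
have {}hM2 : bnd (fun=> e1) M u by apply: bnd_monor hM2.
have {}hM' : bnd (fun=> e1) M' g by apply: bnd_monor hM'.
have M2 : 0 < M ^+ 2 + 1 by rewrite ltr_wpDl// sqr_ge0.
(* [A] has norm at most [eps * M * M] and [tau] costs a factor [e1 ^- d]; this [eps] makes the
   product at most 1/2. *)
pose eps := Num.min 1 (e1 ^+ d / (2 * (M ^+ 2 + 1))).
have eps0 : 0 < eps by rewrite lt_min ltr01 divr_gt0 ?exprn_gt0// mulr_gt0.
have eps1 : eps <= 1 by rewrite ge_min lexx.
pose r i := if (i < n)%N then eps * e1 else e1.
have r0 i : 0 < r i by rewrite /r; case: ifP => _; rewrite ?mulr_gt0.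
have re i : r i <= e1 by rewrite /r; case: ifP => _ //; rewrite ler_piMl// ltW.
have rn : r n = e1 by rewrite /r ltnn.
have hA : bnd r (eps * M * M) A.
  apply: (bndM r0); last exact: bnd_monor hM2.
  by apply: bnd_scale_last => // k; rewrite /=; case: ifP => [/w0//|_]; exact: c00.
have small_A : eps * M * M / e1 ^+ d <= 2^-1.
  rewrite ler_pdivrMr ?exprn_gt0// -mulrA -expr2.
  rewrite (@le_trans _ _ (e1 ^+ d / (2 * (M ^+ 2 + 1)) * M ^+ 2))//.
    by rewrite ler_wpM2r ?sqr_ge0// ge_min lexx orbT.
  rewrite invfM [e1 ^+ d * (_ / _)]mulrA [e1 ^+ d / 2]mulrC -mulrA ler_piMr ?mulr_ge0 ?exprn_ge0 ?(ltW e10)//.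
  by rewrite mulrC ler_pdivrMr// mul1r lerDl.
have [||||Z hZ [MZ hMZ]] := @fixpoint _ n.+1 r (fun Z => - tau (A * Z)) (M' / r n ^+ d) (tau g).
- exact: r0.
- by move=> x y; rewrite mulrBr tauB opprD.
- move=> B Z hB; have := bnd_shift d r0 (bndM r0 hA hB); rewrite rn => h.
  apply: bndN; apply: bnd_le h; rewrite mulrAC [B / 2]mulrC.
  by rewrite ler_wpM2r// (bnd_ge0 r0 hB).
- by apply: bnd_shift => //; exact: bnd_monor hM'.
exists (Z * u) => [|k dk]; first by apply: summM hu; exact: bnd_summ hMZ.
have : tau (g - Z * u * w) = 0.
  have -> : Z * u * w = A * Z + psX (F n) ^+ d * Z.
    rewrite {1}wE mulrDr /A; congr (_ + _); first by ring.
    rewrite mulrCA; congr (_ * _); rewrite -mulrA [u * _]mulrC wu.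
    by rewrite mulr1.
  by rewrite tauB tauD tauX opprD addrA; apply/eqP; rewrite subr_eq0 eq_sym; apply/eqP.
by move=> /(congr1 (fun f : F n.+1 => psc f (k - d))); rewrite /tau /= subnK.
Qed.

End Division.

(** * The ring of convergent power series *)

Section GermDef.
Variable R : realType.
Local Notation F := (F R).

Definition summb n : {pred F n} := fun s => `[< summ s >].

Lemma summb_subring n : subring_closed (@summb n).
Proof.
split=> [|s t|s t]; rewrite !unfold_in.
- by apply/asboolP; exact: summ1.
- by move=> /asboolP hs /asboolP ht; apply/asboolP; exact: summB.
- by move=> /asboolP hs /asboolP ht; apply/asboolP; exact: summM.
Qed.
HB.instance Definition _ n := GRing.isSubringClosed.Build (F n) (@summb n) (@summb_subring n).

Record germ n := Germ { gval : F n; gvalP : gval \in @summb n }.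
HB.instance Definition _ n := [isSub for (@gval n)].
HB.instance Definition _ n := [Choice of germ n by <:].
HB.instance Definition _ n := [SubChoice_isSubComNzRing of germ n by <:].

End GermDef.

Section Germs.
Variable R : realType.
Local Notation C := R[i].
Local Notation F := (F R).
Local Notation germ := (germ R).
Implicit Types n k : nat.

Lemma gsumm n (s : germ n) : summ (gval s).
Proof. by case: s => s /=; rewrite unfold_in => /asboolP. Qed.

Definition mkg n (s : F n) (h : summ s) : germ n :=
  @Germ R n s (introT (asboolP _) h).

Lemma gvalB n (s t : germ n) : gval (s - t) = gval s - gval t. Proof. exact: (raddfB (\val : germ n -> F n)). Qed.
Lemma gvalD n (s t : germ n) : gval (s + t) = gval s + gval t. Proof. exact: (raddfD (\val : germ n -> F n)). Qed.
Lemma gvalM n (s t : germ n) : gval (s * t) = gval s * gval t. Proof. exact: (rmorphM (\val : germ n -> F n)). Qed.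
Lemma gval1 n : gval (1 : germ n) = 1. Proof. exact: (rmorph1 (\val : germ n -> F n)). Qed.
Lemma gval0 n : gval (0 : germ n) = 0. Proof. exact: (raddf0 (\val : germ n -> F n)). Qed.
Lemma gval_sum n I (rg : seq I) (P : pred I) (f : I -> germ n) :
  gval (\sum_(i <- rg | P i) f i) = \sum_(i <- rg | P i) gval (f i).
Proof. exact: (raddf_sum (\val : germ n -> F n)). Qed.
Lemma gval_inj n : injective (@gval R n). Proof. exact: val_inj. Qed.

Lemma germ_domain n (s t : germ n) : s * t = 0 -> s = 0 \/ t = 0.
Proof.
move=> /(congr1 (@gval R n)); rewrite gvalM gval0 => /F_domain[] h.
- by left; apply: gval_inj; rewrite h gval0.
- by right; apply: gval_inj; rewrite h gval0.
Qed.

Definition gcst n (c : C) : germ n := mkg (summ_fcst n c).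
Lemma gcst_zmod n : zmod_morphism (gcst n).
Proof. by move=> a b; apply: gval_inj; rewrite gvalB; exact: fcstB. Qed.
Lemma gcst_monoid n : monoid_morphism (gcst n).
Proof. by split=> [|a b]; apply: gval_inj; rewrite ?gval1 ?gvalM /= ?fcst1 ?fcstM. Qed.
HB.instance Definition _ n := GRing.isZmodMorphism.Build C (germ n) (gcst n) (@gcst_zmod n).
HB.instance Definition _ n := GRing.isMonoidMorphism.Build C (germ n) (gcst n) (@gcst_monoid n).

Definition gi n (s : germ n) : germ n.+1 := mkg (summ_psC (gsumm s)).
Lemma gval_gi n (s : germ n) : gval (gi s) = psC (gval s). Proof. by []. Qed.
Lemma gi_zmod n : zmod_morphism (@gi n).
Proof.
by move=> a b; apply: gval_inj; rewrite gvalB !gval_gi gvalB; exact: (raddfB (psC (A := F n))).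
Qed.
Lemma gi_monoid n : monoid_morphism (@gi n).
Proof.
split=> [|a b]; apply: gval_inj; rewrite ?gvalM !gval_gi ?gval1 ?gvalM.
- exact: (rmorph1 (psC (A := F n))).
- exact: (rmorphM (psC (A := F n))).
Qed.
HB.instance Definition _ n := GRing.isZmodMorphism.Build (germ n) (germ n.+1) (@gi n) (@gi_zmod n).
HB.instance Definition _ n := GRing.isMonoidMorphism.Build (germ n) (germ n.+1) (@gi n) (@gi_monoid n).

Lemma gi_inj n : injective (@gi n).
Proof.
move=> a b /(congr1 (fun s : germ n.+1 => psc (gval s : ps (F n)) 0)) h.
by apply: gval_inj.
Qed.

(* The last variable; [gi] embeds the germs in the other variables. *)
Definition gX n : germ n.+1 := mkg (summ_psX R n).
Definition gcoef n (s : germ n.+1) k : germ n := mkg (summ_coef k (gsumm s)).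
Definition gpd n i (s : germ n) : germ n := mkg (summ_pd i (gsumm s)).
Definition gc0 n (s : germ n) : C := c0 (gval s).
Definition gev n (v : nat -> C) (s : germ n) : C := ev v (gval s).

Lemma gval_pd n i (s : germ n) : gval (gpd i s) = pd i (gval s). Proof. by []. Qed.
Lemma gpd_zmod n i : zmod_morphism (@gpd n i).
Proof. by move=> a b; apply: gval_inj; rewrite gvalB !gval_pd gvalB pdB. Qed.
HB.instance Definition _ n i := GRing.isZmodMorphism.Build (germ n) (germ n) (@gpd n i) (@gpd_zmod n i).
Lemma gpdM n i (s t : germ n) : gpd i (s * t) = gpd i s * t + s * gpd i t.
Proof. by apply: gval_inj; rewrite gvalD !gvalM !gval_pd gvalM pdM. Qed.
Lemma gpd_gi n i (s : germ n) : (i < n)%N -> gpd i (gi s) = gi (gpd i s).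
Proof. by move=> ni; apply: gval_inj; exact: pd_psC. Qed.
Lemma gpd_gi_last n (s : germ n) : gpd n (gi s) = 0.
Proof. by apply: gval_inj; rewrite gval0; exact: pd_psC_last. Qed.
Lemma gpd_gX n i : (i < n)%N -> gpd i (gX n) = 0.
Proof. by move=> ni; apply: gval_inj; rewrite gval0; exact: pd_psX. Qed.
Lemma gpd_gX_last n : gpd n (gX n) = 1.
Proof. by apply: gval_inj; rewrite gval1; exact: pd_psX_last. Qed.
Lemma gpd_gcst n i c : gpd i (gcst n c) = 0.
Proof. by apply: gval_inj; rewrite gval0; exact: pd_fcst. Qed.
Lemma gpd_coef n i (s : germ n.+1) k : i != n -> gcoef (gpd i s) k = gpd i (gcoef s k).
Proof. by move=> ni; apply: gval_inj; exact: pd_coef. Qed.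

Lemma gc0_zmod n : zmod_morphism (@gc0 n).
Proof. by move=> a b; rewrite /gc0 gvalB c0B. Qed.
Lemma gc0_monoid n : monoid_morphism (@gc0 n).
Proof. by split=> [|a b]; rewrite /gc0 ?gval1 ?c01 ?gvalM ?c0M. Qed.
HB.instance Definition _ n := GRing.isZmodMorphism.Build (germ n) C (@gc0 n) (@gc0_zmod n).
HB.instance Definition _ n := GRing.isMonoidMorphism.Build (germ n) C (@gc0 n) (@gc0_monoid n).
Lemma gc0_cst n c : gc0 (gcst n c) = c. Proof. exact: c0_fcst. Qed.
Lemma gc0_gi n (s : germ n) : gc0 (gi s) = gc0 s. Proof. by []. Qed.
Lemma gc0_gX n : gc0 (gX n) = 0. Proof. exact: c00. Qed.
Lemma gc0_coef0 n (s : germ n.+1) : gc0 (gcoef s 0) = gc0 s. Proof. by []. Qed.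
Lemma gcst_S n c : gcst n.+1 c = gi (gcst n c). Proof. exact: gval_inj. Qed.

Lemma gunit n (s : germ n) : gc0 s != 0 -> exists t, s * t = 1.
Proof.
move=> s0; have [t ht st] := summ_inv (gsumm s) s0.
by exists (mkg ht); apply: gval_inj; rewrite gvalM gval1.
Qed.

Lemma gsplit n (s : germ n.+1) : exists t, s = gi (gcoef s 0) + gX n * t.
Proof.
have ht : summ (psshift (gval s) : F n.+1).
  have := summ_shift 1 (gsumm s); congr summ.
  by apply: psP => k; rewrite /= addn1.
exists (mkg ht); apply: gval_inj; rewrite gvalD gvalM; exact: (ps_split (gval s)).
Qed.

Lemma gcoef_ext n (s t : germ n.+1) : (forall k, gcoef s k = gcoef t k) -> s = t.
Proof. by move=> h; apply: gval_inj; apply: psP => k; exact: (congr1 (@gval R n) (h k)). Qed.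

(** The remainder is returned as a polynomial over the germs in the first [n] variables, evaluated
    at the last variable, so that the algebra of polynomial relations applies to it. *)
Lemma gweierstrass n d (w g : germ n.+1) :
  (forall k, (k < d)%N -> gc0 (gcoef w k) = 0) -> gc0 (gcoef w d) != 0 ->
  exists (q : germ n.+1) (p : {poly germ n}),
    (size p <= d)%N /\ g = q * w + (map_poly (@gi n) p).[gX n].
Proof.
move=> w0 wd; have [q hq qd] := division (gsumm w) (gsumm g) w0 wd.
pose rm := g - mkg hq * w.
exists (mkg hq), (\poly_(k < d) gcoef rm k); split; first exact: size_poly.
apply/eqP; rewrite addrC -subr_eq -/rm; apply/eqP.
rewrite (horner_coef_wide _ (leq_trans (size_poly _ _) (size_poly _ _))).
apply: gval_inj; apply: psP => k.
rewrite gval_sum Fc_sum.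
transitivity (\sum_(i < d) if k == i then psc (gval rm) i else 0).
  have [kd|dk] := ltnP k d.
    move: (gval rm) => x; rewrite (bigD1 (Ordinal kd))// big1 => [|j jk]; last by rewrite ifN// eq_sym.
    by rewrite eqxx; exact/esym/addr0.
  rewrite big1 => [|j _]; last by rewrite ifN// gtn_eqF// (leq_trans (ltn_ord j) dk).
  by rewrite gvalB gvalM; exact: qd.
apply: eq_bigr => j _; rewrite coef_map coef_poly ltn_ord gvalM.
have -> : gval (gX n ^+ j) = psX (F n) ^+ j by exact: (rmorphXn (\val : germ n.+1 -> F n.+1)).
by rewrite FcCXn.
Qed.

(* Points are infinite sequences, of which a germ in [n] variables reads the
   first [n] entries; [nz P] means that [P] holds near 0. *)
Definition nz (P : (nat -> C) -> Prop) :=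
  exists2 e : R, 0 < e & forall v, (forall i, nc (v i) <= e) -> P v.

Lemma nzT (P : (nat -> C) -> Prop) : (forall v, P v) -> nz P.
Proof. by move=> h; exists 1. Qed.

Lemma nz2 (P Q T : (nat -> C) -> Prop) :
  (forall v, P v -> Q v -> T v) -> nz P -> nz Q -> nz T.
Proof.
move=> h [e e0 p] [e' e'0 q]; exists (Num.min e e'); first by rewrite lt_min e0.
move=> v hv; apply: h; [apply: p|apply: q] => i; rewrite (le_trans (hv i))// ge_min lexx ?orbT//.
Qed.

Lemma nz1 (P T : (nat -> C) -> Prop) : (forall v, P v -> T v) -> nz P -> nz T.
Proof. by move=> h [e e0 p]; exists e => // v /p/h. Qed.

Lemma nzI (P Q : (nat -> C) -> Prop) : nz P -> nz Q -> nz (fun v => P v /\ Q v).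
Proof. by apply: nz2. Qed.

Lemma nz_all (m : nat) (P : nat -> (nat -> C) -> Prop) :
  (forall i, (i < m)%N -> nz (P i)) -> nz (fun v => forall i, (i < m)%N -> P i v).
Proof.
elim: m => [|m IH] h; first exact: nzT.
apply: (@nz2 _ _ _ _ (IH _) (h m (ltnSn m))) => [v h1 h2 i|i im]; last by apply: h; rewrite ltnW.
by rewrite ltnS leq_eqVlt => /orP[/eqP -> //|/h1].
Qed.

Lemma gev_ext n (s : germ n) v w : (forall i, (i < n)%N -> v i = w i) -> gev v s = gev w s.
Proof. exact: ev_ext. Qed.

Lemma nz_gev2 n (s t : germ n) : nz (fun v => [/\ gev v (s - t) = gev v s - gev v t,
   gev v (s + t) = gev v s + gev v t & gev v (s * t) = gev v s * gev v t]).
Proof.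
have [e e0 [M h h']] := summ2 (gsumm s) (gsumm t); exists e => // v hv.
rewrite /gev gvalB gvalD gvalM (evB (r := fun=> e) _ hv h h')//.
by rewrite (evD (r := fun=> e) _ hv h h')// (evM (r := fun=> e) _ hv h h').
Qed.
Lemma nz_gevB n (s t : germ n) : nz (fun v => gev v (s - t) = gev v s - gev v t).
Proof. by apply: nz1 (nz_gev2 s t) => v []. Qed.
Lemma nz_gevD n (s t : germ n) : nz (fun v => gev v (s + t) = gev v s + gev v t).
Proof. by apply: nz1 (nz_gev2 s t) => v []. Qed.
Lemma nz_gevM n (s t : germ n) : nz (fun v => gev v (s * t) = gev v s * gev v t).
Proof. by apply: nz1 (nz_gev2 s t) => v []. Qed.
Lemma gev_cst n v c : gev v (gcst n c) = c. Proof. exact: ev_fcst. Qed.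
Lemma gev1 n v : gev v (1 : germ n) = 1. Proof. by rewrite -(rmorph1 (gcst n)) gev_cst. Qed.
Lemma gev0 n v : gev v (0 : germ n) = 0. Proof. by rewrite -(raddf0 (gcst n)) gev_cst. Qed.
Lemma nz_gev_gi n (s : germ n) : nz (fun v => gev v (gi s) = gev v s).
Proof. by have [e e0 [M h]] := gsumm s; exists e => // v hv; apply: (ev_psC (r := fun=> e) _ hv h). Qed.
Lemma gev_gX n v : gev v (gX n) = v n.
Proof.
apply: (@ev_psX _ (fun i => nc (v i) + 1)) => i; rewrite ?lerDl//.
by rewrite ltr_wpDl ?nc_ge0.
Qed.

Lemma gidentity n (s : germ n) : s != 0 -> forall e, 0 < e ->
  exists2 v : nat -> C, forall i, nc (v i) <= e & gev v s != 0.
Proof.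
move=> s0; apply: identity (gsumm s) _; apply: contra s0 => /eqP s0; apply/eqP.
by apply: gval_inj; rewrite s0 gval0.
Qed.

(** The identity theorem applied to [s - t]. Germs constructed analytically are compared through
    their values by means of it. *)
Lemma gev_inj n (s t : germ n) : nz (fun v => gev v s = gev v t) -> s = t.
Proof.
move=> h; apply/eqP; rewrite -subr_eq0; apply/negPn/negP => st0.
have [e e0 he] := nz2 (T := fun v => gev v (s - t) = 0)
  (fun v => (fun h1 h2 => etrans h2 (etrans (congr1 (fun x => x - _) h1) (subrr _)))) h (nz_gevB s t).
by have [v /he ->] := gidentity st0 e0; rewrite eqxx.
Qed.

Lemma nz_small n (s : germ n) e : gc0 s = 0 -> 0 < e -> nz (fun v => nc (gev v s) <= e).
Proof.
move=> s0 e0; have [d d0 h] := small (gsumm s) s0 e0; exists d => // v vd.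
by apply: (ev_le (r := fun=> d) _ vd (h d d0 (lexx _))).
Qed.

Lemma gev_at0 n (s : germ n) : gev (fun=> 0) s = gc0 s.
Proof.
have [e e0 he] := nz_gevB s (gcst n (gc0 s)).
have z0 (d : R) : 0 < d -> forall i : nat, nc (0 : C) <= d by move=> d0 _; rewrite nc0 ltW.
have := he (fun=> 0) (z0 e e0).
rewrite gev_cst => h; apply/eqP; rewrite -subr_eq0 -h; apply/eqP/nc_eq0/eqP.
rewrite eq_le nc_ge0 andbT; apply: le_lim_eps => d d0; rewrite add0r.
have [|e1 e10 he1] := @nz_small n (s - gcst n (gc0 s)) d _ d0.
  by rewrite raddfB /= gc0_cst subrr.
exact: he1 (z0 e1 e10).
Qed.

Lemma nz_neq0 n (s : germ n) : gc0 s != 0 -> nz (fun v => gev v s != 0).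
Proof.
move=> /gunit[t st]; apply: nz1 (nz_gevM s t) => v; rewrite st gev1 => h.
by apply/eqP => s0; move/eqP: h; rewrite s0 mul0r oner_eq0.
Qed.

(** Continuity at 0 of the map with components [g i]. Entries beyond [n] are set to 0 because [P] is
    only known where all entries are small. *)
Lemma nz_comp n k (g : nat -> germ k) (P : (nat -> C) -> Prop) :
  (forall i, (i < n)%N -> gc0 (g i) = 0) -> nz P ->
  nz (fun w => P (fun i => if (i < n)%N then gev w (g i) else 0)).
Proof.
move=> g0 [e e0 he].
have := @nz_all n (fun i w => nc (gev w (g i)) <= e) (fun i ni => nz_small (g0 i ni) e0).
apply: nz1 => w hw; apply: he => i; case: ifP => [/hw//|_].
by rewrite nc0 ltW.
Qed.

(** The composite is chosen for each germ separately; since values determine germs, the choice is a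
    ring morphism. *)
Lemma subst_ex n k (g : nat -> germ k) : (forall i, (i < n)%N -> gc0 (g i) = 0) ->
  exists sg : {rmorphism germ n -> germ k}, forall s,
    nz (fun w => gev w (sg s) = gev (fun i => gev w (g i)) s).
Proof.
move=> g0; pose g' i : germ k := if (i < n)%N then g i else 0.
have g'0 i : gc0 (g' i) = 0 by rewrite /g'; case: ifP => [/g0//|_]; rewrite raddf0.
have gg' w (s : germ n) : gev (fun i => gev w (g' i)) s = gev (fun i => gev w (g i)) s.
  by apply: gev_ext => i ni; rewrite /g' ni.
have /choice[sg hsg] : forall s : germ n, exists t : germ k,
    nz (fun w => gev w t = gev (fun i => gev w (g i)) s).
  move=> s; have [e e0 [M h]] := gsumm s.
  have [d d0 hd] : exists2 d, 0 < d & forall i, bnd (fun=> d) e (gval (g' i)).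
    suff [d d0 hd] : exists2 d, 0 < d & forall i, (i < n)%N -> bnd (fun=> d) e (gval (g' i)).
      exists d => // i; have [/hd//|ni] := ltnP i n; rewrite /g' ifN -?leqNgt// gval0.
      by apply: bnd_le (ltW e0) _; exact: bnd0.
    elim: (n) => [|m [d1 d10 h1]]; first by exists 1.
    have [d2 d20 h2] := small (gsumm (g' m)) (g'0 m) e0.
    exists (Num.min d1 d2) => [|i]; first by rewrite lt_min d10.
    rewrite ltnS leq_eqVlt => /orP[/eqP ->|/h1].
      by apply: h2; rewrite ?lt_min ?d10 ?ge_min ?lexx ?orbT.
    by apply: bnd_monor => [_|_ _]; rewrite ?lt_min ?d10 ?ge_min ?lexx.
  have [c hc hcw] := comp_ex (fun=> e0) (fun=> d0) h hd.
  exists (mkg (bnd_summ (fun=> d0) hc)); exists d => // w wd.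
  by rewrite -gg'; exact: hcw.
have push P : nz P -> nz (fun w => P (fun i => gev w (g' i))).
  move=> hP; have := nz_comp (n := n) (g := g') (fun i _ => g'0 i) hP.
  apply: nz1 => w; congr P; apply/funext => i; case: ifP => // ni.
  by rewrite /g' ni gev0.
have h1 : zmod_morphism sg.
  move=> s t; apply: gev_inj; have := push _ (nz_gevB s t).
  move=> /nzI/(_ (hsg (s - t)))/nzI/(_ (hsg s))/nzI/(_ (hsg t))/nzI/(_ (nz_gevB (sg s) (sg t))).
  by apply: nz1 => v [[[[+ ->] h2] h3] ->]; rewrite !gg' h2 h3.
have h2 : monoid_morphism sg.
  split=> [|s t]; apply: gev_inj.
    by apply: nz1 (hsg 1) => v ->; rewrite !gev1.
  have := push _ (nz_gevM s t).
  move=> /nzI/(_ (hsg (s * t)))/nzI/(_ (hsg s))/nzI/(_ (hsg t))/nzI/(_ (nz_gevM (sg s) (sg t))).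
  by apply: nz1 => v [[[[+ ->] h2] h3] ->]; rewrite !gg' h2 h3.
pose m1 := GRing.isZmodMorphism.Build _ _ sg h1.
pose m2 := GRing.isMonoidMorphism.Build _ _ sg h2.
pose sg' : {rmorphism germ n -> germ k} := HB.pack sg m1 m2.
by exists sg'.
Qed.

End Germs.

(** * Order of vanishing, chain rule, quotients with zero derivatives *)

Section ChainRule.
Variable R : realType.
Local Notation C := R[i].
Local Notation F := (F R).
Local Notation germ := (germ R).
Implicit Types n k : nat.

(** Order of vanishing at least [m] at 0: all coefficients of total degree below [m] are 0. The
    truncated subtraction makes the condition on [psc s j] empty for [j >= m]. *)
Fixpoint vord n (m : nat) : F n -> Prop :=
  match n return F n -> Prop with
  | 0 => fun s => m = 0 \/ s = 0
  | n'.+1 => fun s => forall j, vord (m - j) (psc s j)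
  end.

Lemma vord0 n (s : F n) : vord 0 s.
Proof. by elim: n s => [|n IH] s /=; [left|move=> j; rewrite sub0n]. Qed.

Lemma vord_mono n m m' (s : F n) : (m' <= m)%N -> vord m s -> vord m' s.
Proof.
elim: n s m m' => [|n IH] s m m' mm' /=.
  by case=> [m0|->]; [left; move: mm'; rewrite m0 leqn0 => /eqP|right].
by move=> h j; apply: IH (h j); rewrite leq_sub2r.
Qed.

Lemma vordD n m (s t : F n) : vord m s -> vord m t -> vord m (s + t).
Proof.
elim: n s t m => [|n IH] s t m.
  by case=> [->|->]; [left|case=> [->|->]; [left|right; exact: addr0]].
by move=> hs ht j; rewrite FcD; apply: IH.
Qed.

Lemma vordz n m : vord m (0 : F n).
Proof. by elim: n m => [|n IH] m /=; [right|move=> j; exact: IH]. Qed.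

Lemma vordM n m m' (s t : F n) : vord m s -> vord m' t -> vord (m + m') (s * t).
Proof.
elim: n s t m m' => [|n IH] s t m m'.
  by case=> [->|->]; [case=> [->|->]; [left|right; exact: mulr0]|right; exact: mul0r].
move=> hs ht k; rewrite FcM; elim/big_ind: _ => [|x y|j _]; [exact: vordz|exact: vordD|].
apply: vord_mono (IH _ _ _ _ (hs j) (ht (k - j)%N)); have := ltn_ord j; lia.
Qed.

Lemma vord_all n (s : F n) : (forall m, vord m s) -> s = 0.
Proof.
elim: n s => [|n IH] s h; first by case: (h 1%N).
by apply: psP => k; apply: IH => m; have := h (m + k)%N k; rewrite addnK.
Qed.

Lemma vord1 n (s : F n) : c0 s = 0 -> vord 1 s.
Proof.
elim: n s => [|n IH] s /= s0; first by right.
by case=> [|j]; [exact: IH|exact: vord0].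
Qed.

Fixpoint gvar n (i : nat) : germ n :=
  match n return germ n with
  | 0 => 0
  | m.+1 => if i == m then gX R m else gi (gvar m i)
  end.

Lemma gc0_gvar n i : gc0 (gvar n i) = 0.
Proof.
elim: n => [|n IH] /=; first exact: raddf0.
by case: eqP => _; [exact: gc0_gX|rewrite gc0_gi].
Qed.

Lemma gev_gvar n i : (i < n)%N -> nz (fun v => gev v (gvar n i) = v i).
Proof.
elim: n => [//|n IH]; rewrite ltnS leq_eqVlt /=.
have [->|ni] := eqVneq i n; first by move=> _; apply: nzT => v; rewrite gev_gX.
by move=> /= /IH; move/nzI/(_ (nz_gev_gi (gvar n i))); apply: nz1 => v [<- ->].
Qed.

Lemma gpd_gvar n i j : (i < n)%N -> (j < n)%N -> gpd i (gvar n j) = (i == j)%:R.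
Proof.
elim: n => [//|n IH]; rewrite !ltnS /=.
have [->|jn] := eqVneq j n.
  have [->|iN] := eqVneq i n; first by rewrite gpd_gX_last.
  by rewrite leq_eqVlt (negPf iN) => /= ni _; rewrite gpd_gX.
have [->|iN] := eqVneq i n; first by rewrite gpd_gi_last eq_sym (negPf jn).
rewrite leq_eqVlt (negPf iN) [(j <= n)%N]leq_eqVlt (negPf jn) => /= ni nj.
by rewrite gpd_gi// IH// rmorph_nat.
Qed.

(** Hadamard's lemma: the germs vanishing at 0 are generated by the variables. *)
Lemma gdecomp n (s : germ n) : exists q : nat -> germ n,
  s = gcst n (gc0 s) + \sum_(i < n) gvar n i * q i.
Proof.
elim: n s => [|n IH] s.
  exists (fun=> 0); rewrite big_ord0 addr0; exact: gval_inj.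
have [t st] := gsplit s; have [q hq] := IH (gcoef s 0).
exists (fun i => if i == n then t else gi (q i)).
rewrite {1}st {1}hq gc0_coef0 gcst_S rmorphD -addrA; congr (_ + _).
rewrite big_ord_recr /= eqxx; congr (_ + _); rewrite raddf_sum.
by apply: eq_bigr => i _; rewrite /= ltn_eqF// rmorphM.
Qed.

(* By [gdecomp], such an [E] raises the order of vanishing indefinitely. *)
Lemma derivation_eq0 n k (sg : {rmorphism germ n -> germ k}) (E : germ n -> germ k) :
  (forall i, (i < n)%N -> gc0 (sg (gvar n i)) = 0) ->
  zmod_morphism E -> (forall a b, E (a * b) = E a * sg b + sg a * E b) ->
  (forall c, E (gcst n c) = 0) -> (forall i, (i < n)%N -> E (gvar n i) = 0) ->
  forall s, E s = 0.
Proof.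
move=> sg0 EB EM Ec Ev s; have E0 : E 0 = 0 by have := EB 0 0; rewrite !subrr.
have ED a b : E (a + b) = E a + E b.
  by rewrite -[b in LHS]opprK EB -[- b]sub0r EB E0 sub0r opprK.
apply: gval_inj; rewrite gval0; apply: vord_all => m.
elim: m s => [|m IH] s; first exact: vord0.
have [q ->] := gdecomp s.
rewrite ED Ec add0r (big_morph E ED E0) gval_sum.
elim/big_ind: _ => [|x y|i _]; [exact: vordz|exact: vordD|].
rewrite EM Ev// mul0r add0r gvalM -add1n; apply: vordM; last exact: IH.
by apply: vord1; exact: sg0.
Qed.

Lemma subst_germ n k (g : nat -> germ k) : (forall i, (i < n)%N -> gc0 (g i) = 0) ->
  exists sg : {rmorphism germ n -> germ k},
    [/\ forall s, nz (fun w => gev w (sg s) = gev (fun i => gev w (g i)) s),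
        forall c, sg (gcst n c) = gcst k c
      & forall i, (i < n)%N -> sg (gvar n i) = g i].
Proof.
move=> g0; have [sg hsg] := subst_ex g0; exists sg; split => // [c|i ni].
  by apply: gev_inj; apply: nz1 (hsg (gcst n c)) => v ->; rewrite !gev_cst.
have h2 := nz_comp (P := fun v => gev v (gvar n i) = v i) g0 (gev_gvar ni).
apply: gev_inj; have := hsg (gvar n i); move/nzI/(_ h2).
apply: nz1 => v [->] => h; rewrite ni in h; rewrite -h.
by apply: gev_ext => j jn; rewrite jn.
Qed.

(** The difference of the two sides is a derivation along [sg] that kills constants and variables,
    hence is 0. *)
Lemma chain_rule n k (sg : {rmorphism germ n -> germ k}) l s :
  (forall i, (i < n)%N -> gc0 (sg (gvar n i)) = 0) ->
  (forall c, sg (gcst n c) = gcst k c) ->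
  gpd l (sg s) = \sum_(i < n) gpd l (sg (gvar n i)) * sg (gpd i s).
Proof.
move=> sg0 sgc.
pose E s := gpd l (sg s) - \sum_(i < n) gpd l (sg (gvar n i)) * sg (gpd i s).
apply/eqP; rewrite -subr_eq0; apply/eqP; rewrite -/(E s).
apply: (derivation_eq0 sg0) => [a b|a b|c|j jn] {s}; rewrite /E.
- have -> : \sum_(i < n) gpd l (sg (gvar n i)) * sg (gpd i (a - b)) =
    \sum_(i < n) gpd l (sg (gvar n i)) * sg (gpd i a) -
    \sum_(i < n) gpd l (sg (gvar n i)) * sg (gpd i b).
    by rewrite -sumrB; apply: eq_bigr => i _; rewrite (raddfB (@gpd R n i)) rmorphB mulrBr.
  by rewrite rmorphB (raddfB (@gpd R k l)); ring.
- rewrite rmorphM gpdM.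
  rewrite mulrBl mulrBr mulr_suml mulr_sumr addrACA -opprD -big_split; congr (_ - _).
  apply: eq_bigr => i _ /=; rewrite gpdM rmorphD !rmorphM mulrDr; congr (_ + _).
    by rewrite mulrA.
  by rewrite mulrCA.
- rewrite sgc gpd_gcst sub0r big1 ?oppr0// => i _.
  by rewrite gpd_gcst raddf0 mulr0.
- rewrite (bigD1 (Ordinal jn))//= gpd_gvar// eqxx rmorph1 mulr1 big1 ?addr0 ?subrr// => i ij.
  by rewrite gpd_gvar// -val_eqE /= in ij *; rewrite (negPf ij) raddf0 mulr0.
Qed.

Lemma gcoefM n (s t : germ n.+1) k :
  gcoef (s * t) k = \sum_(j < k.+1) gcoef s j * gcoef t (k - j).
Proof.
apply: gval_inj; rewrite gval_sum.
by transitivity (psc (gval (s * t)) k).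
Qed.

Lemma gcoef_low n (s t : germ n.+1) i j :
  (forall k, (k < i)%N -> gcoef s k = 0) -> (forall k, (k < j)%N -> gcoef t k = 0) ->
  gcoef (s * t) (i + j) = gcoef s i * gcoef t j.
Proof.
move=> si tj; have iij : (i < (i + j).+1)%N by rewrite ltnS leq_addr.
rewrite gcoefM (bigD1 (Ordinal iij))//= addKn big1 ?addr0// => k ki.
rewrite -val_eqE /= in ki; have [lt|gt|eq] := ltngtP k i.
- by rewrite si ?mul0r.
- by rewrite tj ?mulr0//; have := ltn_ord k; lia.
- by rewrite eq eqxx in ki.
Qed.

Lemma gcoef_giM n (a : germ n) (s : germ n.+1) k : gcoef (gi a * s) k = a * gcoef s k.
Proof.
apply: gval_inj; rewrite gvalM; transitivity (psc (gval (gi a * s)) k) => //.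
by rewrite gvalM gval_gi; exact: psCM_coef.
Qed.

Lemma gcoefB n (s t : germ n.+1) k : gcoef (s - t) k = gcoef s k - gcoef t k.
Proof.
by apply: gval_inj; rewrite gvalB.
Qed.

Lemma gcoef_euler n (s : germ n.+1) k : gcoef (gX R n * gpd n s) k = gcoef s k *+ k.
Proof.
apply: gval_inj; transitivity (psc (gval (gX R n * gpd n s)) k) => //.
rewrite gvalM gval_pd pd_last.
transitivity (psc (psX (F n) * psderiv (gval s)) k) => //; rewrite psXM_coef.
case: k => [|k]; first by rewrite mulr0n gval0.
exact/esym/(raddfMn (\val : germ n -> F n)).
Qed.

Lemma gcoef_gXM n (s : germ n.+1) k :
  gcoef (gX R n * s) k = if k is k'.+1 then gcoef s k' else 0.
Proof.
apply: gval_inj; transitivity (psc (gval (gX R n * s)) k) => //; rewrite gvalM.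
transitivity (psc (psX (F n) * gval s) k) => //; rewrite psXM_coef.
by case: k => [|k]; rewrite ?gval0.
Qed.

Lemma ex_lowest n (s : germ n.+1) : s != 0 ->
  exists2 d, gcoef s d != 0 & forall k, (k < d)%N -> gcoef s k = 0.
Proof.
move=> s0; have : exists d, gcoef s d != 0.
  apply: contrapT => H; move/eqP: s0; apply; apply: gcoef_ext => k.
  transitivity (0 : germ n); last by apply: gval_inj.
  by apply/eqP/negPn/negP => sk; apply: H; exists k.
case/ex_minnP => d sd mind; exists d => // k kd; apply/eqP/negPn/negP => /mind.
by rewrite leqNgt kd.
Qed.

Lemma germ_mulf_eq0 n (a b : germ n) : a * b = 0 -> a != 0 -> b = 0.
Proof. by move=> /germ_domain[->|//]; rewrite eqxx. Qed.

Lemma germ_natr n (a : germ n) k : a *+ k = 0 -> (0 < k)%N -> a = 0.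
Proof.
move=> + k0; rewrite -mulr_natr mulrC => /germ_mulf_eq0; apply.
rewrite -(rmorph_nat (gcst n)); apply/eqP => /(congr1 (@gc0 R n)).
by rewrite gc0_cst raddf0 => /eqP; rewrite pnatr_eq0 -leqn0 leqNgt k0.
Qed.

(** Let [s] be the lowest degree of [b] in the last variable. The combination [e], whose coefficient
    of degree [s] is 0 by construction, satisfies [b * e' = e * b']. If [e] were nonzero with lowest
    degree [t], comparing lowest terms after the Euler operator would force [t = s], a
    contradiction. So [a / b] is the quotient of the coefficients of degree [s], constant by
    induction. *)
Lemma quotient_cst n (a b : germ n) : b != 0 ->
  (forall i, (i < n)%N -> b * gpd i a = a * gpd i b) -> exists l, a = gcst n l * b.
Proof.
elim: n a b => [|n IH] a b b0 h.
  have b0' : (gval b : C) != 0.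
    by apply: contra b0 => /eqP b0'; apply/eqP; apply: gval_inj; rewrite b0' gval0.
  exists ((gval a : C) / gval b); apply: gval_inj; rewrite gvalM.
  exact/esym/(@divfK C).
have [s bs lowb] := ex_lowest b0.
pose e := gi (gcoef b s) * a - gi (gcoef a s) * b.
have e0 : e = 0.
  apply/eqP/negPn/negP => eN0; have [t et lowe] := ex_lowest eN0.
  have be : b * (gX R n * gpd n e) = e * (gX R n * gpd n b).
    rewrite /e raddfB /= !gpdM !gpd_gi_last !mul0r !add0r.
    have hn := h n (ltnSn n); rewrite !mulrBr mulrBl; congr (_ - _); last by ring.
    transitivity (gX R n * gi (gcoef b s) * (b * gpd n a)); first by ring.
    by rewrite hn; ring.
  have : gcoef (b * (gX R n * gpd n e)) (s + t) = gcoef (e * (gX R n * gpd n b)) (t + s).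
    by rewrite be addnC.
  rewrite !gcoef_low//; first last.
  - by move=> k kt; rewrite gcoef_euler lowe// mul0rn.
  - by move=> k ks; rewrite gcoef_euler lowb// mul0rn.
  rewrite !gcoef_euler !mulrnAr [gcoef e t * _]mulrC => eq.
  have [ts|st|ts] := ltngtP t s.
  - have : gcoef b s * gcoef e t *+ (s - t) = 0 by rewrite mulrnBr ?eq ?subrr// ltnW.
    by move/germ_natr; rewrite subn_gt0 => /(_ ts)/germ_mulf_eq0/(_ bs)/eqP; rewrite (negPf et).
  - have : gcoef b s * gcoef e t *+ (t - s) = 0 by rewrite mulrnBr ?eq ?subrr// ltnW.
    by move/germ_natr; rewrite subn_gt0 => /(_ st)/germ_mulf_eq0/(_ bs)/eqP; rewrite (negPf et).
  - by move: et; rewrite ts /e gcoefB !gcoef_giM mulrC subrr eqxx.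
have {e0} ab : gi (gcoef b s) * a = gi (gcoef a s) * b.
  by apply/eqP; rewrite -subr_eq0 -/e e0.
have lowa k : (k < s)%N -> gcoef a k = 0.
  move=> ks; have := congr1 (fun x => gcoef x k) ab; rewrite !gcoef_giM (lowb k ks) mulr0.
  by move/germ_mulf_eq0; apply.
have [i ni|l hl] := IH (gcoef a s) (gcoef b s) bs.
  have := congr1 (fun x => gcoef x (s + s)) (h i (ltnW ni : (i < n.+1)%N)).
  have iN : i != n by rewrite ltn_eqF.
  rewrite !gcoef_low ?gpd_coef// => k ks; rewrite gpd_coef ?lowa ?lowb//; exact: raddf0.
exists l; apply/eqP; rewrite -subr_eq0; apply/eqP; apply: (germ_mulf_eq0 (a := gi (gcoef b s))).
  rewrite mulrBr ab {1}hl (rmorphM (@gi R n)) (gcst_S n l); ring.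
by apply: contra bs => /eqP h0; apply/eqP/(@gi_inj R n); rewrite h0 raddf0.
Qed.

End ChainRule.

(** * Functions with vanishing tangential derivatives *)

Section PrimeQuotient.
Variables (A : comNzRingType) (P : set A).
Hypothesis P0 : P 0.
Hypothesis P1 : ~ P 1.
Hypothesis PD : forall a u v, P u -> P v -> P (a * u + v).
Hypothesis PM : forall u v, P (u * v) -> P u \/ P v.

Definition primeb : {pred A} := fun a => `[< P a >].

Lemma primeb_idealr : idealr_closed primeb.
Proof.
split; rewrite ?unfold_in; [exact/asboolP|exact/asboolP|].
by move=> a u v; rewrite !unfold_in => /asboolP hu /asboolP hv; apply/asboolP/PD.
Qed.
HB.instance Definition _ := isIdealr.Build A primeb primeb_idealr.

Lemma primeb_prime : prime_idealr_closed primeb.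
Proof.
move=> u v; rewrite !unfold_in => /asboolP/PM[h|h]; apply/orP; [left|right]; exact/asboolP.
Qed.
HB.instance Definition _ := isPrimeIdealrClosed.Build A primeb primeb_prime.

Definition primequot := {ideal_quot primeb}.
HB.instance Definition _ := GRing.ComNzRing.on primequot.

(** Chosen inverses, with [x] itself as default, make the quotient a unit ring, from which the
    fraction field is formed. *)
Definition pq_inv (x : primequot) : primequot := xget x [set y | y * x = 1].
Definition pq_unit : {pred primequot} := fun x => `[< exists y, y * x = 1 >].

Lemma pq_mulVx : {in pq_unit, left_inverse 1 pq_inv *%R}.
Proof.
by move=> x; rewrite unfold_in => /asboolP[y yx]; exact: (@xgetPex _ x [set y | y * x = 1] (ex_intro _ y yx)).
Qed.
Lemma pq_unitPl x y : y * x = 1 -> pq_unit x.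
Proof. by move=> yx; apply/asboolP; exists y. Qed.
Lemma pq_invr_out : {in [predC pq_unit], pq_inv =1 id}.
Proof.
move=> x xN; apply: xgetPN => y yx; move: xN; rewrite inE => /negP; apply.
by rewrite unfold_in; apply/asboolP; exists y.
Qed.
HB.instance Definition _ := GRing.ComNzRing_hasMulInverse.Build primequot
  pq_mulVx pq_unitPl pq_invr_out.

Lemma pq_domain (x y : primequot) : x * y = 0 -> (x == 0) || (y == 0).
Proof. exact: Quotient.rquot_IdomainAxiom. Qed.
HB.instance Definition _ := GRing.ComUnitRing_isIntegral.Build primequot pq_domain.

(** [K] is the residue field of the prime: congruences modulo [P] become equalities in a field. *)
Lemma prime_field : exists (K : fieldType) (f : {rmorphism A -> K}),
  forall a, f a = 0 <-> P a.
Proof.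
pose g : {rmorphism A -> {ideal_quot primeb}} := (\pi_({ideal_quot primeb}))%qT.
exists {fraction primequot}, ((@tofrac primequot : {rmorphism primequot -> _}) \o (g : {rmorphism A -> primequot})) => a.
have gE : (g a == 0) = primeb a.
  have g0 : g 0 = 0 by exact: rmorph0.
  by rewrite -g0 -[primeb a](congr1 primeb (subr0 a)); exact/esym/Quotient.idealrBE.
split=> [/eqP|Pa]; rewrite /= ?tofrac_eq0 ?gE.
  by move/asboolP.
by apply/eqP; rewrite tofrac_eq0 gE; exact/asboolP.
Qed.

End PrimeQuotient.

(** An ideal maximal among those that contain [J] and avoid the powers of [f] is prime: adjoining to
    it any [u] outside reaches some power of [f], and the product of two such powers would lie in
    [P] if [u * v] did. *)
Lemma prime_avoiding (A : comNzRingType) (J : set A) (f : A) :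
  J 0 -> (forall a u v, J u -> J v -> J (a * u + v)) -> (forall k, ~ J (f ^+ k)) ->
  exists P : set A, [/\ J `<=` P, ~ P f,
    P 0 /\ ~ P 1, forall a u v, P u -> P v -> P (a * u + v)
  & forall u v, P (u * v) -> P u \/ P v].
Proof.
move=> J0 JD Jf.
pose good (X : set A) := [/\ J `<=` X, forall a u v, X u -> X v -> X (a * u + v)
  & forall k, ~ X (f ^+ k)].
have [|P [P0 Pmax]] := @Zorn_bigcup A (fun X => X = set0 \/ good X).
  move=> G GP tot; have [[X GX Xgood]|none] := pselect (exists2 X, G X & good X); last first.
    left; rewrite -subset0 => x [X GX Xx].
    case: (GP X GX) => [X0|Xg]; first by rewrite X0 in Xx.
    by exfalso; apply: none; exists X.
  right; split.
  - by case: Xgood => JX _ _ x /JX Xx; exists X.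
  - move=> a u v [Y GY Yu] [Z GZ Zv].
    have good_of W : G W -> (exists w, W w) -> good W.
      by move=> /GP[-> [w []]|].
    have gY := good_of Y GY (ex_intro _ u Yu); have gZ := good_of Z GZ (ex_intro _ v Zv).
    case: (tot _ _ GY GZ) => sub.
      by exists Z => //; case: gZ => _ + _; apply => //; apply: sub.
    by exists Y => //; case: gY => _ + _; apply => //; apply: sub.
  - move=> k [Y GY Yk]; case: (GP Y GY) => [Y0|[_ _ /(_ k)//]].
    by rewrite Y0 in Yk.
have Pgood : good P.
  case: P0 => // P0; exfalso; apply: (Pmax J); last by right; split.
  by rewrite P0; split=> [? []|/(_ 0 J0) []].
case: Pgood => JP PD Pf; have Pz : P 0 by apply: JP.
exists P; split => //; first by move=> Pf1; apply: (Pf 1%N); rewrite expr1.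
  by split=> // P1; apply: (Pf 0%N); rewrite expr0.
have ext u : ~ P u -> exists a v k, P v /\ a * u + v = f ^+ k.
  move=> Pu; apply: contrapT => none.
  pose Q := [set w | exists a v, P v /\ w = a * u + v].
  have PQ : P `<=` Q by move=> w Pw; exists 0, w; rewrite mul0r add0r.
  have Qu : Q u by exists 1, 0; rewrite mul1r addr0.
  apply: (Pmax Q); first by split=> // /(_ u Qu).
  right; split; first by move=> w /JP/PQ.
    move=> a _ _ [b [v [Pv ->]]] [b' [v' [Pv' ->]]].
    exists (a * b + b'), (a * v + v'); split; first exact: PD.
    by rewrite mulrDr mulrDl addrACA mulrA.
  by move=> k [a [v [Pv e]]]; apply: none; exists a, v, k.
move=> u v Puv; apply: contrapT => /not_orP[/ext[a [p [k [Pp e1]]]] /ext[b [q [l [Pq e2]]]]].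
apply: (Pf (k + l)%N); rewrite exprD -e1 -e2.
have -> : (a * u + p) * (b * v + q) = (a * b) * (u * v) + ((b * v + q) * p + ((a * u) * q + 0)) by ring.
by apply: (PD) => //; apply: (PD) => //; apply: (PD).
Qed.

Lemma horner_map_wide (A B : nzRingType) (g : A -> B) n (p : {poly A}) x :
  g 0 = 0 -> (size p <= n)%N -> (map_poly g p).[x] = \sum_(l < n) g p`_l * x ^+ l.
Proof.
move=> g0 pn; rewrite (horner_coef_wide _ (leq_trans (size_poly _ _) pn)).
by apply: eq_bigr => l _; rewrite -(coef_map_id0 p l g0).
Qed.

(** * Integral and algebraic elements over a ring mapped to a field *)

Section Algebraic.
Variables (A : comNzRingType) (K : fieldType) (f : {rmorphism A -> K}).
Local Notation "p ^f" := (map_poly f p).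

(** With [b] the lowest coefficient of an equation of [y] that survives in [K], that equation reads
    [f b = y * y'] with [y'] integral. Hence [x / y = x * y' / f b], and scaling the [l]-th
    coefficient of an equation of [x * y'] by [b ^+ l] gives a relation. *)
Lemma algebraic_quotient x y : y != 0 -> integralOver f x -> integralOver f y ->
  exists Q : {poly A}, Q^f != 0 /\ root Q^f (x / y).
Proof.
move=> y0 ix [p pm py].
have : exists s, p^f`_s != 0.
  by exists (size p).-1; rewrite coef_map /= -/(lead_coef p) (monicP pm) rmorph1 oner_eq0.
case/ex_minnP => s ps mins.
pose q := drop_poly s.+1 p.
have yE : f p`_s = y * - q^f.[y].
  have : p^f = take_poly s.+1 p^f + drop_poly s.+1 p^f * 'X^(s.+1) by rewrite poly_take_drop.
  have -> : take_poly s.+1 p^f = (f p`_s)%:P * 'X^s.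
    apply/polyP => k; rewrite coef_take_poly coefCM coefXn coef_map /=.
    have [->|ksn] := eqVneq k s; first by rewrite ltnSn mulr1.
    rewrite mulr0; case: ifP => // ks; apply/eqP/negPn/negP => h.
    by have := mins k; rewrite coef_map h => /(_ isT); rewrite leqNgt ltn_neqAle ksn -ltnS ks.
  have -> : drop_poly s.+1 p^f = q^f.
    by apply/polyP => k; rewrite coef_drop_poly !coef_map coef_drop_poly.
  move=> /(congr1 (fun r => r.[y])); rewrite (eqP py) !hornerE.
  rewrite exprS mulrA -mulrDl => /esym/eqP; rewrite mulf_eq0 expf_eq0 (negPf y0) andbF orbF.
  by rewrite addr_eq0 => /eqP ->; rewrite mulrN mulrC.
have iy : integralOver f y by exists p.
have iq : integralOver f (- q^f.[y]).
  apply: integral_opp; apply: integral_horner iy => _ /(nthP 0)[k _ <-].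
  by rewrite coef_map; exact: integral_id.
have [r rm rz] := integral_mul ix iq.
pose b := p`_s; have b0 : f b != 0 by move: ps; rewrite coef_map.
exists (\poly_(l < size r) (r`_l * b ^+ l)).
have szr : (0 < size r)%N by rewrite size_poly_gt0 monic_neq0.
split.
  apply/eqP => /(congr1 (fun t : {poly K} => t`_(size r).-1)).
  rewrite coef_map coef_poly prednK// leqnn coef0 /= rmorphM rmorphXn -/(lead_coef r).
  by rewrite (monicP rm) rmorph1 mul1r => /eqP; rewrite expf_eq0 (negPf b0) andbF.
apply/rootP; rewrite (horner_coef_wide _ (leq_trans (size_poly _ _) (size_poly _ _))).
transitivity (r^f.[x * - q^f.[y]]); last exact/rootP.
rewrite (horner_coef_wide _ (size_poly _ _)); apply: eq_bigr => l _.
rewrite !coef_map coef_poly ltn_ord /= rmorphM rmorphXn -mulrA -exprMn.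
by congr (_ * _ ^+ _); rewrite yE mulrC mulrA divfK.
Qed.

(** If the leading coefficient of a shortest relation vanished in [K], dropping it would shorten the
    relation without changing its image. Relations are kept over [A], not over [K], because
    derivations act on [A]. *)
Lemma min_relation y : (exists Q : {poly A}, Q^f != 0 /\ root Q^f y) ->
  exists Q : {poly A}, [/\ f (lead_coef Q) != 0, root Q^f y
    & forall r : {poly A}, root r^f y -> (size r < size Q)%N -> r^f = 0].
Proof.
move=> ex; have : exists k, `[< exists Q : {poly A}, [/\ size Q = k, Q^f != 0 & root Q^f y] >].
  by have [Q [h1 h2]] := ex; exists (size Q); apply/asboolP; exists Q.
case/ex_minnP => k /asboolP[Q [Qk Q0 Qy]] mink.
have minQ (r : {poly A}) : root r^f y -> (size r < size Q)%N -> r^f = 0.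
  move=> ry rQ; apply/eqP/negPn/negP => r0.
  by have := mink (size r); rewrite leqNgt -Qk rQ => /(_ _)/negP; apply => //; apply/asboolP; exists r.
exists Q; split=> //; apply/eqP => lead0.
pose Q' := \poly_(i < (size Q).-1) Q`_i.
have sQ : (0 < size Q)%N by rewrite size_poly_gt0; apply: contra Q0 => /eqP ->; rewrite rmorph0.
have QQ' : Q'^f = Q^f.
  apply/polyP => i; rewrite !coef_map coef_poly; case: ltnP => //= h.
  move: h; rewrite leq_eqVlt => /orP[/eqP <-|h]; first by rewrite -lead_coefE lead0 rmorph0.
  by rewrite [Q`_i]nth_default ?rmorph0// -(prednK sQ).
have /eqP : Q'^f = 0 by apply: minQ; rewrite ?QQ'// (leq_ltn_trans (size_poly _ _))// prednK.
by rewrite QQ' (negPf Q0).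
Qed.

(** Pseudo-division, as the leading coefficient of [Q] need not be invertible in [A]; the remainder
    is too short to be a relation unless its image is 0. *)
Lemma pseudo_division (Q r : {poly A}) y : f (lead_coef Q) != 0 -> root Q^f y ->
  (forall r : {poly A}, root r^f y -> (size r < size Q)%N -> r^f = 0) ->
  root r^f y -> exists c q s, [/\ f c != 0, c *: r = q * Q + s & s^f = 0].
Proof.
move=> Q0 Qy minQ ry; pose s := Pdiv.Ring.rmodp r Q; pose q := Pdiv.Ring.rdivp r Q.
have e := Pdiv.ComRing.rdivp_eq Q r.
exists (lead_coef Q ^+ Pdiv.Ring.rscalp r Q), q, s; split=> //.
  by rewrite rmorphXn expf_neq0.
apply: minQ; last first.
  by apply: Pdiv.Ring.ltn_rmodpN0; apply: contra Q0 => /eqP ->; rewrite lead_coef0 rmorph0.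
apply/rootP; have := congr1 (fun t => (map_poly f t).[y]) e.
rewrite /= map_polyZ rmorphD rmorphM !hornerE (eqP ry) (eqP Qy) !mulr0 add0r.
by move=> <-.
Qed.

End Algebraic.

(** The factor [e] allows for a derivation [d] that extends [d'] only after a denominator has been
    cleared. *)
Lemma derivation_horner (A B : comNzRingType) (i : {rmorphism A -> B}) (d' : {additive A -> A})
    (d : B -> B) (e x : B) :
  zmod_morphism d -> (forall u v, d (u * v) = d u * v + u * d v) ->
  (forall a, d (i a) = e * i (d' a)) ->
  forall p, d (map_poly i p).[x] =
    e * (map_poly i (map_poly d' p)).[x] + (map_poly i p^`()).[x] * d x.
Proof.
move=> dB dM di; have d0 : d 0 = 0 by have := dB 0 0; rewrite !subrr.
have dD u v : d (u + v) = d u + d v.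
  by rewrite -[v in LHS]opprK dB -[- v]sub0r dB d0 sub0r opprK.
apply: poly_ind => [|p c IH].
  by rewrite deriv0 !map_poly0 ?raddf0// !horner0 d0 mulr0 mul0r addr0.
have -> : map_poly d' (p * 'X + c%:P) = map_poly d' p * 'X + (d' c)%:P.
  apply/polyP => k; rewrite coefD coef_map_id0 ?raddf0// !coefMX !coefD !coefMX !coefC.
  by case: k => [|k] /=; rewrite ?coef_map_id0 ?raddf0// ?addr0 ?add0r.
rewrite derivD derivM derivX derivC mulr1 addr0 !rmorphD !rmorphM /= !map_polyX !map_polyC /=.
by rewrite !hornerE dD dM IH di; ring.
Qed.

(** * Vector fields tangent to a subvariety *)

Section Tangent.
Variable R : realType.
Local Notation C := R[i].
Local Notation F := (F R).
Local Notation germ := (germ R).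
Implicit Types n k : nat.

Definition vf n (c : nat -> germ n) (s : germ n) := \sum_(j < n) c j * gpd j s.

Lemma vf_zmod n c : zmod_morphism (@vf n c).
Proof.
by move=> a b; rewrite /vf -sumrB; apply: eq_bigr => j _; rewrite raddfB mulrBr.
Qed.
HB.instance Definition _ n c := GRing.isZmodMorphism.Build (germ n) (germ n) (@vf n c) (@vf_zmod n c).

Lemma vfM n c (a b : germ n) : vf c (a * b) = vf c a * b + a * vf c b.
Proof.
rewrite /vf mulr_suml mulr_sumr -big_split; apply: eq_bigr => j _ /=.
by rewrite gpdM mulrDr mulrA [c j * (a * _)]mulrCA.
Qed.

Definition tangent n (K : fieldType) (f : germ n -> K) (c : nat -> germ n) :=
  forall p, f p = 0 -> f (vf c p) = 0.

(* On the subvariety defined by the kernel of [f], a meromorphic function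
   killed by all tangent vector fields is constant. *)
Definition constancy n := forall (K : fieldType) (f : {rmorphism germ n -> K}) (a b : germ n),
  f b != 0 -> (forall c, tangent f c -> f (b * vf c a) = f (a * vf c b)) ->
  exists l : C, f a = f (gcst n l) * f b.

Lemma gcoef_poly n (p : {poly germ n}) k : gcoef (map_poly (@gi R n) p).[gX R n] k = p`_k.
Proof.
elim/poly_ind: p k => [|p c IH] k.
  by rewrite map_poly0 ?raddf0// horner0 coef0; exact: gval_inj.
rewrite rmorphD rmorphM /= map_polyX map_polyC /= !hornerE coefD coefMX coefC.
have -> (x y : germ n.+1) : gcoef (x + y) k = gcoef x k + gcoef y k.
  by rewrite -[y in LHS]opprK gcoefB -[- y]sub0r gcoefB [gcoef 0 k](_ : _ = 0) ?sub0r ?opprK//; exact: gval_inj.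
have -> : gcoef (gi c) k = if k == 0 then c else 0.
  by case: k => [|k]; exact: gval_inj.
congr (_ + _); rewrite mulrC gcoef_gXM; case: k => [|k] //=.
Qed.

(** * Constancy when the kernel contains a germ regular in the last variable *)

Section Regular.
Variables (n : nat) (K : fieldType) (f : {rmorphism germ n.+1 -> K}).
Variables (d : nat) (w : germ n.+1).
Hypothesis cn : constancy n.
Hypothesis fw : f w = 0.
Hypothesis wlow : forall k, (k < d)%N -> gc0 (gcoef w k) = 0.
Hypothesis wd : gc0 (gcoef w d) != 0.

Let f' : {rmorphism germ n -> K} := f \o @gi R n.
Local Notation ev p := (map_poly (@gi R n) p).[gX R n].
Let X := f (gX R n).

Let f_ev p : f (ev p) = (map_poly f' p).[X].
Proof. by rewrite -horner_map -map_poly_comp. Qed.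

(** Weierstrass preparation: dividing the [d]-th power of the last variable by [w] gives a monic [W]
    whose value is a multiple of [w], hence in the kernel. That value is again regular of order [d],
    so one can divide by it. *)
Let weierstrass_poly : exists W : {poly germ n}, [/\ root (map_poly f' W) X, W \is monic
  & forall g, exists q (p : {poly germ n}), (size p <= d)%N /\ g = q * ev W + ev p].
Proof.
have [q [p [sp e]]] := gweierstrass (gX R n ^+ d) wlow wd.
pose W := 'X^d - p.
have WE : ev W = q * w.
  by rewrite rmorphB rmorphXn /= map_polyX !hornerE e addrK.
have sW : size W = d.+1 by rewrite size_polyDl ?size_polyXn// size_polyN.
have Wd : W`_d = 1 by rewrite coefB coefXn eqxx [p`_d]nth_default ?subr0.
exists W; split.
- by apply/rootP; rewrite -f_ev WE rmorphM fw mulr0.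
- by apply/monicP; rewrite lead_coefE sW.
- move=> g; apply: (gweierstrass (d := d) (w := ev W)) => [k kd|].
    rewrite WE gcoefM raddf_sum big1// => j _ /=.
    rewrite rmorphM /= (wlow (k := k - j)) ?mulr0//.
    by rewrite (leq_ltn_trans (leq_subr _ _)).
  by rewrite gcoef_poly Wd rmorph1 oner_eq0.
Qed.

(** Modulo the kernel, [s] is its Weierstrass remainder, a polynomial in [X], and [X] is integral
    through [W]. *)
Let integral_germ s : integralOver f' (f s).
Proof.
have [W [WX Wm Wdiv]] := weierstrass_poly.
have iX : integralOver f' X by exists W.
have [q [p [_ ->]]] := Wdiv s.
rewrite rmorphD rmorphM !f_ev (eqP WX) mulr0 add0r.
apply: integral_horner iX => _ /(nthP 0)[k _ <-].
by rewrite coef_map; exact: integral_id.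
Qed.

Lemma f'_natr k : (0 < k)%N -> (k%:R : K) != 0.
Proof.
move=> k0; rewrite -(rmorph_nat f) -(rmorph_nat (gcst n.+1)).
have : f (gcst n.+1 k%:R) * f (gcst n.+1 k%:R^-1) = 1.
  by rewrite -rmorphM -rmorphM mulfV ?rmorph1// pnatr_eq0 -lt0n.
by move=> h; apply/eqP => h0; move/eqP: h; rewrite h0 mul0r eq_sym oner_eq0.
Qed.

Section Extension.
Variables (c : nat -> germ n) (Q : {poly germ n}).
Hypothesis Qlead : f' (lead_coef Q) != 0.
Hypothesis QX : root (map_poly f' Q) X.
Hypothesis Qmin : forall r : {poly germ n},
  root (map_poly f' r) X -> (size r < size Q)%N -> map_poly f' r = 0.
Hypothesis tc : tangent f' c.

Let e := ev Q^`().
(* The lift of [c] to [n.+1] variables, scaled by Q'(X), that kills Q(X). *)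
Definition lift_vf j := if j == n then - ev (map_poly (vf c) Q) else e * gi (c j).

Lemma lift_vf_gi a : vf lift_vf (gi a) = e * gi (vf c a).
Proof.
rewrite /vf big_ord_recr /= gpd_gi_last mulr0 addr0 raddf_sum mulr_sumr.
apply: eq_bigr => j _; rewrite /lift_vf ltn_eqF// gpd_gi// -mulrA.
by rewrite -rmorphM.
Qed.

Lemma lift_vf_gX : vf lift_vf (gX R n) = - ev (map_poly (vf c) Q).
Proof.
rewrite /vf big_ord_recr /= gpd_gX_last mulr1 /lift_vf eqxx big1 ?add0r// => j _.
by rewrite gpd_gX// mulr0.
Qed.

Lemma lift_vf_ev p : vf lift_vf (ev p) =
  e * ev (map_poly (vf c) p) - ev p^`() * ev (map_poly (vf c) Q).
Proof.
have := @derivation_horner _ _ (@gi R n) (vf c) (vf lift_vf) e (gX R n).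
move=> ->; first by rewrite lift_vf_gX mulrN.
- exact: vf_zmod.
- exact: vfM.
- exact: lift_vf_gi.
Qed.

(** By pseudo-division a multiple of [r] is a multiple of [Q] plus a polynomial [s] with zero image.
    The lift kills the value of [Q] and, since [c] is tangent, keeps that of [s] in the kernel. *)
Lemma lift_vf_root r : root (map_poly f' r) X -> f (vf lift_vf (ev r)) = 0.
Proof.
move=> rX; have [a [q [s [a0 e1 s0]]]] := pseudo_division Qlead QX Qmin rX.
have := congr1 (fun t => f (vf lift_vf (ev t))) e1.
rewrite -mul_polyC !rmorphD !rmorphM /= map_polyC /= !hornerE.
rewrite raddfD /= !vfM lift_vf_gi !rmorphD !rmorphM /= !f_ev (eqP rX) (eqP QX) !mulr0 add0r add0r.
rewrite (lift_vf_ev Q) subrr rmorph0 mulr0 add0r.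
rewrite (lift_vf_ev s) rmorphB !rmorphM !f_ev.
have -> : map_poly f' (map_poly (vf c) s) = 0.
  apply/polyP => k; rewrite coef_map coef_map_id0 ?raddf0// coef0.
  by apply: tc; rewrite -[LHS](coef_map f') s0 coef0.
rewrite -(deriv_map f' s) s0 deriv0 !horner0 mulr0 mul0r subrr mulrC.
by move/eqP; rewrite mulf_eq0 (negPf (a0 : f (gi a) != 0)) orbF => /eqP.
Qed.

(** A germ in the kernel is a combination of the values of [W] and of a remainder [r], and both
    polynomials are relations of [X]. *)
Lemma lift_tangent : tangent f lift_vf.
Proof.
move=> p fp; have [W [WX Wm Wdiv]] := weierstrass_poly.
have [q [r [_ pE]]] := Wdiv p.
have rX : root (map_poly f' r) X.
  apply/rootP; rewrite -f_ev; move: fp; rewrite pE rmorphD rmorphM f_ev (eqP WX).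
  by rewrite mulr0 add0r.
rewrite pE raddfD /= vfM !rmorphD !rmorphM /= f_ev (eqP WX) mulr0 add0r.
by rewrite !lift_vf_root// mulr0 addr0.
Qed.

(** Separability: the derivative of [Q] is shorter than the minimal relation, and its leading
    coefficient survives in characteristic 0. *)
Lemma f_lift_neq0 : f e != 0.
Proof.
have sQ : (1 < size Q)%N.
  rewrite ltnNge; apply/negP => /size1_polyC Qc.
  move: QX Qlead; rewrite Qc lead_coefC map_polyC /= => /rootP; rewrite hornerC => ->.
  by rewrite eqxx.
rewrite /e f_ev; apply/eqP => h.
have : map_poly f' Q^`() = 0.
  by apply: Qmin; [exact/rootP|apply: lt_size_deriv; rewrite -size_poly_gt0 ltnW].
move/(congr1 (fun t : {poly K} => t`_(size Q).-2)); rewrite coef_map coef_deriv coef0.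
have -> : (size Q).-2.+1 = (size Q).-1 by case: (size Q) sQ => [|[]].
rewrite -lead_coefE raddfMn /= -mulr_natr => /eqP; rewrite mulf_eq0 (negPf Qlead) /=.
by apply/negP; apply: f'_natr; case: (size Q) sQ => [|[]].
Qed.

End Extension.

(** Let [Q] be a minimal relation of [y = f a / f b] over the germs in [n] variables. Lifted tangent
    fields kill [y], so applying a tangent field to the coefficients of [Q] gives another relation
    of [y], proportional to [Q] by minimality. The ratios of the coefficients to the leading one are
    thus killed by all tangent fields and are constant by induction: [y] is a root of a complex
    polynomial, which splits. *)
Lemma constancy_regular (a b : germ n.+1) : f b != 0 ->
  (forall c, tangent f c -> f (b * vf c a) = f (a * vf c b)) ->
  exists l : C, f a = f (gcst n.+1 l) * f b.
Proof.
move=> fb hc.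
have [QX [QXlead QXroot QXmin]] : exists Q : {poly germ n}, [/\ f' (lead_coef Q) != 0,
    root (map_poly f' Q) X
  & forall r : {poly germ n}, root (map_poly f' r) X -> (size r < size Q)%N -> map_poly f' r = 0].
  apply: min_relation; have [W [WX Wm _]] := weierstrass_poly; exists W; split=> //.
  apply/eqP => /(congr1 (fun t : {poly K} => t`_(size W).-1)).
  rewrite coef_map coef0 -/(lead_coef W) (monicP Wm) => /eqP.
  by move=> /eqP/(etrans (esym (rmorph1 f')))/eqP; rewrite oner_eq0.
pose y := f a / f b; have ya : f a = y * f b by rewrite /y divfK.
have [Q [Qlead Qroot Qmin]] := min_relation (algebraic_quotient fb (integral_germ a) (integral_germ b)).
rewrite -/y in Qroot Qmin.
pose N := (size Q).-1.
have sQ : size Q = N.+1.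
  rewrite prednK// size_poly_gt0; apply: contra Qlead => /eqP ->.
  by rewrite lead_coef0 rmorph0.
have Qder c : tangent f' c -> root (map_poly f' (map_poly (vf c) Q)) y.
  move=> tc; pose g := lift_vf c QX; pose e := ev QX^`().
  have tg : tangent f g := lift_tangent QXlead QXroot QXmin tc.
  have e0 : f e != 0 := f_lift_neq0 QXlead QXroot QXmin.
  pose D s := f (vf g s).
  have DM s t : D (s * t) = D s * f t + f s * D t by rewrite /D vfM rmorphD !rmorphM.
  have Dab : D a = y * D b.
    have := hc g tg; rewrite !rmorphM ya -/(D a) -/(D b) [y * _]mulrC -mulrA.
    by move/(mulfI fb).
  (* [y] need not be the image of a germ, so the relation is differentiated in homogeneous form:
     [good s l k] says that [s] behaves like [y ^+ l * b ^+ k] with [y] constant. *)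
  pose good s l k := f s = y ^+ l * f b ^+ k /\ D s * f b = (y ^+ l * f b ^+ k * D b) *+ k.
  have goodM s t l k l' k' : good s l k -> good t l' k' -> good (s * t) (l + l')%N (k + k')%N.
    move=> [s1 s2] [t1 t2]; split; first by rewrite rmorphM s1 t1 !exprD; ring.
    have -> : D (s * t) * f b = (D s * f b) * f t + f s * (D t * f b) by rewrite DM; ring.
    rewrite s2 t2 s1 t1 !exprD mulrnDr.
    move: (f b ^+ k) (f b ^+ k') (y ^+ l) (y ^+ l') (D b) => u u' v v' x.
    rewrite mulrnAl mulrnAr; congr (_ *+ _ + _ *+ _); ring.
  have good1 : good 1 0%N 0%N.
    split; first by rewrite rmorph1 !expr0 mulr1.
    rewrite mulr0n; have := DM 1 1; rewrite mulr1 rmorph1 mulr1 mul1r => /eqP.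
    by rewrite -subr_eq0 opprD addNKr oppr_eq0 => /eqP ->; rewrite mul0r.
  have gooda l : good (a ^+ l) l l.
    elim: l => [|l IH]; first by rewrite expr0.
    have /goodM/(_ IH) : good a 1%N 1%N by split; rewrite ?expr1// Dab mulr1n; ring.
    by rewrite -exprS !add1n.
  have goodb l : good (b ^+ l) 0%N l.
    elim: l => [|l IH]; first by rewrite expr0.
    have /goodM/(_ IH) : good b 0%N 1%N by split; rewrite ?expr1 ?expr0 ?mul1r// mulr1n mulrC.
    by rewrite -exprS add0n add1n.
  pose m l := a ^+ l * b ^+ (N - l).
  have goodm l : (l <= N)%N -> good (m l) l N.
    by move=> lN; have := goodM _ _ _ _ _ _ (gooda l) (goodb (N - l)%N); rewrite addn0 subnKC.
  (* [Q] at [y], multiplied by [b ^+ N]: a true germ in the kernel, to which the lifted field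
     applies. *)
  pose H := \sum_(l < N.+1) gi Q`_l * m l.
  have Dgi u : D (gi u) = f e * f' (vf c u).
    by rewrite /D lift_vf_gi (rmorphM f).
  have aux (E V z B' B q x : K) k : E * V * (z * B') * B + q * ((z * B' * x) *+ k) =
    E * (B' * B) * (V * z) + q * z * ((B' * x) *+ k).
    by rewrite -(mulr_natr (z * B' * x)) -(mulr_natr (B' * x)); ring.
  have QyE : \sum_(l < N.+1) f' Q`_l * y ^+ l = 0.
    by rewrite -[RHS](eqP Qroot) (@horner_map_wide _ _ _ N.+1) ?rmorph0 ?sQ.
  have fH : f H = 0.
    rewrite /H rmorph_sum /=; transitivity ((\sum_(l < N.+1) f' Q`_l * y ^+ l) * f b ^+ N).
      rewrite mulr_suml; apply: eq_bigr => l _; have [m1 _] := goodm l (ltn_ord l).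
      by rewrite (rmorphM f) m1 mulrA.
    by rewrite QyE mul0r.
  have : D H * f b = 0 by rewrite /D tg// mul0r.
  have -> : D H = \sum_(l < N.+1) D (gi Q`_l * m l).
    by rewrite /D /H (raddf_sum (@vf n.+1 g)) (raddf_sum f).
  rewrite mulr_suml.
  have -> : \sum_(l < N.+1) D (gi Q`_l * m l) * f b =
     f e * f b ^+ N.+1 * (\sum_(l < N.+1) f' (vf c Q`_l) * y ^+ l) +
     (\sum_(l < N.+1) f' Q`_l * y ^+ l) * (f b ^+ N * D b *+ N).
    rewrite mulr_sumr mulr_suml -big_split; apply: eq_bigr => l _ /=.
    have [m1 m2] := goodm l (ltn_ord l).
    rewrite DM mulrDl -(mulrA (f (gi Q`_l)) (D (m l)) (f b)) m2 m1 Dgi exprSr.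
    rewrite -/(f' Q`_l); exact: aux.
  rewrite QyE mul0r addr0 => /eqP; rewrite !mulf_eq0 (negPf e0) expf_eq0 (negPf fb) andbF /=.
  move=> /eqP h; apply/rootP.
  rewrite (@horner_map_wide _ _ _ N.+1) ?rmorph0//; last first.
    by rewrite -sQ; exact: size_poly.
  by rewrite -[RHS]h; apply: eq_bigr => l _; rewrite coef_map_id0 ?raddf0.
(* The leading terms of [r] cancel, so [r] is a relation shorter than [Q] and its image is 0. *)
have lam l : exists z : C, f' Q`_l = f' (gcst n z) * f' (lead_coef Q).
  apply: cn Qlead _ => c tc; pose r := lead_coef Q *: map_poly (vf c) Q - vf c (lead_coef Q) *: Q.
  have : map_poly f' r = 0.
    apply: Qmin.
      apply/rootP; rewrite rmorphB /= !map_polyZ /= !hornerE (eqP (Qder c tc)) (eqP Qroot).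
      by rewrite !mulr0 subrr.
    rewrite sQ ltnS; apply/leq_sizeP => j; rewrite leq_eqVlt => /orP[/eqP <-|Nj].
      by rewrite coefB !coefZ coef_map_id0 ?raddf0// -lead_coefE mulrC subrr.
    by rewrite coefB !coefZ coef_map_id0 ?raddf0// [Q`_j]nth_default ?raddf0 ?mulr0 ?subrr// sQ.
  have rl : r`_l = lead_coef Q * vf c Q`_l - vf c (lead_coef Q) * Q`_l.
    by rewrite coefB !coefZ coef_map_id0 ?raddf0.
  move=> /(congr1 (fun t : {poly K} => t`_l)); rewrite (coef_map f') coef0 rl.
  move=> /(etrans (esym (rmorphB f' _ _)))/eqP; rewrite subr_eq0 => /eqP ->.
  by rewrite mulrC.
have {lam}/choice[z hz] := lam.
(* [Q] divided by its leading coefficient, with coefficients now constant. *)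
pose L : {poly C} := \poly_(l < N.+1) z l.
pose fc : {rmorphism C -> K} := f \o gcst n.+1.
have fcE t : f' (gcst n t) = fc t by rewrite /fc /= gcst_S.
have LN : L != 0.
  apply/eqP => /(congr1 (fun t : {poly C} => t`_N)); rewrite coef_poly ltnSn coef0 => zN.
  by have := hz N; rewrite zN !rmorph0 mul0r -lead_coefE => /eqP; rewrite (negPf Qlead).
have Ly : root (map_poly fc L) y.
  apply/rootP; rewrite (@horner_map_wide _ _ _ N.+1) ?rmorph0 ?size_poly//.
  apply: (mulIf Qlead); rewrite mul0r -[RHS](eqP Qroot) (@horner_map_wide _ _ _ N.+1) ?rmorph0 ?sQ//.
  rewrite mulr_suml; apply: eq_bigr => l _.
  by rewrite coef_poly ltn_ord -fcE (hz l) mulrAC.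
have [s Ls] := closed_field_poly_normal L.
move: Ly; rewrite Ls map_polyZ rootZ ?fmorph_eq0 ?lead_coef_eq0// rmorph_prod.
have -> : \prod_(i <- s) map_poly fc ('X - i%:P) = \prod_(x <- map fc s) ('X - x%:P).
  by rewrite big_map; apply: eq_bigr => t _; rewrite rmorphB /= map_polyX map_polyC.
rewrite root_prod_XsubC => /mapP[t _ yt].
by exists t; rewrite ya yt.
Qed.

End Regular.

End Tangent.

(** * Constancy for an arbitrary prime *)

Section Constancy.
Variable R : realType.
Local Notation C := R[i].
Local Notation F := (F R).
Local Notation germ := (germ R).
Implicit Types n k : nat.

(** As for derivations, Hadamard's decomposition raises the order of vanishing of [s x - t x]
    indefinitely. *)
Lemma rmorph_germ_uniq n k (s t : {rmorphism germ n -> germ k}) :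
  (forall i, (i < n)%N -> gc0 (s (gvar R n i)) = 0) ->
  (forall c, s (gcst n c) = t (gcst n c)) ->
  (forall i, (i < n)%N -> s (gvar R n i) = t (gvar R n i)) -> s =1 t.
Proof.
move=> s0 sc sv x; apply/eqP; rewrite -subr_eq0; apply/eqP.
apply: gval_inj; rewrite gval0; apply: vord_all => m.
elim: m x => [|m IH] x; first exact: vord0.
have [q ->] := gdecomp x; rewrite (rmorphD s) (rmorphD t) sc opprD addrACA subrr add0r.
rewrite (rmorph_sum s) (rmorph_sum t) -sumrB gval_sum.
elim/big_ind: _ => [|a b|i _]; [exact: vordz|exact: vordD|].
rewrite (rmorphM s) (rmorphM t) -sv// -mulrBr gvalM -add1n; apply: vordM; last exact: IH.
by apply: vord1; exact: s0.
Qed.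

(** On the line from 0 through a point [v] where [w] is nonzero, [w] becomes a series in one
    variable. It does not vanish identically, because of its value at [v], so it is nonzero
    arbitrarily close to 0. *)
Lemma nonzero_on_line n (w : germ n.+1) : w != 0 -> exists l : nat -> C,
  forall e, 0 < e -> exists2 t, nc t <= e & gev (fun i => if i == n then t else l i * t) w != 0.
Proof.
move=> w0; have [e0 e00 [M hM]] := gsumm w.
(* Multiplying by the last variable gives [v] a nonzero last entry, which then serves as the
   parameter of the line. *)
have Xw0 : gX R n * w != 0.
  apply/eqP => /germ_domain[X0|wz]; last by rewrite wz eqxx in w0.
  have := gev_gX n (fun=> (1 : C)); rewrite X0 gev0 => /esym/eqP.
  by rewrite oner_eq0.
have [e1 e10 h1] := nz_gevM (gX R n) w.
have [v vs] := gidentity Xw0 (e := Num.min e0 e1) ltac:(by rewrite lt_min e00).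
have ve0 i : nc (v i) <= e0 by rewrite (le_trans (vs i))// ge_min lexx.
rewrite h1 => [|i]; last by rewrite (le_trans (vs i))// ge_min lexx orbT.
rewrite gev_gX mulf_eq0 => /norP[vn wv].
pose l i := v i / v n; exists l => e ep.
pose g i : F 1 := if i == n then psX (F 0) else fcst 1 (l i) * psX (F 0).
pose sg := fun _ : nat => nc (v n).
have sg0 i : 0 < sg i by rewrite nc_gt0.
have r0 : forall i : nat, 0 < (fun _ : nat => e0) i by [].
have hg i : bnd sg e0 (g i).
  rewrite /g; case: eqP => _; first by apply: bnd_le (bnd_psX sg0 0); exact: ve0.
  apply: bnd_le (bndM sg0 (bnd_fcst 1 (l i) sg0) (bnd_psX sg0 0)).
  by rewrite /sg -ncM divfK.
have [c hc hcw] := comp_ex r0 sg0 hM hg.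
have evg u i : (forall i, nc (u i) <= sg i) -> ev u (g i) = if i == n then u 0%N else l i * u 0%N.
  move=> us; rewrite /g; case: eqP => _; first exact: (ev_psX sg0 us).
  by rewrite (evM sg0 us (bnd_fcst 1 (l i) sg0) (bnd_psX sg0 0)) ev_fcst (ev_psX sg0 us).
have c0 : c != 0.
  apply/eqP => cz; have vsg : forall i : nat, nc ((fun=> v n) i) <= sg i by move=> i; exact: lexx.
  have := hcw (fun=> v n) vsg; rewrite cz (ev0 sg0 vsg) => /esym/eqP; apply/negP.
  suff -> : (fun i => ev (fun=> v n) (g i)) = v by [].
  by apply/funext => i; rewrite evg//; case: eqP => [->//|_]; rewrite divfK.
have [u us cu] := identity (bnd_summ sg0 hc) c0 (e := Num.min e (nc (v n))) ltac:(by rewrite lt_min ep nc_gt0).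
have usg i : nc (u i) <= sg i by rewrite (le_trans (us i))// ge_min lexx orbT.
exists (u 0%N); first by rewrite (le_trans (us _))// ge_min lexx.
have ugE : (fun i => ev u (g i)) = (fun i => if i == n then u 0%N else l i * u 0%N).
  by apply/funext => i; rewrite evg.
by rewrite /gev -ugE -hcw.
Qed.

Lemma gev_axis n (s : germ n.+1) : (forall k, gc0 (gcoef s k) = 0) ->
  nz (fun u => (forall i, (i < n)%N -> u i = 0) -> gev u s = 0).
Proof.
move=> sk; have [e e0 [M h]] := gsumm s; exists e => // v ve v0.
apply: clim_uniq (ev_iter (fun=> e0) ve h) _.
apply: clim_near (clim_cst _); exists 0%N => N _; rewrite big1// => k _.
have -> : ev v (psc (gval s) k) = gev (fun=> 0) (gcoef s k) by exact: ev_ext.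
by rewrite gev_at0 sk mul0r.
Qed.

Section Shear.
Variables (n : nat) (l : nat -> C).
Let m i := if i == n then 0 else l i.
Let g (b : bool) i : germ n.+1 :=
  gvar R n.+1 i + gcst n.+1 (if b then m i else - m i) * gX R n.

Let g0 b i : gc0 (g b i) = 0.
Proof. by rewrite rmorphD rmorphM /= gc0_gvar gc0_gX mulr0 addr0. Qed.

(** A linear shear that carries the last axis to the line of direction [l], and the shear of
    opposite sign. As [m n = 0], the last variable is fixed. *)
Lemma shear_ex : exists sg tau : {rmorphism germ n.+1 -> germ n.+1},
  [/\ forall s, nz (fun w => gev w (sg s) = gev (fun i => w i + m i * w n) s),
      forall c, sg (gcst n.+1 c) = gcst n.+1 c,
      forall i, (i < n.+1)%N -> gc0 (sg (gvar R n.+1 i)) = 0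
    & cancel sg tau].
Proof.
have [sg [sg1 sg2 sg3]] := subst_germ (n := n.+1) (fun i _ => g0 true i).
have [tau [tau1 tau2 tau3]] := subst_germ (n := n.+1) (fun i _ => g0 false i).
exists sg, tau; split=> [s|c|i ni|].
- have h i : (i < n.+1)%N -> nz (fun w => gev w (g true i) = w i + m i * w n).
    move=> ni; move: (nz_gevD (gvar R n.+1 i) (gcst n.+1 (m i) * gX R n)).
    move=> /nzI/(_ (nz_gevM (gcst n.+1 (m i)) (gX R n)))/nzI/(_ (gev_gvar R ni)).
    by apply: nz1 => v [[h1 h2] h3]; rewrite h1 h2 h3 gev_cst gev_gX.
  have := nzI (sg1 s) (nz_all h); apply: nz1 => v [-> hv].
  by apply: gev_ext => i ni; rewrite hv.
- exact: sg2.
- by rewrite sg3.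
- pose st : {rmorphism germ n.+1 -> germ n.+1} := tau \o sg.
  have stE x : st x = tau (sg x) by [].
  have XE : gX R n = gvar R n.+1 n by rewrite /= eqxx.
  have tX : tau (gX R n) = gX R n.
    by rewrite {1}XE tau3// /g /m eqxx oppr0 raddf0 mul0r addr0 -XE.
  have stv i : (i < n.+1)%N -> st (gvar R n.+1 i) = gvar R n.+1 i.
    move=> ni; rewrite stE sg3// /g (rmorphD tau) (rmorphM tau) tau2 tX tau3//.
    by rewrite /g (raddfN (gcst n.+1)) mulNr addrNK.
  apply: (rmorph_germ_uniq (s := st) (t := idfun)) => [i ni|c|i ni].
  + by rewrite stv// gc0_gvar.
  + by rewrite stE sg2 tau2.
  + exact: stv.
Qed.

End Shear.

(** If the kernel is zero, every vector field is tangent and the coordinate fields suffice.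
    Otherwise a shear makes some nonzero [w] in the kernel regular in the last variable, and the
    regular case applies after transport. *)
Lemma constancy_all n : constancy R n.
Proof.
elim: n => [|n IH] K f a b fb hc.
  exists ((gval a : C) / gval b).
  have b0 : (gval b : C) != 0.
    apply/eqP => b0; move/eqP: fb; apply.
    by rewrite (_ : b = 0) ?rmorph0//; apply: gval_inj; rewrite b0 gval0.
  rewrite -rmorphM; congr (f _); apply: gval_inj; rewrite gvalM.
  exact/esym/(@divfK C).
have [ker|/existsNP[w /not_implyP[fw /eqP w0]]] := pselect (forall w, f w = 0 -> w = 0).
  have b0 : b != 0 by apply: contra fb => /eqP ->; rewrite rmorph0.
  have [i ni|l ->] := @quotient_cst R n.+1 a b b0; last by exists l; rewrite rmorphM.
  pose c (j : nat) : germ n.+1 := (j == i)%:R.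
  have vfc s : vf c s = gpd i s.
    rewrite /vf (bigD1 (Ordinal ni))//= /c eqxx mul1r big1 ?addr0// => j ji.
    by rewrite -val_eqE /= in ji *; rewrite (negPf ji) mul0r.
  have := hc c; rewrite !vfc => h; apply/eqP; rewrite -subr_eq0; apply/eqP; apply: (ker).
  rewrite (rmorphB f) h ?subrr// => p /ker ->.
  by rewrite raddf0 rmorph0.
have [l hl] := nonzero_on_line w0.
have [sg [tau [sgev sgc sgv sgK]]] := shear_ex n l.
pose f2 : {rmorphism germ n.+1 -> K} := f \o tau.
have f2d s : f2 s = f (tau s) by [].
have f2E s : f2 (sg s) = f s by rewrite f2d sgK.
have [d [dlow dN]] : exists d, (forall k, (k < d)%N -> gc0 (gcoef (sg w) k) = 0) /\
    gc0 (gcoef (sg w) d) != 0.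
  have : exists k, gc0 (gcoef (sg w) k) != 0.
    apply: contrapT => none.
    have none' k : gc0 (gcoef (sg w) k) = 0.
      by apply/eqP/negPn/negP => h; apply: none; exists k.
    have [e e0 he] := nzI (gev_axis none') (sgev w).
    have [t te] := hl e e0; apply/negP; rewrite negbK.
    pose u i := if i == n then t else 0.
    have [|h1 h2] := he u; first by move=> i; rewrite /u; case: eqP => // _; rewrite nc0 ltW.
    apply/eqP; rewrite -[RHS]h1 ?h2 => [|i ni]; last by rewrite /u ltn_eqF.
    apply: gev_ext => i _; rewrite /u eqxx; case: eqP => _; first by rewrite mul0r addr0.
    by rewrite add0r.
  case/ex_minnP => d dN mind; exists d; split=> // k kd; apply/eqP/negPn/negP => /mind.
  by rewrite leqNgt kd.
have [|||l' hl'] := @constancy_regular R n K f2 d (sg w) IH _ dlow dN (sg a) (sg b).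
- by rewrite f2E.
- by rewrite f2E.
- move=> c tc.
  (* The field [c] transported back through the shear, by the chain rule. *)
  pose c' i := tau (\sum_(j < n.+1) c j * gpd j (sg (gvar R n.+1 i))).
  have vfc s : tau (vf c (sg s)) = vf c' s.
    rewrite /vf; transitivity (tau (\sum_(i < n.+1)
       (\sum_(j < n.+1) c j * gpd j (sg (gvar R n.+1 i))) * sg (gpd i s))).
      congr (tau _); under [RHS]eq_bigr do rewrite mulr_suml.
      rewrite exchange_big; apply: eq_bigr => j _ /=.
      by rewrite (chain_rule j s sgv sgc) mulr_sumr; apply: eq_bigr => i _; rewrite mulrA.
    rewrite (rmorph_sum tau); apply: eq_bigr => i _.
    by rewrite (rmorphM tau) sgK.
  have fv s t : f2 (sg s * vf c (sg t)) = f (s * vf c' t).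
    by rewrite f2d (rmorphM tau) sgK vfc.
  rewrite !fv; apply: hc => p fp; rewrite -vfc.
  by apply: (tc (sg p)); rewrite f2E.
- by exists l'; move: hl'; rewrite !f2E => ->; congr (_ * _); rewrite -f2E sgc.
Qed.

(* A germ vanishing at 0 lies in every prime containing its partial derivatives,
   since it is constant along the corresponding subvariety. *)
Lemma power_in_jacobian n (s : germ n) : gc0 s = 0 ->
  exists k (a : nat -> germ n), s ^+ k = \sum_(i < n) a i * gpd i s.
Proof.
move=> s0; pose J := [set x | exists a : nat -> germ n, x = \sum_(i < n) a i * gpd i s].
have J0 : J 0 by exists (fun=> 0); rewrite big1// => i _; rewrite mul0r.
have JD a u v : J u -> J v -> J (a * u + v).
  move=> [b ->] [c ->]; exists (fun i => a * b i + c i); rewrite mulr_sumr -big_split.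
  by apply: eq_bigr => i _ /=; rewrite mulrDl mulrA.
apply: contrapT => none.
have [k [a ka]|P [JP Ps [P0 P1] PD PM]] := prime_avoiding J0 JD (f := s).
  by apply: none; exists k, a.
have [K [f hf]] := prime_field P0 P1 PD PM.
have [||l hl] := @constancy_all n K f s 1.
- by rewrite rmorph1 oner_eq0.
- move=> c _; rewrite mul1r; transitivity (0 : K).
    rewrite /vf (raddf_sum f) big1// => i _; rewrite [LHS](rmorphM f) (_ : f (gpd i s) = 0) ?mulr0//.
    apply/hf/JP; exists (fun j => (j == i :> nat)%:R).
    rewrite (bigD1 i)//= eqxx mul1r big1 ?addr0// => j ji.
    by rewrite -val_eqE /= in ji; rewrite (negPf ji) mul0r.
  have vf1 : vf c 1 = 0.
    by rewrite /vf big1// => i _; rewrite -(rmorph1 (gcst n)) gpd_gcst mulr0.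
  by rewrite vf1 mulr0 rmorph0.
- move: hl; rewrite (rmorph1 f) mulr1 => hl.
  (* Since [s] vanishes at 0, either [l = 0] and [s] lies in [P], or [s - l] is a unit in [P]; both
     are excluded. *)
  have Psl : P (s - gcst n l) by apply/hf; rewrite rmorphB hl subrr.
  have [l0|l0] := eqVneq l 0; first by apply: Ps; move: Psl; rewrite l0 raddf0 subr0.
  have [|t ht] := @gunit R n (s - gcst n l); first by rewrite raddfB /= s0 gc0_cst sub0r oppr_eq0.
  by apply: P1; have := PD t _ _ Psl P0; rewrite addr0 mulrC ht.
Qed.

End Constancy.

(** * Germs of holomorphic functions on a manifold *)

Section Topology.
Variables (K : numFieldType) (n : nat).

Lemma nbhs_rVP (a : 'rV[K]_n) (P : 'rV[K]_n -> Prop) :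
  (\forall v \near a, P v) <->
  exists2 e : K, 0 < e & forall v : 'rV[K]_n, (forall i, `|v 0 i - a 0 i| <= e) -> P v.
Proof.
split=> [/nbhs_ballP[e /= e0 h]|[e e0 h]].
  exists (e / 2); first by rewrite divr_gt0.
  move=> v hv; apply: h; split=> // i j; rewrite -ball_normE /= (ord1 i) distrC.
  by rewrite (le_lt_trans (hv j))// ltr_pdivrMr// ltr_pMr// ltr1n.
apply/nbhs_ballP; exists e => // v [_ hv]; apply: h => i.
by have := hv 0 i; rewrite -ball_normE /= distrC => /ltW.
Qed.

Lemma cvg_seqP (u : nat -> K) (l : K) :
  (u N @[N --> \oo] --> l) <->
  forall e : K, 0 < e -> exists N0, forall N, (N0 <= N)%N -> `|u N - l| <= e.
Proof.
split=> [/cvgrPdist_le h e /h|h].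
  by case=> N0 _ hN; exists N0 => N /hN; rewrite distrC.
apply/cvgrPdist_le => e /h[N0 hN]; exists N0 => // N /hN.
by rewrite distrC.
Qed.

Lemma derive_eps (f : 'rV[K]_n -> K) (a v : 'rV[K]_n) (l : K) :
  (forall e : K, 0 < e -> exists2 d, 0 < d & forall t, t != 0 -> `|t| <= d ->
     `|t^-1 * (f (t *: v + a) - f a) - l| <= e) ->
  'D_v (f : 'rV[K]_n -> K^o) a = l.
Proof.
move=> h; apply: cvg_lim; first exact: norm_hausdorff.
apply/cvgrPdist_le => e /h[d d0 hd].
rewrite near_withinE; apply/nbhs_normP; exists d => // t; rewrite /ball_ /= sub0r normrN => td t0.
by rewrite distrC; apply: hd => //; exact: ltW.
Qed.

End Topology.

(** * Multi-indices and nested series *)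

Section MultiIndex.
Variable R : realType.
Local Notation C := R[i].
Local Notation F := (F R).
Implicit Types n N : nat.

Definition ext (T : Type) (z : T) n (f : 'I_n -> T) (i : nat) : T :=
  if insub i is Some j then f j else z.

Lemma ext_ord (T : Type) (z : T) n (f : 'I_n -> T) (i : 'I_n) : ext z f i = f i.
Proof. by rewrite /ext valK. Qed.

Lemma ext_out (T : Type) (z : T) n (f : 'I_n -> T) i : (n <= i)%N -> ext z f i = z.
Proof. by move=> ni; rewrite /ext insubF// ltnNge ni. Qed.

Lemma ext_lt (T : Type) (z : T) n (f : 'I_n -> T) i (ni : (i < n)%N) : ext z f i = f (Ordinal ni).
Proof. by rewrite -(ext_ord z f (Ordinal ni)). Qed.

Fixpoint cf n (s : F n) (al : nat -> nat) : C :=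
  match n return F n -> C with
  | 0 => fun s => s
  | m.+1 => fun s => cf (psc s (al m)) al
  end s.

Fixpoint mkF n (c : (nat -> nat) -> C) : F n :=
  match n return F n with
  | 0 => c (fun=> 0%N)
  | m.+1 => Ps (fun k => mkF m (fun al => c (fun i => if i == m then k else al i)))
  end.

Lemma cf_mkF n (c : (nat -> nat) -> C) al :
  cf (mkF n c) al = c (fun i => if (i < n)%N then al i else 0%N).
Proof.
elim: n c => [|n IH] c /=; first by congr c; apply/funext => i.
rewrite IH; congr c; apply/funext => i; rewrite ltnS.
by case: ltngtP => // ->.
Qed.

Lemma cf_ext n (s : F n) al be : (forall i, (i < n)%N -> al i = be i) -> cf s al = cf s be.
Proof.
elim: n s => [//|n IH] s h /=; rewrite h//; apply: IH => i ni.
by rewrite h// ltnW.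
Qed.

Lemma sum_ffun_recr (V : zmodType) n N (G : (nat -> nat) -> V) :
  (forall al be, (forall i, (i < n.+1)%N -> al i = be i) -> G al = G be) ->
  \sum_(al : {ffun 'I_n.+1 -> 'I_N}) G (ext 0%N (fun i => nat_of_ord (al i))) =
  \sum_(k < N) \sum_(be : {ffun 'I_n -> 'I_N})
     G (fun i => if i == n then nat_of_ord k else ext 0%N (fun i => nat_of_ord (be i)) i).
Proof.
move=> Gext; rewrite pair_big /=.
pose join (p : 'I_N * {ffun 'I_n -> 'I_N}) : {ffun 'I_n.+1 -> 'I_N} :=
  [ffun i => if unlift ord_max i is Some j then p.2 j else p.1].
have maxlift (j : 'I_n) : lift ord_max j = j :> nat by rewrite /= /bump leqNgt ltn_ord.
rewrite (reindex join) /=; last first.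
  exists (fun al => (al ord_max, [ffun j => al (lift ord_max j)])) => [[k be] _|al _] /=.
    congr pair; first by rewrite ffunE unlift_none.
    by apply/ffunP => j; rewrite !ffunE liftK.
  by apply/ffunP => i; rewrite ffunE; case: unliftP => [j ->|->]; rewrite ?ffunE.
apply: eq_bigr => -[k be] _ /=; apply: Gext => i; rewrite ltnS leq_eqVlt.
have [-> _|iN /= ni] := eqVneq i n.
  have nmax : Ordinal (ltnSn n) = ord_max by apply: val_inj.
  by rewrite (ext_lt _ _ (ltnSn n)) nmax ffunE unlift_none.
have -> : i = nat_of_ord (lift ord_max (Ordinal ni)) by rewrite maxlift.
by rewrite ext_ord ffunE liftK maxlift /= ext_lt.
Qed.

(** Both sides cut each exponent separately at [N], so the nested partial sums equal those over
    multi-indices exactly, not only in the limit. *)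
Lemma pev_multi n N (w : nat -> C) (s : F n) :
  pev N w s = \sum_(al : {ffun 'I_n -> 'I_N}) cf s (ext 0%N (fun i => nat_of_ord (al i))) *
     \prod_(i < n) w i ^+ ext 0%N (fun i => nat_of_ord (al i)) i.
Proof.
elim: n s => [|n IH] s.
  rewrite (big_pred1 [ffun i : 'I_0 => match i with Ordinal m lt => False_rect _ (notF lt) end]).
    by rewrite big_ord0 mulr1.
  by move=> al; apply/esym/eqP/ffunP => -[].
rewrite (@sum_ffun_recr _ _ _ (fun al => cf s al * \prod_(i < n.+1) w i ^+ al i)); last first.
  by move=> al be h; rewrite (cf_ext _ h); congr (_ * _); apply: eq_bigr => i _; rewrite h.
rewrite pevS; apply: eq_bigr => k _; rewrite IH mulr_suml; apply: eq_bigr => be _.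
rewrite big_ord_recr /= eqxx mulrA; congr (_ * _ * _).
  by apply: cf_ext => i ni; rewrite ltn_eqF.
by apply: eq_bigr => i _; rewrite ltn_eqF.
Qed.

Fixpoint absF n : F n -> F n :=
  match n return F n -> F n with
  | 0 => fun s => (nc s)%:C%C
  | m.+1 => fun s => Ps (fun k => absF (psc s k))
  end.

Lemma pev_absF n N (r : nat -> R) (s : F n) :
  pev N (fun i => (r i)%:C%C) (absF s) = (cs N r s)%:C%C.
Proof.
elim: n s => [//|n IH] s; rewrite pevS /= rmorph_sum; apply: eq_bigr => k _ /=.
by rewrite IH rmorphM rmorphXn.
Qed.

End MultiIndex.

(** * Analytic functions and their germs *)

Section Analytic.
Variables (R : realType) (n : nat).
Local Notation C := R[i].
Local Notation K := (R[i] : numFieldType).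
Local Notation F := (F R).
Local Notation germ := (germ R).
Implicit Types (v a : 'rV[K]_n).

Definition vx v : nat -> C := ext 0 (fun i => v 0 i).
Definition xv (w : nat -> C) : 'rV[K]_n := \row_i w i.

Lemma vx_ord v (i : 'I_n) : vx v i = v 0 i. Proof. exact: ext_ord. Qed.
Lemma vx_lt v i (ni : (i < n)%N) : vx v i = v 0 (Ordinal ni). Proof. exact: ext_lt. Qed.
Lemma vxK v : xv (vx v) = v.
Proof. by apply/rowP => i; rewrite mxE vx_ord. Qed.
Lemma xvK w i : (i < n)%N -> vx (xv w) i = w i.
Proof. by move=> ni; rewrite vx_lt mxE. Qed.
Lemma gev_xv w (s : germ n) : gev (vx (xv w)) s = gev w s.
Proof. by apply: gev_ext => i ni; exact: xvK. Qed.

Lemma real_pos (e : C) : 0 < e -> 0 < complex.Re e /\ e = (complex.Re e)%:C%C.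
Proof. by rewrite ltcE /= => /andP[/eqP ie ->]; split=> //; case: e ie => a b /= ->. Qed.

Lemma norm_le (z : C) (e : R) : (`|z| <= e%:C%C) = (nc z <= e).
Proof. by rewrite nc_norm lecR. Qed.

Lemma nbhs_modP a (P : 'rV[K]_n -> Prop) : (\forall v \near a, P v) <->
  exists2 e : R, 0 < e & forall v, (forall i, nc (v 0 i - a 0 i) <= e) -> P v.
Proof.
split=> [/nbhs_rVP[e e0 h]|[e e0 h]].
  have [e0' eE] := real_pos e0; exists (complex.Re e) => // v hv; apply: h => i.
  by rewrite eE norm_le.
apply/nbhs_rVP; exists e%:C%C; first by rewrite ltcR.
by move=> v hv; apply: h => i; rewrite -norm_le.
Qed.

Lemma near_vx (P : (nat -> C) -> Prop) : nz P -> \forall v \near (0 : 'rV[K]_n), P (vx v).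
Proof.
move=> [e e0 h]; apply/nbhs_modP; exists e => // v hv; apply: h => i.
have [ni|ni] := ltnP i n; last by rewrite /vx ext_out// nc0 ltW.
by rewrite vx_lt; have := hv (Ordinal ni); rewrite mxE subr0.
Qed.

Lemma near_xv (P : 'rV[K]_n -> Prop) : (\forall v \near (0 : 'rV[K]_n), P v) -> nz (fun w => P (xv w)).
Proof.
move=> /nbhs_modP[e e0 h]; exists e => // w hw; apply: h => i.
by rewrite !mxE subr0.
Qed.

Definition expands (f : 'rV[K]_n -> C) (s : germ n) := \forall v \near (0 : 'rV[K]_n), f v = gev (vx v) s.

Lemma expands_uniq f s t : expands f s -> expands f t -> s = t.
Proof.
move=> /near_xv hs /near_xv ht; apply: gev_inj.
by apply: nz1 (nzI hs ht) => v; rewrite !gev_xv => -[<- <-].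
Qed.

Lemma expands_near f g s : (\forall v \near (0 : 'rV[K]_n), f v = g v) -> expands f s -> expands g s.
Proof. by apply: filterS2 => v ->. Qed.

Lemma clim_cvg (u : nat -> C) (l : C) : clim u l <-> (u N : K) @[N --> \oo] --> (l : K).
Proof.
split=> [h|/cvg_seqP h e e0].
  apply/cvg_seqP => e /real_pos[e0 ->]; have [N0 hN] := h _ e0.
  by exists N0 => N /hN; rewrite norm_le.
have [|N0 hN] := h e%:C%C; first by rewrite ltcR.
by exists N0 => N /hN; rewrite norm_le.
Qed.

Lemma partial_sumE (c : multi_index n -> C) v N :
  @partial_sum K n c v N =
  pev N (vx v) (mkF n (fun al => c [ffun i : 'I_n => al (nat_of_ord i)])).
Proof.
rewrite pev_multi; apply: eq_bigr => al _ /=; rewrite cf_mkF; congr (_ * _).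
  congr c; apply/ffunP => i; rewrite !ffunE ltn_ord.
  by rewrite (@ext_ord _ 0%N n (fun i => nat_of_ord (al i))).
apply: eq_bigr => i _; rewrite ffunE vx_ord.
by rewrite (@ext_ord _ 0%N n (fun i => nat_of_ord (al i))).
Qed.

Lemma mkF_abs m (c : (nat -> nat) -> C) : mkF m (fun al => `|c al|) = absF (mkF m c).
Proof.
elim: m c => [|m IH] c /=; first by rewrite nc_norm.
by apply: psP => k /=; rewrite IH.
Qed.

Lemma mkF_cf m (s : F m) : mkF m (cf s) = s.
Proof.
elim: m s => [//|m IH] s; apply: psP => k /=; rewrite -[RHS]IH; congr (mkF m _).
by apply/funext => al; rewrite eqxx; apply: cf_ext => i im; rewrite ltn_eqF.
Qed.

(** A positive element of [C] is real, so the radius and the bound of [analytic_at] turn into the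
    real ones of [bnd]. *)
Lemma analyticP (f : 'rV[K]_n -> K) a :
  analytic_at f a <-> exists s : germ n, expands (fun v => f (a + v)) s.
Proof.
have parts e (c : multi_index n -> C) N : @partial_sum K n (fun al => `|c al|) (const_mx e%:C%C) N =
   (cs N (fun=> e) (mkF n (fun al => c [ffun i : 'I_n => al (nat_of_ord i)])))%:C%C.
  rewrite partial_sumE mkF_abs -pev_absF; apply: pev_ext => i ni.
  by rewrite vx_lt mxE.
split=> [[c [rho [rho0 [M hM] hf]]]|[s hs]].
  have [e0 rhoE] := real_pos rho0; move: (complex.Re rho) e0 rhoE => e e0 rhoE.
  pose s := mkF n (fun al => c [ffun i : 'I_n => al (nat_of_ord i)]).
  have hb : bnd (fun=> e) (complex.Re M) s.
    by move=> N; have := hM N; rewrite rhoE parts lecE => /andP[].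
  exists (mkg (bnd_summ (fun=> e0) hb)); apply/nbhs_modP; exists e => // v hv.
  have ve i : nc (vx v i) <= e.
    have [ni|ni] := ltnP i n; last by rewrite /vx ext_out// nc0 ltW.
    by rewrite vx_lt; have := hv (Ordinal ni); rewrite mxE subr0.
  apply/esym/(ev_eq (r := fun=> e) _ ve hb) => //; apply/clim_cvg.
  have := hf v; under eq_fun do rewrite partial_sumE.
  by apply=> i; rewrite rhoE norm_le; have := hv i; rewrite mxE subr0.
have [e e0 [M hM]] := gsumm s; have /nbhs_modP[e1 e10 h1] := hs.
pose e2 := Num.min e e1; have e20 : 0 < e2 by rewrite lt_min e0.
have h2 : bnd (fun=> e2) M (gval s).
  by apply: bnd_monor hM => // i _; rewrite ge_min lexx.
pose c (al : multi_index n) := cf (gval s) (ext 0%N al).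
have cE : mkF n (fun al => c [ffun i : 'I_n => al (nat_of_ord i)]) = gval s.
  rewrite -[RHS]mkF_cf.
  have -> : (fun al => c [ffun i : 'I_n => al (nat_of_ord i)]) = cf (gval s); last by [].
  apply/funext => al; apply: cf_ext => i ni.
  by rewrite ext_lt ffunE.
exists c, e2%:C%C; split; first by rewrite ltcR.
  by exists M%:C%C => N; rewrite parts cE lecR.
move=> v hv; have hv' i : nc (v 0 i) <= e2 by rewrite -norm_le.
have ve i : nc (vx v i) <= e2.
  have [ni|ni] := ltnP i n; last by rewrite /vx ext_out// nc0 ltW.
  by rewrite vx_lt.
rewrite h1 => [|i]; last by rewrite mxE subr0 (le_trans (hv' i))// ge_min lexx orbT.
under eq_fun do rewrite partial_sumE cE; apply/clim_cvg.
exact: (evP (r := fun=> e2) _ ve h2).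
Qed.

Lemma derive_expands (f : 'rV[K]_n -> K) s (i : 'I_n) : expands f s ->
  expands (fun v => 'D_(delta_mx 0 i) (f : 'rV[K]_n -> K^o) v) (gpd i s).
Proof.
move=> hs; have [e e0 [M hM]] := gsumm s; have /nbhs_modP[e1 e10 h1] := hs.
have M0 := bnd_ge0 (fun=> e0) hM.
(* Half of each radius, so that the displaced point [t *: delta_mx 0 i + v] still lies where the
   Taylor estimate and the expansion of [f] hold. *)
pose d := Num.min (e / 2) (e1 / 2); have d0 : 0 < d by rewrite lt_min !divr_gt0.
apply/nbhs_modP; exists d => // v hv0.
have hv j : nc (v 0 j) <= d by have := hv0 j; rewrite mxE subr0.
have ve j : nc (vx v j) <= e / 2.
  have [nj|nj] := ltnP j n; last by rewrite /vx ext_out// nc0 divr_ge0// ltW.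
  by rewrite vx_lt (le_trans (hv _))// ge_min lexx.
have fE (w : 'rV[K]_n) : (forall j, nc (w 0 j - v 0 j) <= e1 / 2) -> f w = gev (vx w) s.
  move=> hw; apply: h1 => j; rewrite mxE subr0.
  have := nc_dist3 (w 0 j) (v 0 j) 0; rewrite !subr0 => /le_trans; apply.
  by rewrite [leRHS]splitr lerD// (le_trans (hv j))// ge_min lexx orbT.
apply: derive_eps => eps /real_pos[eps0 ->]; move: (complex.Re eps) eps0 => {eps} eps eps0.
pose A := (e / 2) ^- 2 * M.
have A0 : 0 <= A by rewrite mulr_ge0// invr_ge0 exprn_ge0// divr_ge0// ltW.
(* The difference quotient is off by at most [nc t * A], which this makes at most [eps]. *)
pose dd := Num.min d (eps / (A + 1)).
have dd0 : 0 < dd by rewrite lt_min d0 divr_gt0// ltr_wpDl.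
exists dd%:C%C; first by rewrite ltcR.
move=> t t0; rewrite norm_le le_min => /andP[td te]; rewrite norm_le.
have coord j : (t *: delta_mx 0 i + v) 0 j = if j == i then v 0 j + t else v 0 j.
  by rewrite !mxE eqxx /=; case: eqP => _; rewrite ?mulr1 ?mulr0 ?add0r// addrC.
rewrite !fE; first last.
- move=> j; rewrite coord; case: eqP => _; last by rewrite subrr nc0 divr_ge0// ltW.
  by rewrite addrC addKr (le_trans td)// ge_min lexx orbT.
- by move=> j; rewrite subrr nc0 divr_ge0// ltW.
have -> : gev (vx (t *: delta_mx 0 i + v)) s =
    ev (fun j => if j == i :> nat then vx v j + t else vx v j) (gval s).
  apply: gev_ext => j nj; rewrite !vx_lt coord.
  by rewrite -val_eqE.
have td2 : nc t <= e / 2 by rewrite (le_trans td)// ge_min lexx.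
have := ev_deriv (r := fun=> e) (fun=> e0) (ltn_ord i) hM ve td2.
rewrite /gev gval_pd; set X := ev _ (gval s); set Y := ev _ _; set Z := ev _ (pd _ _) => h.
have -> : t^-1 * (X - Y) - Z = t^-1 * (X - Y - t * Z) by rewrite [RHS]mulrBr mulKf.
have nt0 : 0 < nc t by rewrite nc_gt0.
rewrite ncM ncV mulrC ler_pdivrMr// (le_trans h)//.
rewrite exprMn exprVn -mulrA -/A expr2 -mulrA mulrC ler_pM2r//.
rewrite (le_trans (ler_wpM2r A0 te))// mulrAC ler_pdivrMr ?ltr_wpDl// ler_pM2l//.
by rewrite lerDl.
Qed.

End Analytic.

Lemma near_sub (T : topologicalType) (a : T) (P Q : T -> Prop) :
  (forall q, P q -> Q q) -> (\forall q \near a, P q) -> \forall q \near a, Q q.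
Proof. by move=> PQ; apply: (@filterS _ _ (nbhs_filter a)). Qed.

Lemma near_and (T : topologicalType) (a : T) (P Q : T -> Prop) :
  (\forall q \near a, P q) -> (\forall q \near a, Q q) -> \forall q \near a, P q /\ Q q.
Proof. exact: (@filterI _ _ (nbhs_filter a)). Qed.

(** * Germs at a point of the manifold, read in a chart *)

Section Representation.
Variables (R : realType) (n : nat).
Local Notation C := R[i].
Local Notation K := (R[i] : numFieldType).
Local Notation germ := (germ R).

Lemma expands_at0 (f : 'rV[K]_n -> C) (s : germ n) : expands f s -> f 0 = gc0 s.
Proof.
move=> /nbhs_modP[e e0 h]; rewrite h => [|i]; last by rewrite subrr nc0 ltW.
by rewrite -gev_at0; apply: gev_ext => i ni; rewrite vx_lt mxE.
Qed.

Lemma comp_expands (f : 'rV[K]_n -> C) s (phi : 'rV[K]_n -> 'rV[K]_n) (g : nat -> germ n)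
    (sg : germ n -> germ n) :
  expands f s -> (forall i : 'I_n, expands (fun v => phi v 0 i) (g i)) ->
  (forall i, (i < n)%N -> gc0 (g i) = 0) ->
  (forall s, nz (fun w => gev w (sg s) = gev (fun i => gev w (g i)) s)) ->
  expands (fun v => f (phi v)) (sg s).
Proof.
move=> hf hphi g0 hsg.
have h1 := nz_comp (P := fun u => f (xv n u) = gev (vx (xv n u)) s) g0 (near_xv hf).
have h2 : nz (fun w => forall i, (i < n)%N -> vx (phi (xv n w)) i = gev w (g i)).
  apply: nz_all => i ni; apply: nz1 (near_xv (hphi (Ordinal ni))) => w.
  by rewrite (vx_lt _ ni) gev_xv.
have := near_vx n (nzI h1 (nzI h2 (hsg s))); rewrite /expands.
move=> /nbhs_modP[e e0 he]; apply/nbhs_modP; exists e => // v hv.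
have [] := he v hv; set u := fun i : nat => if _ then _ else _ => e1 [e2 ->].
rewrite vxK in e2; have uE : xv n u = phi v.
  by apply/rowP => i; rewrite mxE /u ltn_ord -e2 ?ltn_ord// vx_ord.
rewrite uE in e1; rewrite e1; apply: gev_ext => i ni.
by rewrite e2.
Qed.

Lemma comp_analytic (f : 'rV[K]_n -> K) (g : 'rV[K]_n -> 'rV[K]_n) (a : 'rV[K]_n) :
  analytic_at f (g a) -> (forall i, analytic_at (fun v => g v 0 i) a) ->
  analytic_at (fun v => f (g v)) a.
Proof.
move=> /analyticP[s hs] hg; apply/analyticP.
have /choice[G hG] : forall i : 'I_n, exists s : germ n, expands (fun v => g (a + v) 0 i) s.
  by move=> i; have /analyticP := hg i.
pose h := ext 0 (fun i : 'I_n => G i - gcst n (g a 0 i)).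
have h0 i : (i < n)%N -> gc0 (h i) = 0.
  move=> ni; rewrite /h (ext_lt _ _ ni) raddfB /= gc0_cst -(expands_at0 (hG _)) addr0.
  by rewrite subrr.
have [sg [sg1 _ _]] := subst_germ h0; exists (sg s).
have := comp_expands (phi := fun v => g (a + v) - g a) hs _ h0 sg1.
rewrite (_ : (fun v => f (g a + (g (a + v) - g a))) = fun v => f (g (a + v))); last first.
  by apply/funext => v; rewrite addrC subrK.
apply=> i; have h1 := near_vx n (nz_gevB (G i) (gcst n (g a 0 i))).
apply: filterS2 (hG i) h1 => v e1 e2.
by rewrite /h ext_ord e2 gev_cst -e1 !mxE.
Qed.

Lemma analytic_near (f g : 'rV[K]_n -> K) (a : 'rV[K]_n) :
  (\forall v \near a, f v = g v) -> analytic_at f a -> analytic_at g a.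
Proof.
move=> /nbhs_modP[e e0 h] /analyticP[s hs]; apply/analyticP; exists s.
apply: expands_near hs; apply/nbhs_modP; exists e => // v hv; apply: h => i.
have -> : (a + v) 0 i - a 0 i = v 0 i by rewrite mxE addrAC subrr add0r.
by have := hv i; rewrite mxE subr0.
Qed.

Lemma gvar_expands (i : 'I_n) : expands (fun v : 'rV[K]_n => v 0 i) (gvar R n i).
Proof.
have := near_vx n (gev_gvar R (ltn_ord i)); apply: filterS => v ->.
by rewrite vx_ord.
Qed.

Section Manifold.
Variables (S : complex_manifold R n) (p : S).
Implicit Types x y : chart R[i] n S.

Lemma near_chart x q0 (P : S -> Prop) : cdom x q0 ->
  (\forall q \near q0, P q) <-> (\forall v \near Defs.coord x q0, P (coord_inv x v)).
Proof.
move=> xq0; split=> hP.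
  have /= h : coord_inv x @ Defs.coord x q0 --> coord_inv x (Defs.coord x q0).
    exact: coord_inv_continuous.
  by rewrite Defs.coordK// in h; exact: h.
have dom : \forall q \near q0, cdom x q by apply: open_nbhs_nbhs; split => //; exact: cdom_open.
have /= h : Defs.coord x @ q0 --> Defs.coord x q0 by exact: Defs.coord_continuous.
have {}h := h _ hP.
by apply: filterS2 dom h => q xq; rewrite /= Defs.coordK.
Qed.

Lemma near_image x q0 : cdom x q0 ->
  \forall v \near Defs.coord x q0, cdom x (coord_inv x v) /\ Defs.coord x (coord_inv x v) = v.
Proof.
move=> xq0; have : \forall v \near Defs.coord x q0, (Defs.coord x @` cdom x) v.
  by apply: open_nbhs_nbhs; split; [exact: ccod_open|exists q0].
by apply: filterS => _ [q xq <-]; rewrite Defs.coordK.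
Qed.

Definition rep x (f : S -> C) (s : germ n) := expands (fun v => f (coord_inv x v)) s.

Section AtP.
Variable x : chart R[i] n S.
Hypothesis hx : coordinates_at p x.

Let xp : cdom x p. Proof. by case: hx. Qed.
Let x0 : Defs.coord x p = 0. Proof. by case: hx. Qed.

Lemma near_coord (P : S -> Prop) :
  (\forall q \near p, P q) <-> (\forall v \near (0 : 'rV[K]_n), P (coord_inv x v)).
Proof. by rewrite (near_chart _ xp) x0. Qed.

Lemma near_coordK : \forall v \near (0 : 'rV[K]_n), cdom x (coord_inv x v) /\ Defs.coord x (coord_inv x v) = v.
Proof. by have := near_image xp; rewrite x0. Qed.

Lemma coord_inv0 : coord_inv x 0 = p.
Proof. rewrite -x0; exact: Defs.coordK. Qed.

Lemma rep_near f g s : germ_eq p f g -> rep x f s -> rep x g s.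
Proof. by move=> /near_coord; exact: expands_near. Qed.

Lemma germ_eqP f g s t : rep x f s -> rep x g t -> (germ_eq p f g <-> s = t).
Proof.
move=> fs gt; split=> [/rep_near/(_ fs) gs|st]; first exact: expands_uniq gs gt.
apply/near_coord; rewrite -st in gt; have := near_and fs gt.
by apply: near_sub => v [-> ->].
Qed.

Lemma rep_at f s : rep x f s -> f p = gc0 s.
Proof. by move=> /expands_at0; rewrite coord_inv0. Qed.

Lemma rep_cst c : rep x (fun=> c) (gcst n c).
Proof. by apply/nbhs_modP; exists 1 => // v _; rewrite gev_cst. Qed.

Lemma repD f g s t : rep x f s -> rep x g t -> rep x (fun q => f q + g q) (s + t).
Proof.
move=> fs gt; have h := near_vx n (nz_gevD s t).
by have := near_and h (near_and fs gt); apply: near_sub => v [-> [-> ->]].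
Qed.

Lemma repM f g s t : rep x f s -> rep x g t -> rep x (fun q => f q * g q) (s * t).
Proof.
move=> fs gt; have h := near_vx n (nz_gevM s t).
by have := near_and h (near_and fs gt); apply: near_sub => v [-> [-> ->]].
Qed.

Lemma rep_sum (I : Type) (r : seq I) (P : pred I) (f : I -> S -> C) (s : I -> germ n) :
  (forall i, rep x (f i) (s i)) ->
  rep x (fun q => \sum_(i <- r | P i) f i q) (\sum_(i <- r | P i) s i).
Proof.
move=> h; elim: r => [|i r IH].
  under eq_fun do rewrite big_nil; rewrite big_nil -(raddf0 (gcst n)).
  exact: rep_cst.
under eq_fun do rewrite big_cons; rewrite big_cons; case: ifP => // _.
exact: repD.
Qed.

Lemma rep_prod (I : Type) (r : seq I) (P : pred I) (f : I -> S -> C) (s : I -> germ n) :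
  (forall i, rep x (f i) (s i)) ->
  rep x (fun q => \prod_(i <- r | P i) f i q) (\prod_(i <- r | P i) s i).
Proof.
move=> h; elim: r => [|i r IH].
  under eq_fun do rewrite big_nil; rewrite big_nil -(rmorph1 (gcst n)).
  exact: rep_cst.
under eq_fun do rewrite big_cons; rewrite big_cons; case: ifP => // _.
exact: repM.
Qed.

Lemma repX f s k : rep x f s -> rep x (fun q => f q ^+ k) (s ^+ k).
Proof.
move=> h; elim: k => [|k IH].
  under eq_fun do rewrite expr0; rewrite expr0 -(rmorph1 (gcst n)); exact: rep_cst.
by under eq_fun do rewrite exprS; rewrite exprS; exact: repM.
Qed.

Lemma rep_pderiv f s (i : 'I_n) : rep x f s -> rep x (pderiv x i f) (gpd i s).
Proof.
move=> /derive_expands h; have := near_and near_coordK (h i).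
by apply: near_sub => v [[_ e] <-]; rewrite /pderiv e.
Qed.

Definition germ_fun (s : germ n) (q : S) : C := gev (vx (Defs.coord x q)) s.

Lemma rep_germ_fun s : rep x (germ_fun s) s.
Proof. by move: near_coordK; apply: near_sub => v [_ e]; rewrite /germ_fun e. Qed.

Lemma rep_coord (i : 'I_n) : rep x (fun q => Defs.coord x q 0 i) (gvar R n i).
Proof.
by have := near_and near_coordK (gvar_expands i); apply: near_sub => v [[_ ->]].
Qed.

(** Holomorphy refers to all charts of the atlas; as analytic functions compose, an expansion in one
    compatible chart is enough. *)
Lemma holoP f : holo_at p f <-> exists s, rep x f s.
Proof.
split=> [hf|[s hs] c ac cp].
  have [c ac cp] := atlas_cover p; have := hf c ac cp.
  have [_ _ /(_ c ac)[/(_ p xp cp) hxc _]] := hx.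
  rewrite x0 in hxc; move=> hfc.
  have : analytic_at (fun v => f (coord_inv c (Defs.coord c (coord_inv x v)))) 0.
    have := @comp_analytic (fun v => f (coord_inv c v)) (fun v => Defs.coord c (coord_inv x v)) 0.
    by rewrite coord_inv0 => /(_ hfc hxc).
  move=> /analyticP[s hs]; exists s; apply: expands_near hs.
  have /near_coord : \forall q \near p, cdom c q by apply: open_nbhs_nbhs; split => //; exact: cdom_open.
  by apply: near_sub => v cv; rewrite add0r Defs.coordK.
have [_ _ /(_ c ac)[_ /(_ p cp xp) hcx]] := hx.
have hfx : analytic_at (fun v => f (coord_inv x v)) (Defs.coord x (coord_inv c (Defs.coord c p))).
  rewrite Defs.coordK// x0; apply/analyticP; exists s.
  by under eq_fun do rewrite add0r.
have := comp_analytic hfx hcx; apply: analytic_near.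
have /(near_chart _ cp) : \forall q \near p, cdom x q by apply: open_nbhs_nbhs; split => //; exact: cdom_open.
by apply: near_sub => v xv; rewrite Defs.coordK.
Qed.

Lemma holo_germ_fun s : holo_at p (germ_fun s).
Proof. by apply/holoP; exists s; exact: rep_germ_fun. Qed.

Lemma jacobianP f s g t : rep x f s -> rep x g t ->
  (jacobian_ideal p x f g <-> exists a : 'I_n -> germ n, t = \sum_(i < n) a i * gpd i s).
Proof.
move=> fs gt; split=> [[_ [a [ha ge]]]|[a ta]].
  have /choice[b hb] : forall i, exists s, rep x (a i) s by move=> i; apply/holoP.
  exists b; apply/(germ_eqP gt _)/ge.
  by apply: rep_sum => i; apply: repM => //; exact: rep_pderiv.
split; first by apply/holoP; exists t.
exists (fun i => germ_fun (a i)); split=> [i|]; first exact: holo_germ_fun.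
apply/(germ_eqP gt _)/ta; apply: rep_sum => i; apply: repM; first exact: rep_germ_fun.
exact: rep_pderiv.
Qed.

Lemma germ_unitP f s : rep x f s -> (germ_unit p f <-> gc0 s != 0).
Proof.
move=> fs; split=> [[g /holoP[t gt] fg]|/gunit[t st]].
  have := (germ_eqP (repM fs gt) (rep_cst 1)).1 fg; rewrite rmorph1 => st.
  apply/eqP => s0; have := congr1 (@gc0 R n) st.
  by rewrite rmorphM /= s0 mul0r rmorph1 => /esym/eqP; rewrite oner_eq0.
exists (germ_fun t); first exact: holo_germ_fun.
by apply/(germ_eqP (repM fs (rep_germ_fun t)) (rep_cst 1)); rewrite rmorph1.
Qed.

End AtP.

Lemma transition_half x y : coordinates_at p x -> coordinates_at p y ->
  exists sg : {rmorphism germ n -> germ n}, [/\ forall f s, rep x f s -> rep y f (sg s),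
    forall c, sg (gcst n c) = gcst n c
  & forall i, (i < n)%N -> gc0 (sg (gvar R n i)) = 0].
Proof.
move=> hx hy.
have /choice[G hG] : forall i : 'I_n, exists s, rep y (fun q => Defs.coord x q 0 i) s.
  by move=> i; apply/(holoP hy)/(holoP hx); exists (gvar R n i); exact: rep_coord.
pose g := ext 0 G.
have g0 i : (i < n)%N -> gc0 (g i) = 0.
  move=> ni; rewrite /g (ext_lt _ _ ni) -(rep_at hy (hG _)).
  by case: hx => _ -> _; rewrite mxE.
have [sg [sg1 sg2 sg3]] := subst_germ g0; exists sg; split=> //; last first.
  by move=> i ni; rewrite sg3// g0.
move=> f s fs.
have := comp_expands (phi := fun v => Defs.coord x (coord_inv y v)) fs _ g0 sg1.
move=> h; apply: expands_near (h _); last by move=> i; rewrite /g ext_ord; exact: hG.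
have xp : cdom x p by case: hx.
have /(near_coord hy) : \forall q \near p, cdom x q by apply: open_nbhs_nbhs; split => //; exact: cdom_open.
by apply: near_sub => v xv; rewrite Defs.coordK.
Qed.

(** Each half substitutes the expansions of the other chart's coordinates; the two are inverse
    because expansions are unique. *)
Lemma transition x y : coordinates_at p x -> coordinates_at p y ->
  exists sg tau : {rmorphism germ n -> germ n},
  [/\ forall f s, rep x f s -> rep y f (sg s), forall f s, rep y f s -> rep x f (tau s),
      cancel sg tau, cancel tau sg
    & (forall c, sg (gcst n c) = gcst n c) /\ (forall i, (i < n)%N -> gc0 (sg (gvar R n i)) = 0)].
Proof.
move=> hx hy; have [sg [s1 s2 s3]] := transition_half hx hy.
have [tau [t1 _ _]] := transition_half hy hx.
exists sg, tau; split=> //.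
- move=> s; have h := rep_germ_fun hx s; exact: expands_uniq (t1 _ _ (s1 _ _ h)) h.
- move=> s; have h := rep_germ_fun hy s; exact: expands_uniq (s1 _ _ (t1 _ _ h)) h.
Qed.

End Manifold.
End Representation.

(** * Equations of smooth hypersurfaces *)

Section SmoothHypersurface.
Variable R : realType.
Local Notation C := R[i].
Local Notation K := (R[i] : numFieldType).
Local Notation germ := (germ R).

(** Up to sign [p.[0]] is the product of the roots, so not all of them can exceed [e] in modulus. *)
Lemma small_root (p : {poly C}) d (e : R) : p \is monic -> size p = d.+2 ->
  p.[0] != 0 -> nc p.[0] <= e ^+ d.+1 -> 0 < e -> exists t, [/\ root p t, t != 0 & nc t <= e].
Proof.
move=> pm sp p0 pe e0; have [r pE] := closed_field_poly_normal (p : {poly C}).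
rewrite (monicP pm) scale1r in pE.
have sr : size r = d.+1 by move: sp; rewrite pE size_prod_XsubC => -[].
have rootr z : (z \in r) = root p z by rewrite pE root_prod_XsubC.
have [/hasP[t tr te]|/hasPn big] := boolP (has (fun t => nc t <= e) r).
  exists t; split=> //; first by rewrite -rootr.
  by apply: contra p0 => /eqP t0; rewrite -/(root p 0) -t0 -rootr.
have : e ^+ size r < nc p.[0].
  have r0 : r != [::] by rewrite -size_eq0 sr.
  rewrite pE horner_prod; elim: r r0 big {sr rootr pE} => [//|z r IH] _ big.
  have ez : e < nc z by rewrite ltNge; apply: big; rewrite mem_head.
  rewrite big_cons ncM hornerXsubC sub0r ncN exprS.
  have [->|r0] := eqVneq r [::]; first by rewrite big_nil nc1 expr0 !mulr1.
  apply: ltr_pM => //; [exact: ltW|exact/exprn_ge0/ltW|apply: IH => // y yr; apply: big].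
  by rewrite in_cons yr orbT.
by rewrite sr ltNge pe.
Qed.

Lemma nz_gevX n (s : germ n) k : nz (fun v => gev v (s ^+ k) = gev v s ^+ k).
Proof.
elim: k => [|k IH]; first by apply: nzT => v; rewrite expr0 gev1.
by apply: nz1 (nzI IH (nz_gevM s (s ^+ k))) => v [IHv]; rewrite !exprS IHv.
Qed.

Lemma nz_gev_sum n m (s : nat -> germ n) :
  nz (fun v => gev v (\sum_(k < m) s k) = \sum_(k < m) gev v (s k)).
Proof.
elim: m => [|m IH]; first by apply: nzT => v; rewrite !big_ord0 gev0.
apply: nz1 (nzI IH (nz_gevD (\sum_(k < m) s k) (s m))) => v [IHv].
by rewrite !big_ord_recr IHv.
Qed.

Lemma nz_gev_horner n d (p : {poly germ n}) : (size p <= d)%N ->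
  nz (fun v => gev v (map_poly (@gi R n) p).[gX R n] = \sum_(k < d) gev v p`_k * v n ^+ k).
Proof.
move=> pd; rewrite (horner_map_wide _ _ pd) ?raddf0//.
have := nz_gev_sum d (fun k => gi p`_k * gX R n ^+ k); move=> /nzI.
have h2 := nz_all (fun k _ => nzI (nz_gev_gi p`_k)
  (nzI (nz_gevX (gX R n) k) (nz_gevM (gi p`_k) (gX R n ^+ k)))).
move=> /(_ _ (h2 d)); apply: nz1 => v [-> h]; apply: eq_bigr => k _.
by have [e1 [e2 ->]] := h k (ltn_ord k); rewrite e1 e2 gev_gX.
Qed.

Lemma nz_truncate n (P : (nat -> C) -> Prop) :
  nz P -> nz (fun w => P (fun i => if i == n then 0 else w i)).
Proof.
move=> [e e0 h]; exists e => // w we; apply: h => i; case: eqP => // _.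
by rewrite nc0 ltW.
Qed.

Lemma gcoefD n (s t : germ n.+1) k : gcoef (s + t) k = gcoef s k + gcoef t k.
Proof. by apply: gval_inj; rewrite gvalD. Qed.

Lemma gX_dvd n (s : germ n.+1) : gcoef s 0 = 0 -> exists t, s = gX R n * t.
Proof. by move=> s0; have [t st] := gsplit s; exists t; rewrite {1}st s0 raddf0 add0r. Qed.

(** Vanishing on the hyperplane gives [s = X * u]. If [u] vanished at 0, it would be regular of
    positive order in [X], and its Weierstrass polynomial would have a nonzero constant coefficient,
    as [X ^+ 2] does not divide [s]. At a nearby point where that coefficient is nonzero, the
    polynomial has a small nonzero root, so [s] would have a zero off the hyperplane. *)
Lemma gX_factor n (s : germ n.+1) : nz (fun w => gev w s = 0 <-> w n = 0) ->
  (forall k, s <> gX R n ^+ 2 * k) -> exists u, s = gX R n * u /\ gc0 u != 0.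
Proof.
move=> s0 sqf; have [u su] : exists u, s = gX R n * u.
  apply: gX_dvd; have [t st] := gsplit s; apply: gev_inj.
  have := nz_truncate n (nzI s0 (nzI (nz_gevD (gi (gcoef s 0)) (gX R n * t))
    (nzI (nz_gev_gi (gcoef s 0)) (nz_gevM (gX R n) t)))).
  apply: nz1 => w; rewrite -st eqxx => -[[_ z] [e1 [e2 e3]]].
  have {z} := z erefl; rewrite e1 e2 e3 gev_gX eqxx mul0r addr0 gev0 => <-.
  by apply: gev_ext => i ni; rewrite ltn_eqF.
exists u; split=> //; apply/eqP => u0.
have s0' : nz (fun w => gev w u = 0 -> w n = 0).
  by apply: nz1 (nzI s0 (nz_gevM (gX R n) u)) => w [] + e1 e2; rewrite su e1 e2 mulr0 => -[->].
have [k uk] : exists k, gc0 (gcoef u k) != 0.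
  apply: contrapT => none.
  have none' k : gc0 (gcoef u k) = 0.
    by apply/eqP/negPn/negP => h; apply: none; exists k.
  have [e e0 he] := nzI (gev_axis none') s0'.
  pose w i : C := if i == n then e%:C%C else 0.
  have [|h1 h2] := he w.
    move=> i; rewrite /w; case: eqP => _; last by rewrite nc0 ltW.
    by rewrite nc_real ger0_norm// ltW.
  have : w n = 0 by apply: h2; apply: h1 => i ni; rewrite /w ltn_eqF.
  by rewrite /w eqxx => -[/eqP]; rewrite gt_eqF.
have [d [dlow dN]] : exists d, (forall k, (k < d)%N -> gc0 (gcoef u k) = 0) /\
    gc0 (gcoef u d) != 0.
  case: (@ex_minnP (fun k => gc0 (gcoef u k) != 0)); first by exists k.
  move=> d dN mind; exists d; split=> // j jd; apply/eqP/negPn/negP => /mind.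
  by rewrite leqNgt jd.
case: d dlow dN => [|d] dlow dN; first by move: dN; rewrite gc0_coef0 u0 eqxx.
have [q [r [rd Xd]]] := gweierstrass (gX R n ^+ d.+1) dlow dN.
have coefr j : gcoef (gX R n ^+ d.+1) j = gcoef (q * u) j + r`_j.
  by rewrite Xd gcoefD gcoef_poly.
have coefX j : gcoef (gX R n ^+ d.+1) j = (j == d.+1)%:R.
  by have := @gcoef_poly R n 'X^(d.+1) j; rewrite map_polyXn hornerXn coefXn.
have r0E : r`_0 = - (gcoef q 0 * gcoef u 0).
  have := coefr 0%N; rewrite coefX /= gcoefM big_ord1 /= => /eqP.
  by rewrite eq_sym addrC addr_eq0 => /eqP.
have u00 : gcoef u 0 != 0.
  by apply/eqP => /gX_dvd[t ut]; apply: (sqf t); rewrite su ut expr2 mulrA.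
have q0 : gc0 q != 0.
  have := congr1 (@gc0 R n) (coefr d.+1); rewrite coefX eqxx nth_default// addr0.
  rewrite gcoefM big_ord_recl subn0 (raddfD (@gc0 R n)) /= (rmorphM (@gc0 R n)) /= gc0_coef0.
  rewrite mulr1n (rmorph1 (@gc0 R n)) (raddf_sum (@gc0 R n)) big1.
    by move=> h; apply/eqP => q0; move/eqP: h; rewrite q0 mul0r addr0 oner_eq0.
  by move=> j _ /=; rewrite (rmorphM (@gc0 R n)) /= (dlow (d.+1 - _)%N) ?mulr0// ltn_subrL.
have r00 : r`_0 != 0.
  rewrite r0E oppr_eq0; apply/eqP => /germ_domain[q00|]; last exact/eqP.
  by move: q0; rewrite -gc0_coef0 q00 raddf0 eqxx.
have := nzI s0' (nzI (nz_gevX (gX R n) d.+1) (nzI (nz_gev_horner rd)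
  (nzI (nz_gevD (q * u) (map_poly (@gi R n) r).[gX R n]) (nzI (nz_gevM q u) (nz_neq0 q0))))).
move=> [e e0 he]; have [e1 e10 he1] : nz (fun v => nc (gev v r`_0) <= e ^+ d.+1).
  by apply: nz_small; rewrite ?exprn_gt0// r0E raddfN /= rmorphM /= (gc0_coef0 u) u0 mulr0 oppr0.
have [|v vs vr] := gidentity r00 (e := Num.min e e1); first by rewrite lt_min e0.
pose c (j : nat) := gev v r`_j.
(* The Weierstrass polynomial with coefficients evaluated at [v]. Replacing the last entry of [v] by
   a root gives a point where [q * u], hence [u], vanishes. *)
pose p : {poly C} := 'X^(d.+1) - \poly_(j < d.+1) c j.
have sp' : (size (- \poly_(j < d.+1) c j) < size ('X^(d.+1) : {poly C}))%N.
  by rewrite size_polyN size_polyXn ltnS size_poly.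
have p0 : p.[0] = - gev v r`_0.
  by rewrite horner_coef0 coefB coefXn coef_poly /= sub0r.
have [||||//|t [pt t0 te]] := @small_root p d e.
- by rewrite monicE lead_coefDl// lead_coefXn.
- by rewrite size_polyDl// size_polyXn.
- by rewrite p0 oppr_eq0.
- by rewrite p0 ncN; apply: he1 => i; rewrite (le_trans (vs i))// ge_min lexx orbT.
pose w i := if i == n then t else v i.
have [|h1 [h2 [h3 [h4 [h5 h6]]]]] := he w.
  move=> i; rewrite /w; case: eqP => // _.
  by rewrite (le_trans (vs i))// ge_min lexx.
have wt : w n = t by rewrite /w eqxx.
suff uw : gev w u = 0 by move: t0; rewrite -wt h1 ?eqxx.
have pt0 : \sum_(j < d.+1) gev w r`_j * w n ^+ j = w n ^+ d.+1.
  move/rootP: pt; rewrite /p hornerD hornerN horner_poly hornerXn => /eqP.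
  rewrite subr_eq0 /w eqxx => /eqP ->; apply: eq_bigr => j _; congr (_ * _).
  by apply: gev_ext => i ni; rewrite ltn_eqF.
move: h2; rewrite Xd h4 h3 h5 gev_gX pt0 => /eqP.
by rewrite -subr_eq0 addrK mulf_eq0 (negPf h6) => /eqP.
Qed.

Lemma gc0_unit n (a b : germ n) : a * b = 1 -> gc0 a != 0.
Proof.
move=> /(congr1 (@gc0 R n)); rewrite (rmorphM (@gc0 R n)) /= rmorph1 => ab.
by apply/eqP => a0; move/eqP: ab; rewrite a0 mul0r eq_sym oner_eq0.
Qed.

(** Vanishing at 0 means not being invertible, and a ring morphism with a left inverse preserves
    this. *)
Lemma gc0_iso n k (f : {rmorphism germ n -> germ k}) (g : {rmorphism germ k -> germ n}) s :
  cancel f g -> gc0 s = 0 -> gc0 (f s) = 0.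
Proof.
move=> fK s0; apply/eqP/negPn/negP => /gunit[t /(congr1 g)].
by rewrite rmorphM fK rmorph1 => /gc0_unit; rewrite s0 eqxx.
Qed.

Definition transp (a b i : nat) := if i == a then b else if i == b then a else i.

Lemma swap_vars n a b : (a < n)%N -> (b < n)%N ->
  exists pi : {rmorphism germ n -> germ n},
  [/\ involutive pi, forall c, pi (gcst n c) = gcst n c,
      forall i, (i < n)%N -> pi (gvar R n i) = gvar R n (transp a b i)
   & forall s, nz (fun w => gev w (pi s) = gev (fun i => gev w (gvar R n (transp a b i))) s)].
Proof.
move=> an bn; pose r := transp a b.
have rn i : (i < n)%N -> (r i < n)%N by rewrite /r /transp; case: eqP => // _; case: eqP.
have rK i : r (r i) = i.
  rewrite /r /transp; have [->|ij] := eqVneq i a; first by rewrite eqxx; case: eqP.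
  by have [->|inn] := eqVneq i b; rewrite ?eqxx// (negPf ij) (negPf inn).
have g0 i : (i < n)%N -> gc0 (gvar R n (r i)) = 0 by move=> _; exact: gc0_gvar.
have [pi [pev pc pv]] := subst_germ g0; exists pi; split=> //.
have pp0 i : (i < n)%N -> gc0 ((pi \o pi) (gvar R n i)) = 0.
  by move=> ni; rewrite /= pv// pv ?rn// gc0_gvar.
move=> s; apply: (rmorph_germ_uniq (s := pi \o pi) (t := idfun)) => // [c|i ni] /=.
  by rewrite !pc.
by rewrite pv// pv ?rn// rK.
Qed.

Section Component.
Variables (n : nat) (S : complex_manifold R n.+1) (p : S) (x : chart R[i] n.+1 S).
Hypothesis hx : coordinates_at p x.
Variables (D : set S) (h : S -> C) (H : germ n.+1).
Hypotheses (Dsm : smooth_hypersurface_at p D) (Dh : defining_equation p D h) (hH : rep x h H).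

Lemma swap_last (j : 'I_n.+1) : exists pi : {rmorphism germ n.+1 -> germ n.+1},
  [/\ involutive pi, forall c, pi (gcst n.+1 c) = gcst n.+1 c
   & forall s, nz (fun w => gev w s = 0 <-> w j = 0) -> nz (fun w => gev w (pi s) = 0 <-> w n = 0)].
Proof.
have [pi [piK pc pv pev]] := swap_vars (ltn_ord j) (ltnSn n); exists pi; split=> // s hs.
have h1 := nz_comp (fun i (_ : (i < n.+1)%N) => gc0_gvar R n.+1 (transp j n i)) hs.
have rj : transp j n j = n by rewrite /transp eqxx.
apply: nz1 (nzI h1 (nzI (gev_gvar R (ltnSn n)) (pev s))) => w; rewrite ltn_ord rj => -[e1 [<- ->]].
rewrite -e1; split=> <-; [|symmetry]; by apply: gev_ext => i ->.
Qed.

(** In a chart where [D] is a coordinate hyperplane, moved to the last variable, the zero set of [H]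
    is that hyperplane; square-freeness of [h] excludes the square of the variable, so [gX_factor]
    applies. *)
Lemma straighten : exists (th th' : {rmorphism germ n.+1 -> germ n.+1}) (u : germ n.+1),
  [/\ cancel th th', cancel th' th, forall c, th (gcst n.+1 c) = gcst n.+1 c,
      th H = gX R n * u & gc0 u != 0].
Proof.
have [y [j [hy [_ _ yD]]]] := Dsm; have [_ [_ sqf] hD] := Dh.
have [sg [tau [s1 _ sK tK [sc _]]]] := transition hx hy.
have [pi [piK pc piz]] := swap_last j.
have sgH : nz (fun w => gev w (sg H) = 0 <-> w j = 0).
  have h1 : \forall q \near p, h q = 0 <-> Defs.coord y q 0 j = 0.
    have := near_and hD yD; apply: near_sub => q [[a b] [c d]].
    by split=> [/b/c|/d/a].
  have := near_and ((near_coord hy _).1 h1) (near_and (near_coordK hy) (s1 _ _ hH)).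
  move=> /near_xv; apply: nz1 => w [e1 [[_ e2] e3]].
  by rewrite e2 e3 gev_xv mxE in e1.
have pth : cancel (pi \o sg) (tau \o pi) by move=> s; rewrite /= piK sK.
have pth' : cancel (tau \o pi) (pi \o sg) by move=> s; rewrite /= tK piK.
have [u [e u0]] : exists u, pi (sg H) = gX R n * u /\ gc0 u != 0.
  apply: gX_factor; first exact: piz.
  move=> k hk; pose g := tau (pi (gX R n)).
  have [|||t] := sqf (germ_fun x g) (germ_fun x (tau (pi k))).
  - exact: holo_germ_fun.
  - exact: holo_germ_fun.
  - apply/(germ_eqP hx hH (repM (repX 2 (rep_germ_fun hx g)) (rep_germ_fun hx _))).
    by rewrite -[H]pth /= hk !rmorphM.
  move=> th gt; have : germ_unit p (germ_fun x g) by exists t.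
  move=> /(germ_unitP hx (rep_germ_fun hx g)) /eqP; apply.
  by apply: (gc0_iso (f := tau \o pi) pth'); rewrite gc0_gX.
exists (pi \o sg), (tau \o pi), u; split=> //= c.
by rewrite sc pc.
Qed.

(** All three claims are read off from a unit times the last variable: modulo it remains the domain
    of germs in [n] variables, and its last derivative at 0 is the value of the unit. *)
Lemma smooth_component_succ :
  [/\ forall a b c, a * b = H * c -> (exists d, a = H * d) \/ (exists d, b = H * d),
      gc0 H = 0 & exists k : 'I_n.+1, gc0 (gpd k H) != 0].
Proof.
have [th [th' [u [thK th'K thc thH u0]]]] := straighten.
have th0 s : gc0 s = 0 -> gc0 (th s) = 0 by exact: gc0_iso.
have [v uv] := gunit u0.
have dvd a : gcoef (th a) 0 = 0 -> exists d, a = H * d.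
  move=> /gX_dvd[t at_]; exists (th' (v * t)); rewrite -[a]thK at_ -[H]thK thH -(rmorphM th').
  by rewrite -mulrA [u * _]mulrA uv mul1r.
have H0 : gc0 H = 0.
  by rewrite -[H]thK thH; apply: gc0_iso th'K _; rewrite (rmorphM (@gc0 R n.+1)) /= gc0_gX mul0r.
split=> // [a b c /(congr1 th)|].
  rewrite !rmorphM thH => /(congr1 (fun s => gcoef s 0)).
  rewrite -mulrA gcoef_gXM gcoefM big_ord1 /= => /germ_domain[]/dvd; by [left|right].
apply: contrapT => none; move/eqP: u0; apply.
have := @chain_rule R _ _ th n H (fun i _ => th0 _ (gc0_gvar _ _ _)) thc.
rewrite thH gpdM gpd_gX_last mul1r => /(congr1 (@gc0 R n.+1)).
rewrite (raddfD (@gc0 R n.+1)) /= (rmorphM (@gc0 R n.+1)) /= gc0_gX mul0r addr0 => ->.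
rewrite (raddf_sum (@gc0 R n.+1)) big1// => i _ /=.
rewrite (rmorphM (@gc0 R n.+1)) /= (th0 (gpd i H)) ?mulr0//.
by apply/eqP/negPn/negP => hi; apply: none; exists i.
Qed.

End Component.

Lemma smooth_component n (S : complex_manifold R n) (p : S) (x : chart R[i] n S)
    (D : set S) (h : S -> C) (H : germ n) :
  coordinates_at p x -> smooth_hypersurface_at p D -> defining_equation p D h -> rep x h H ->
  [/\ forall a b c, a * b = H * c -> (exists d, a = H * d) \/ (exists d, b = H * d),
      gc0 H = 0 & exists k : 'I_n, gc0 (gpd k H) != 0].
Proof.
case: n S p x D h H => [|n] S p x D h H hx Dsm; first by have [y [[]]] := Dsm.
by move=> Dh hH; exact: (smooth_component_succ hx Dsm Dh hH).
Qed.

End SmoothHypersurface.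

(** * The radical Jacobian ideal *)

Section Radical.
Variables (R : realType) (n m : nat).
Local Notation C := R[i].
Local Notation germ := (germ R).
Variable H : 'I_m -> germ n.
Hypothesis Hprime : forall i a b c, a * b = H i * c ->
  (exists d, a = H i * d) \/ (exists d, b = H i * d).
Hypothesis H0 : forall i, gc0 (H i) = 0.
Hypothesis Hd : forall i, exists k : 'I_n, gc0 (gpd k (H i)) != 0.
Hypothesis Hdist : forall i j d, H j = H i * d -> i = j.

Let P := \prod_i H i.
Let G i := \prod_(k | k != i) H k.

Lemma prod_cofactor i : P = H i * G i.
Proof. by rewrite /P (bigD1 i). Qed.

Lemma dvd_cofactor i d : G i <> H i * d.
Proof.
have main s : all (fun k => k != i) s -> forall d, \prod_(k <- s) H k <> H i * d.
  elim: s => [|k s IH] /= => [_ {}d|/andP[ki /IH{}IH] {}d].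
    rewrite big_nil => /(congr1 (@gc0 R n)).
    by rewrite rmorph1 (rmorphM (@gc0 R n)) /= H0 mul0r => /eqP; rewrite oner_eq0.
  rewrite big_cons => /Hprime[[e /Hdist ik]|[e /IH//]].
  by rewrite ik eqxx in ki.
rewrite /G -big_filter; apply: main; exact: filter_all.
Qed.

Lemma germ_mulfI (a b c : germ n) : a != 0 -> a * b = a * c -> b = c.
Proof.
move=> a0 abc; apply/eqP; rewrite -subr_eq0; apply/eqP.
by apply: germ_mulf_eq0 a0; rewrite mulrBr abc subrr.
Qed.

Lemma H_neq0 i : H i != 0.
Proof.
have [k] := Hd i; apply: contra => /eqP ->.
by rewrite raddf0 raddf0.
Qed.

Lemma prod_neq0 : P != 0.
Proof.
rewrite /P; elim/big_ind: _ => [|a b a0 b0|i _]; last exact: H_neq0.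
  by apply/eqP => /(congr1 (@gc0 R n)); rewrite rmorph1 raddf0 => /eqP; rewrite oner_eq0.
by apply: contra b0 => /eqP/germ_mulf_eq0/(_ a0) ->.
Qed.

(** A factor [g] vanishing at 0 is divisible by some [H i], as the [H i] are prime; its square would
    make [H i] divide its own cofactor. *)
Lemma prod_square_free g k : P = g ^+ 2 * k -> gc0 g != 0.
Proof.
move=> Pg; apply/eqP => g0.
have main s c : g * c = \prod_(k <- s) H k -> exists i d, g = H i * d.
  elim: s c => [|i s IH] c.
    by rewrite big_nil => /gc0_unit; rewrite g0 eqxx.
  rewrite big_cons => gc; have [[d]|[d cd]] := Hprime gc; first by exists i, d.
  apply: (IH d); apply: germ_mulfI (H_neq0 i) _.
  by rewrite -gc cd mulrCA.
have [i [d gd]] := main (index_enum 'I_m) (g * k) (etrans (mulrA _ _ _) (esym Pg)).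
apply: (@dvd_cofactor i (d * d * k)); apply: germ_mulfI (H_neq0 i) _.
by rewrite -prod_cofactor Pg gd; ring.
Qed.

Let J s := exists a : 'I_n -> germ n, s = \sum_(i < n) a i * gpd i P.

(** Independence of the differentials at 0 is delivered as a dual family of tangent vectors, the
    values at 0 of the fields [delta_i]; the later choice of coordinates uses it in this form. *)
Lemma dual_frame : (forall g k, J (g ^+ k) -> J g) ->
  exists A : 'I_m -> 'I_n -> C, forall i k,
    \sum_(j < n) A i j * gc0 (gpd j (H k)) = (i == k)%:R.
Proof.
move=> Jrad.
have JD a b : J a -> J b -> J (a + b).
  move=> [u ->] [v ->]; exists (fun i => u i + v i).
  by rewrite -big_split; apply: eq_bigr => i _; rewrite mulrDl.
have JM a b : J a -> J (b * a).
  by move=> [u ->]; exists (fun i => b * u i); rewrite mulr_sumr; apply: eq_bigr => i _; rewrite mulrA.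
have Jpd (l : 'I_n) : J (gpd l P).
  exists (fun i => (i == l)%:R); rewrite (bigD1 l)//= eqxx mul1r big1 ?addr0// => i /negPf ->.
  by rewrite mul0r.
have JG i : J (G i).
  have [N [c PN]] : exists N (c : nat -> germ n), P ^+ N = \sum_(i < n) c i * gpd i P.
    apply: power_in_jacobian.
    by rewrite (prod_cofactor i) (rmorphM (@gc0 R n)) /= H0 mul0r.
  have JPN : J (P ^+ N) by exists (fun i => c i).
  have [l /gunit[v lv]] := Hd i.
  (* [G i ^+ 2] is congruent to [b] modulo [J], so [G i ^+ (2 * N)] is congruent to [b ^+ N], a
     multiple of [P ^+ N]. *)
  pose b := - (v * gpd l (G i)) * P.
  have G2 : G i ^+ 2 - b = v * G i * gpd l P.
    rewrite /b (prod_cofactor i) gpdM -[G i ^+ 2]mulr1 -lv; ring.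
  apply: (Jrad _ (2 * N)%N); rewrite exprM -[_ ^+ N](subrK (b ^+ N)); apply: (JD).
    by rewrite subrXX G2 mulrC mulrA; apply: (JM); exact: Jpd.
  by rewrite exprMn; exact: JM.
have /choice[A hA] : forall i, exists a : 'I_n -> germ n, G i = \sum_(j < n) a j * gpd j P by exact: JG.
pose d i := vf (ext 0 (A i)).
have dE i s : d i s = \sum_(j < n) A i j * gpd j s.
  by apply: eq_bigr => j _; rewrite ext_ord.
have dG i : G i = d i P by rewrite dE -hA.
exists (fun i j => gc0 (A i j)) => i k.
transitivity (gc0 (d i (H k))).
  by rewrite dE (raddf_sum (@gc0 R n)); apply: eq_bigr => j _ /=; rewrite (rmorphM (@gc0 R n)).
have gc0_dvd a e : a = H k * e -> gc0 a = 0.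
  by move=> ->; rewrite (rmorphM (@gc0 R n)) /= H0 mul0r.
have [ik|ik] := eqVneq i k.
  have : (1 - d i (H k)) * G k = H k * d i (G k).
    rewrite mulrBl mul1r -{1}ik dG (prod_cofactor k) /d vfM; ring.
  move=> /Hprime[[e /gc0_dvd]|[e /dvd_cofactor//]].
  by rewrite (raddfB (@gc0 R n)) /= rmorph1 => /eqP; rewrite subr_eq0 => /eqP.
(* For distinct indices [H k] divides both [P] and [G i], so the product rule for [d i P = G i] puts
   [d i (H k) * G k] in the ideal of [H k]. *)
have : d i (H k) * G k = H k * (\prod_(j | (j != i) && (j != k)) H j - d i (G k)).
  rewrite mulrBr -(bigD1 k) 1?eq_sym//= -/(G i) (dG i) (prod_cofactor k) /d vfM; ring.
by move=> /Hprime[[e /gc0_dvd]|[e /dvd_cofactor//]].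
Qed.

End Radical.

(** * Completing equations to coordinates *)

Section Coordinates.
Variable R : realType.
Local Notation C := R[i].
Local Notation germ := (germ R).

Lemma gc0_subst n k (f : {rmorphism germ n -> germ k}) s :
  (forall i, (i < n)%N -> gc0 (f (gvar R n i)) = 0) -> (forall c, f (gcst n c) = gcst k c) ->
  gc0 (f s) = gc0 s.
Proof.
move=> f0 fc; have [q {1}->] := gdecomp s.
rewrite (rmorphD f) fc (raddfD (@gc0 R k)) /= gc0_cst (raddf_sum f) (raddf_sum (@gc0 R k)).
rewrite big1 ?addr0// => i _ /=.
by rewrite (rmorphM f) (rmorphM (@gc0 R k)) /= f0 ?mul0r.
Qed.

Lemma gcoef1 n (s : germ n.+1) : gcoef s 1 = gcoef (gpd n s) 0.
Proof. by have := gcoef_euler s 1; rewrite gcoef_gXM mulr1n. Qed.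

Lemma gvar_last n : gvar R n.+1 n = gX R n. Proof. by rewrite /= eqxx. Qed.

(* The germ [g] below solves [f(x', g(x', t)) = t]; it is the remainder of the
   division of the last variable [w] by [f(x', w) - t], in the variables
   [x', t, w]. *)
Lemma last_auto n (f : germ n.+1) : gc0 f = 0 -> gc0 (gpd n f) != 0 ->
  exists sg tau : {rmorphism germ n.+1 -> germ n.+1},
  [/\ cancel sg tau, cancel tau sg, forall c, sg (gcst n.+1 c) = gcst n.+1 c,
      forall i, (i < n)%N -> sg (gvar R n.+1 i) = gvar R n.+1 i
    & sg (gvar R n.+1 n) = f].
Proof.
move=> f0 fn.
(* In [n.+2] variables, index [n] stands for [t] and index [n.+1] for [w]; [xs a b] substitutes [a]
   for [t] and [b] for [w]. *)
pose xs (a b : germ n.+1) i := if i == n.+1 then b else if i == n then a else gvar R n.+1 i.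
have xs0 a b i : gc0 a = 0 -> gc0 b = 0 -> gc0 (xs a b i) = 0.
  by move=> a0 b0; rewrite /xs; case: eqP => // _; case: eqP => // _; exact: gc0_gvar.
have xsl a b i : (i < n)%N -> xs a b i = gvar R n.+1 i.
  by move=> ni; rewrite /xs !ltn_eqF// ltnW.
have lt2 i : (i < n)%N -> (i < n.+2)%N by move=> ni; rewrite ltnW// ltnW.
have rho0 i : (i < n.+1)%N -> gc0 (gvar R n.+2 (if i == n then n.+1 else i)) = 0.
  by move=> _; exact: gc0_gvar.
(* [rho] writes [w] for the last variable, so that [Phi] below is [f(x', w) - t], of order 1 in
   [w]. *)
have [rho [_ rc rv]] := subst_germ rho0.
have rn : rho (gX R n) = gX R n.+1 by rewrite -gvar_last rv// eqxx gvar_last.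
have rl i : (i < n)%N -> rho (gvar R n.+1 i) = gvar R n.+2 i.
  by move=> ni; rewrite rv ?ltn_eqF// ltnW.
have rho0' i : (i < n.+1)%N -> gc0 (rho (gvar R n.+1 i)) = 0.
  by move=> ni; rewrite rv// rho0.
pose Phi := rho f - gi (gX R n).
have Phi0 : gc0 (gcoef Phi 0) = 0.
  by rewrite gc0_coef0 (raddfB (@gc0 R n.+2)) /= gc0_subst// gc0_gi gc0_gX f0 subrr.
have Phi1 : gc0 (gcoef Phi 1) = gc0 (gpd n f).
  rewrite gcoef1 gc0_coef0 (raddfB (@gpd R n.+2 n.+1)) /= gpd_gi_last subr0.
  rewrite (chain_rule n.+1 f rho0' rc) big_ord_recr /= eqxx rn gpd_gX_last mul1r big1.
    by rewrite add0r gc0_subst.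
  move=> i _; rewrite ltn_eqF// (_ : gi _ = gvar R n.+1 i); last by rewrite /= ltn_eqF.
  by rewrite rl//= !ltn_eqF ?gpd_gi_last ?mul0r// ltnW ?ltnS// ltnW.
have [||q [r [sr qr]]] := @gweierstrass R n.+1 1 Phi (gX R n.+1).
- by case.
- by rewrite Phi1.
pose g := r`_0.
have {}qr : gX R n.+1 = q * Phi + gi g.
  by rewrite {1}qr [r]size1_polyC ?sr// map_polyC /= hornerC.
have g0 : gc0 g = 0.
  have := congr1 (@gc0 R n.+2) qr; rewrite (raddfD (@gc0 R n.+2)) /= (rmorphM (@gc0 R n.+2)) /=.
  by rewrite gc0_gX -(gc0_coef0 Phi) Phi0 mulr0 add0r gc0_gi.
have q0 : gc0 q != 0.
  have := congr1 (fun s => gc0 (gcoef s 1)) qr; rewrite gcoefD -[gX R n.+1]mulr1 gcoef_gXM.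
  rewrite gcoefM big_ord_recr big_ord1 /= subnn subn0 (_ : gcoef (gi g) 1 = 0) ?addr0; last first.
    by rewrite gcoef1 gpd_gi_last; exact: gval_inj.
  rewrite (raddfD (@gc0 R n.+1)) /= !(rmorphM (@gc0 R n.+1)) /= Phi0 mulr0 addr0 gc0_coef0 rmorph1.
  by move=> e; apply/eqP => q0; move/eqP: e; rewrite gc0_coef0 q0 mul0r oner_eq0.
have [u qu] := gunit q0.
have gi_var i : (i < n)%N -> gvar R n.+2 i = gi (gvar R n.+1 i).
  by move=> ni; rewrite [LHS]/= ltn_eqF// ltnW// ltnS ltnW.
have mor0 (a : germ n.+1) : gc0 a = 0 ->
    forall i, (i < n.+1)%N -> gc0 (if i == n then a else gvar R n.+1 i) = 0.
  by move=> a0 i _; case: eqP => // _; exact: gc0_gvar.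
have [sg [_ sc sv]] := subst_germ (mor0 f f0).
have [tau [_ tc tv]] := subst_germ (mor0 g g0).
have sn : sg (gX R n) = f by rewrite -gvar_last sv// eqxx.
have tn : tau (gX R n) = g by rewrite -gvar_last tv// eqxx.
have sl i : (i < n)%N -> sg (gvar R n.+1 i) = gvar R n.+1 i by move=> ni; rewrite sv ?ltn_eqF// ltnW.
have tl i : (i < n)%N -> tau (gvar R n.+1 i) = gvar R n.+1 i by move=> ni; rewrite tv ?ltn_eqF// ltnW.
(* [al] sets [w = g(x', t)], and the division then yields [f(x', g) = t], the unit [q] being
   cancelled. [be] sets [t = f(x)] and [w = x_n]; it kills [Phi] and yields [g(x', f) = x_n]. *)
have [al [_ ac av]] := subst_germ (fun i (_ : (i < n.+2)%N) => xs0 (gX R n) g i (gc0_gX R n) g0).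
have [be [_ bc bv]] := subst_germ (fun i (_ : (i < n.+2)%N) => xs0 f (gX R n) i f0 (gc0_gX R n)).
have comp_eq (f1 f2 : {rmorphism germ n.+1 -> germ n.+1}) :
   (forall c, f1 (gcst n.+1 c) = gcst n.+1 c) -> (forall c, f2 (gcst n.+1 c) = gcst n.+1 c) ->
   (forall i, (i < n)%N -> f1 (gvar R n.+1 i) = gvar R n.+1 i) ->
   (forall i, (i < n)%N -> f2 (gvar R n.+1 i) = gvar R n.+1 i) ->
   f1 (gX R n) = f2 (gX R n) -> gc0 (f1 (gX R n)) = 0 -> f1 =1 f2.
  move=> c1 c2 l1 l2 x12 x0; apply: rmorph_germ_uniq => [i|c|i]; last 2 first.
  - by rewrite c1 c2.
  - by rewrite ltnS leq_eqVlt => /orP[/eqP ->|ni]; rewrite ?gvar_last// l1 ?l2.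
  by rewrite ltnS leq_eqVlt => /orP[/eqP ->|ni]; rewrite ?gvar_last// l1 ?gc0_gvar.
have al_rho : al \o rho =1 tau.
  apply: comp_eq => [c|//|i ni|//||] /=; rewrite ?rc ?ac ?rn ?rl//.
  - by rewrite av ?lt2// xsl.
  - by rewrite -gvar_last av// /xs eqxx tn.
  - by rewrite -gvar_last av// /xs eqxx.
have be_rho : be \o rho =1 idfun.
  apply: comp_eq => [c|//|i ni|//||] /=; rewrite ?rc ?bc ?rn ?rl//.
  - by rewrite bv ?lt2// xsl.
  - by rewrite -gvar_last bv// /xs eqxx.
  - by rewrite -gvar_last bv// /xs eqxx gc0_gX.
have xn1 (a b : germ n.+1) : xs a b n = a by rewrite /xs eqxx ltn_eqF.
have gin : gi (gX R n) = gvar R n.+2 n by rewrite /= ltn_eqF// eqxx.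
have al_gi : al \o (@gi R n.+1) =1 idfun.
  apply: comp_eq => [c|//|i ni|//||] /=; rewrite -?gcst_S ?ac//.
  - by rewrite -gi_var// av ?lt2// xsl.
  - by rewrite gin av// xn1.
  - by rewrite gin av// xn1 gc0_gX.
have be_gi : be \o (@gi R n.+1) =1 sg.
  apply: comp_eq => [c|//|i ni|//||] /=; rewrite -?gcst_S ?bc//.
  - by rewrite -gi_var// bv ?lt2// xsl.
  - by rewrite gin bv// xn1 sn.
  - by rewrite gin bv// xn1.
have {}al_rho s : al (rho s) = tau s := al_rho s.
have {}be_rho s : be (rho s) = s := be_rho s.
have {}al_gi s : al (gi s) = s := al_gi s.
have {}be_gi s : be (gi s) = sg s := be_gi s.
have tf : tau f = gX R n.
  have := congr1 al qr; rewrite (rmorphD al) (rmorphM al) /Phi (rmorphB al).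
  rewrite (al_rho f) (al_gi g) (al_gi (gX R n)) -{1}gvar_last av// {1}/xs eqxx /= => /eqP.
  rewrite -subr_eq subrr eq_sym => /eqP/(congr1 (fun s => al u * s)).
  rewrite mulr0 mulrA -rmorphM mulrC [u * q]mulrC qu rmorph1 mulr1 => /eqP.
  by rewrite subr_eq0 => /eqP.
have sgg : sg g = gX R n.
  have := congr1 be qr; rewrite (rmorphD be) (rmorphM be) /Phi (rmorphB be).
  rewrite (be_rho f) (be_gi g) (be_gi (gX R n)) sn /= subrr mulr0 add0r => <-.
  by rewrite -gvar_last bv// /xs eqxx.
exists sg, tau; split=> //.
- apply: (comp_eq (tau \o sg) idfun) => [c|//|i ni|//||] /=; rewrite ?sc ?tc ?sl ?tl//.
    by rewrite sn tf.
  by rewrite sn tf gc0_gX.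
- apply: (comp_eq (sg \o tau) idfun) => [c|//|i ni|//||] /=; rewrite ?sc ?tc ?tl ?sl//.
    by rewrite tn sgg.
  by rewrite tn sgg gc0_gX.
- by rewrite gvar_last.
Qed.


(** In the current coordinates [f] reads [tau f]. Variable [j] is moved to the last place, replaced
    there by [f], and the result is put at place [k]. As [k <= j], the variables below [k] do not
    move. *)
Lemma extend_coordinates n (sg tau : {rmorphism germ n -> germ n}) (k j : nat) (f : germ n) :
  cancel sg tau -> cancel tau sg -> (forall c, sg (gcst n c) = gcst n c) -> gc0 f = 0 ->
  (k <= j)%N -> (j < n)%N -> gc0 (gpd j (tau f)) != 0 ->
  exists sg' tau' : {rmorphism germ n -> germ n},
  [/\ cancel sg' tau', cancel tau' sg', forall c, sg' (gcst n c) = gcst n c,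
      forall i, (i < k)%N -> sg' (gvar R n i) = sg (gvar R n i) & sg' (gvar R n k) = f].
Proof.
case: n => [//|n] in sg tau f * => sgK tauK sgc f0 kj jn fj.
have kn := leq_ltn_trans kj jn.
have [pi [piK pc pv _]] := swap_vars R jn (ltnSn n).
have [pi' [pi'K pc' pv' _]] := swap_vars R kn (ltnSn n).
have piv0 i : (i < n.+1)%N -> gc0 (pi (gvar R n.+1 i)) = 0.
  by move=> ni; rewrite pv// gc0_gvar.
have [||la [la' [laK la'K lac lav lan]]] := @last_auto n (pi (tau f)).
- by rewrite gc0_subst//; exact: gc0_iso tauK _.
- rewrite (chain_rule n (tau f) piv0 pc) (raddf_sum (@gc0 R n.+1)).
  rewrite (bigD1 (Ordinal jn))//= (rmorphM (@gc0 R n.+1)) /= (gc0_subst _ piv0 pc).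
  rewrite pv// /transp eqxx gvar_last gpd_gX_last rmorph1 mul1r big1 ?addr0// => i ij.
  rewrite (rmorphM (@gc0 R n.+1)) /= pv//; rewrite -val_eqE /= in ij.
  rewrite /transp (negPf ij) gpd_gvar//; last by case: ifP.
  suff -> : (n == if i == n :> nat then j else i) = false by rewrite raddf0 mul0r.
  by have [<-|/negPf] := eqVneq (i : nat) n; [exact: negPf ij|rewrite eq_sym].
exists (sg \o (pi \o (la \o pi'))), (pi' \o (la' \o (pi \o tau))); split=> [s|s|c|i ik|].
- by rewrite /= sgK piK laK pi'K.
- by rewrite /= pi'K la'K piK tauK.
- by rewrite /= pc' lac pc sgc.
- have ij := leq_trans ik kj; have ni : (i < n)%N by apply: leq_trans ij _; rewrite -ltnS.
  have ni' : (i < n.+1)%N := ltnW ni.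
  transitivity (sg (pi (la (pi' (gvar R n.+1 i))))) => //.
  rewrite pv'// /transp (ltn_eqF ik) (ltn_eqF ni) lav// pv//.
  by rewrite /transp (ltn_eqF ij) (ltn_eqF ni).
- transitivity (sg (pi (la (pi' (gvar R n.+1 k))))) => //.
  by rewrite pv'// /transp eqxx lan piK tauK.
Qed.

(** Exchange argument: if no variable of index at least [k] had a nonzero derivative, the
    differential of the next equation would be a combination of the previous ones, and its dual
    vector would pair to 0 with it instead of 1. *)
Lemma coordinates n m (H : 'I_m -> germ n) (A : 'I_m -> 'I_n -> C) :
  (forall i, gc0 (H i) = 0) ->
  (forall i k, \sum_(j < n) A i j * gc0 (gpd j (H k)) = (i == k)%:R) ->
  (m <= n)%N /\ exists sg tau : {rmorphism germ n -> germ n},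
  [/\ cancel sg tau, cancel tau sg, forall c, sg (gcst n c) = gcst n c
    & forall i : 'I_m, sg (gvar R n i) = H i].
Proof.
move=> H0 AH; suff : forall k, (k <= m)%N ->
    (k <= n)%N /\ exists sg tau : {rmorphism germ n -> germ n},
    [/\ cancel sg tau, cancel tau sg, forall c, sg (gcst n c) = gcst n c
     & forall i : 'I_m, (i < k)%N -> sg (gvar R n i) = H i].
  move=> /(_ m (leqnn m))[mn [sg [tau [h1 h2 h3 h4]]]]; split=> //.
  by exists sg, tau; split=> // i; exact/h4/ltn_ord.
elim=> [_|k IH km]; first by split=> //; exists idfun, idfun.
have [kn [sg [tau [sgK tauK sgc sgH]]]] := IH (ltnW km).
pose i0 := Ordinal km; pose f := H i0.
have sg0 i : (i < n)%N -> gc0 (sg (gvar R n i)) = 0.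
  by move=> _; apply: gc0_iso sgK _; exact: gc0_gvar.
have [j [kj fj]] : exists j : 'I_n, (k <= j)%N /\ gc0 (gpd j (tau f)) != 0.
  apply: contrapT => none; have := AH i0 i0; rewrite eqxx => /eqP; apply/negP.
  have dl (l : 'I_n) : gc0 (gpd l (H i0)) =
      \sum_(i < n) gc0 (gpd l (sg (gvar R n i))) * gc0 (gpd i (tau f)).
    rewrite -{1}[H i0]tauK (chain_rule l _ sg0 sgc) (raddf_sum (@gc0 R n)).
    by apply: eq_bigr => i _; rewrite /= (rmorphM (@gc0 R n)) /= (gc0_subst (gpd i _) sg0 sgc).
  under eq_bigr do rewrite dl mulr_sumr.
  rewrite exchange_big big1 /= => [|i _]; first by rewrite eq_sym oner_eq0.
  under eq_bigr do rewrite mulrA; rewrite -mulr_suml.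
  have [ik|ki] := ltnP i k; last first.
    suff -> : gc0 (gpd i (tau f)) = 0 by rewrite mulr0.
    by apply/eqP/negPn/negP => h; apply: none; exists i.
  have := AH i0 (Ordinal (ltn_trans ik km)); rewrite -(sgH (Ordinal (ltn_trans ik km)))//= => ->.
  by rewrite -val_eqE /= gtn_eqF// mul0r.
have [sg' [tau' [h1 h2 h3 h4 h5]]] := extend_coordinates sgK tauK sgc (H0 i0) kj (ltn_ord j) fj.
split; first exact: leq_ltn_trans kj (ltn_ord j).
exists sg', tau'; split=> // i; rewrite ltnS leq_eqVlt => /orP[/eqP ik|ik].
  by rewrite ik h5; congr H; apply: val_inj.
by rewrite h4// sgH.
Qed.

End Coordinates.

(** * From an automorphism of the germs to a chart *)

Section ChangeOfChart.
Variables (R : realType) (n : nat).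
Local Notation C := R[i].
Local Notation K := (R[i] : numFieldType).
Local Notation germ := (germ R).

Lemma bnd_gvar (r : nat -> R) k i : (forall i, 0 < r i) -> bnd r (r i) (gval (gvar R k i)).
Proof.
move=> r0; elim: k => [|k IH]; first exact: bnd_le (ltW (r0 i)) (bnd0 r 0).
rewrite [gvar _ _ _]/=; case: eqP => [->|_]; first exact: bnd_psX.
by rewrite gval_gi; exact: bnd_psC.
Qed.

Lemma gev_gvar_all v k i : (i < k)%N -> gev v (gvar R k i) = v i.
Proof.
pose r j := nc (v j) + 1.
have r0 j : 0 < r j by rewrite ltr_wpDl ?nc_ge0.
have vr j : nc (v j) <= r j by rewrite lerDl.
elim: k => [//|k IH]; rewrite ltnS leq_eqVlt => /orP[/eqP ->|ik]; first by rewrite gvar_last gev_gX.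
rewrite -IH// [gvar _ k.+1 _]/= ltn_eqF//.
by have := ev_psC r0 vr (bnd_gvar k i r0).
Qed.

(** Recentring is composition with [a i + w i], of norm at most [e / 2 + e / 2] on the half
    polydisc. *)
Lemma translate (s : germ n) :
  nz (fun a => exists t : germ n, nz (fun w => gev w t = gev (fun i => a i + w i) s)).
Proof.
have [e e0 [M hM]] := gsumm s; exists (e / 2); first by rewrite divr_gt0.
move=> a ha; have h0 : forall i : nat, 0 < e / 2 by move=> _; rewrite divr_gt0.
pose g i := fcst n (a i) + gval (gvar R n i).
have hg i : bnd (fun=> e / 2) e (g i).
  apply: (@bnd_le _ _ _ (nc (a i) + e / 2)); first by rewrite [leRHS]splitr lerD2r.
  by apply: (bndD h0); [exact: bnd_fcst|exact: bnd_gvar].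
have [c hc hcw] := comp_ex (fun=> e0) h0 hM hg.
exists (mkg (bnd_summ h0 hc)); exists (e / 2); rewrite ?divr_gt0// => w wd.
rewrite [LHS]hcw//; apply: ev_ext => i ni.
rewrite (evD h0 wd (bnd_fcst _ _ h0) (bnd_gvar n i h0)) ev_fcst; congr (_ + _).
exact: gev_gvar_all.
Qed.

Lemma analytic_nearby (s : germ n) :
  \forall v \near (0 : 'rV[K]_n), analytic_at (fun u : 'rV[K]_n => gev (vx u) s : K) v.
Proof.
apply: near_sub (near_vx n (translate s)) => a [t ht]; apply/analyticP; exists t.
apply: near_sub (near_vx n ht) => v ->; apply: gev_ext => i ni.
by rewrite !vx_lt mxE.
Qed.

Lemma analytic_continuous (f : 'rV[K]_n -> K) a e : analytic_at f a -> 0 < e ->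
  \forall v \near a, nc (f v - f a) <= e.
Proof.
move=> /analyticP[s hs] e0; have fa := expands_at0 hs.
have s0 : gc0 (s - gcst n (gc0 s)) = 0 by rewrite raddfB /= gc0_cst subrr.
have := near_and hs (near_vx n (nzI (nz_small s0 e0) (nz_gevB s (gcst n (gc0 s))))).
move=> /nbhs_modP[d d0 h]; apply/nbhs_modP; exists d => // v hv.
have [|e1 [e2 e3]] := h (v - a); first by move=> i; have := hv i; rewrite !mxE subr0.
by move: e2; rewrite e3 gev_cst -e1 -fa addr0 [a + _]addrC subrK.
Qed.

Lemma analytic_near_map (g : 'rV[K]_n -> 'rV[K]_n) a (P : 'rV[K]_n -> Prop) :
  (forall i, analytic_at (fun v => g v 0 i) a) ->
  (\forall w \near g a, P w) -> \forall v \near a, P (g v).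
Proof.
move=> ga /nbhs_modP[e e0 hP].
have : \forall v \near a, forall i : 'I_n, nc (g v 0 i - g a 0 i) <= e.
  apply: (filter_forall (nbhs_filter a)) => i.
  exact: analytic_continuous (ga i) e0.
by apply: near_sub => v; exact: hP.
Qed.

(** By uniqueness such a morphism is the substitution of its values on the variables. *)
Lemma gev_rmorph (sg : {rmorphism germ n -> germ n}) s :
  (forall i, (i < n)%N -> gc0 (sg (gvar R n i)) = 0) -> (forall c, sg (gcst n c) = gcst n c) ->
  nz (fun w => gev w (sg s) = gev (fun i => gev w (sg (gvar R n i))) s).
Proof.
move=> sg0 sgc; have [f [fev fc fv]] := subst_germ sg0.
have <- : f s = sg s; last exact: fev.
apply: rmorph_germ_uniq => [i ni|c|i ni]; first by rewrite fv// sg0.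
- by rewrite fc sgc.
- by rewrite fv.
Qed.

Variables (S : complex_manifold R n) (p : S) (x : chart R[i] n S).
Hypothesis hx : coordinates_at p x.
Variables sg tau : {rmorphism germ n -> germ n}.
Hypotheses (sgK : cancel sg tau) (tauK : cancel tau sg) (sgc : forall c, sg (gcst n c) = gcst n c).

Lemma near_coord_map (q : S) (P : 'rV[K]_n -> Prop) : cdom x q ->
  (\forall v \near Defs.coord x q, P v) -> \forall q' \near q, P (Defs.coord x q').
Proof.
move=> xq hP; have /= h : Defs.coord x @ q --> Defs.coord x q by exact: Defs.coord_continuous.
exact: (h P hP).
Qed.

Lemma near_coord_inv_map (q : S) (P : S -> Prop) : cdom x q ->
  (\forall q' \near q, P q') -> \forall v \near Defs.coord x q, P (coord_inv x v).
Proof. by move=> xq /(near_chart _ xq). Qed.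

Definition germ_map (f : germ n -> germ n) (v : 'rV[K]_n) : 'rV[K]_n :=
  \row_i gev (vx v) (f (gvar R n i)).

Lemma near_germ_mapK (f g : {rmorphism germ n -> germ n}) :
  cancel f g -> cancel g f -> (forall c, f (gcst n c) = gcst n c) ->
  \forall v \near (0 : 'rV[K]_n), germ_map g (germ_map f v) = v.
Proof.
move=> fK gK fc.
have f0 i : (i < n)%N -> gc0 (f (gvar R n i)) = 0.
  by move=> _; apply: gc0_iso fK _; exact: gc0_gvar.
have h : nz (fun w => forall i, (i < n)%N ->
    gev (fun j => gev w (f (gvar R n j))) (g (gvar R n i)) = w i).
  apply: nz_all => i ni; apply: nz1 (gev_rmorph (g (gvar R n i)) f0 fc) => w <-.
  by rewrite gK gev_gvar_all.
apply: near_sub (near_vx n h) => v hv; apply/rowP => i; rewrite mxE.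
rewrite -[RHS]vx_ord -hv//; apply: gev_ext => j nj.
by rewrite vx_lt mxE.
Qed.

Let Phi := germ_map sg.
Let Psi := germ_map tau.

(** A chart needs open sets and maps inverse to each other, while the morphisms only give identities
    near 0; [B] is an open set at each point of which everything required holds. *)
Let good v := [/\ forall i, analytic_at (fun u => Phi u 0 i) v,
  forall i, analytic_at (fun u => Psi u 0 i) v, Psi (Phi v) = v, Phi (Psi v) = v
  & cdom x (coord_inv x v) /\ Defs.coord x (coord_inv x v) = v].
Let B := interior (good : set 'rV[K]_n).

Lemma chart_change : exists y : chart R[i] n S, coordinates_at p y /\
  forall i : 'I_n, rep x (fun q => Defs.coord y q 0 i) (sg (gvar R n i)).
Proof.
have tauc c : tau (gcst n c) = gcst n c by rewrite -[in LHS]sgc sgK.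
have [xp x0 xc] := hx.
have ana (f : germ n -> germ n) : \forall v \near (0 : 'rV[K]_n),
    forall i, analytic_at (fun u => germ_map f u 0 i) v.
  have h (i : 'I_n) : \forall v \near (0 : 'rV[K]_n), analytic_at (fun u => germ_map f u 0 i) v.
    apply: near_sub (analytic_nearby (f (gvar R n i))) => v.
    by congr (@analytic_at _ _ _ _); apply/funext => u; rewrite mxE.
  exact: filter_forall (nbhs_filter (0 : 'rV[K]_n)) h.
have good0 : \forall v \near (0 : 'rV[K]_n), good v.
  have := near_and (ana sg) (near_and (ana tau) (near_and (near_germ_mapK sgK tauK sgc)
    (near_and (near_germ_mapK tauK sgK tauc) (near_coordK hx)))).
  by apply: near_sub => v [h1 [h2 [h3 [h4 h5]]]]; exact: And5 h1 h2 h3 h4 h5.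
have Bgood v : B v -> good v by exact: interior_subset.
have Bnear v : B v -> \forall u \near v, B u.
  by move=> Bv; apply: open_nbhs_nbhs; split=> //; exact: open_interior.
have Phi0 : Phi 0 = 0.
  apply/rowP => i; rewrite !mxE -(@gev_ext _ _ _ (fun=> 0)) => [|j nj]; last by rewrite vx_lt mxE.
  by rewrite gev_at0; apply: gc0_iso sgK _; exact: gc0_gvar.
(* Shrinking [B] on both sides: [Phi] and [Psi] are inverse bijections between [U] and the [V]
   below, both open, so the image of the new domain is [V]. *)
pose U : set 'rV[K]_n := [set v | B v /\ B (Phi v)].
have Unear v : U v -> \forall u \near v, U u.
  move=> [Bv BPv]; have [h1 _ _ _ _] := Bgood v Bv.
  by apply: near_and (Bnear v Bv) (analytic_near_map h1 (Bnear _ BPv)).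
pose V : set 'rV[K]_n := [set w | B w /\ B (Psi w)].
have Vnear v : V v -> \forall u \near v, V u.
  move=> [Bv BPv]; have [_ h1 _ _ _] := Bgood v Bv.
  by apply: near_and (Bnear v Bv) (analytic_near_map h1 (Bnear _ BPv)).
have UV v : U v -> V (Phi v) /\ Psi (Phi v) = v.
  by move=> [Bv BPv]; have [_ _ h _ _] := Bgood v Bv; split; [split; [|rewrite h]|].
pose yd : set S := [set q | cdom x q /\ U (Defs.coord x q)].
pose yc q := Phi (Defs.coord x q).
pose yi v := coord_inv x (Psi v).
have yd_open : open yd.
  rewrite openE => q [xq Uq]; apply: near_and.
    by apply: open_nbhs_nbhs; split=> //; exact: cdom_open.
  exact: near_coord_map xq (Unear _ Uq).
have ycE : yc @` yd = V.
  apply/seteqP; split=> [_ [q [xq Uq] <-]|w [Bw BPw]]; first by have [] := UV _ Uq.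
  have [_ _ _ e _] := Bgood w Bw; have [_ _ _ _ [d1 d2]] := Bgood _ BPw.
  exists (yi w); last by rewrite /yc /yi d2.
  by split; [exact: d1|rewrite /yi d2; split; [exact: BPw|rewrite e]].
have yc_open : open (yc @` yd) by rewrite ycE openE; exact: Vnear.
have ycK q : yd q -> yi (yc q) = q.
  by move=> [xq /UV[_ e]]; rewrite /yi /yc e Defs.coordK.
have yc_cont q : yd q -> {for q, continuous yc}.
  move=> [xq [Bq BPq]] A; have [h1 _ _ _ _] := Bgood _ Bq.
  move=> /(analytic_near_map h1); exact: near_coord_map.
have yi_cont q : yd q -> {for yc q, continuous yi}.
  move=> yq A; rewrite /yi; have [xq Uq] := yq; have [[BP _] e] := UV _ Uq.
  have [_ h1 _ _ _] := Bgood _ BP.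
  rewrite /yc e Defs.coordK// => /(near_coord_inv_map xq) h2.
  apply: (analytic_near_map (P := fun w => A (coord_inv x w)) h1).
  by rewrite e; exact: h2.
exists (Chart yd_open yc_open ycK yc_cont yi_cont); split; last first.
  move=> i; apply: near_sub (near_coordK hx) => v [_ e].
  by rewrite /= /yc e mxE.
split=> /=.
- by split; [exact: xp|rewrite x0; split; rewrite ?Phi0; exact: good0].
- by rewrite /yc x0 Phi0.
move=> c ac; have [xc1 xc2] := xc c ac; split=> q /=.
  move=> [xq Uq] cq i; have [[BP _] e] := UV _ Uq; have [_ h1 _ _ _] := Bgood _ BP.
  apply: (comp_analytic (f := fun v => Defs.coord c (coord_inv x v) 0 i) (g := Psi)); last exact: h1.
  by rewrite e; exact: xc1.
move=> cq [xq Uq] i; have [h1 _ _ _ _] := Bgood _ (proj1 Uq).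
apply: (comp_analytic (f := fun v => Phi v 0 i) (g := fun v => Defs.coord x (coord_inv c v))).
  by rewrite Defs.coordK//; exact: h1.
exact: xc2.
Qed.

End ChangeOfChart.

Theorem corollary4p7 (R : realType) (n : nat) (S : complex_manifold R n)
    (D : set S) (hD : is_divisor D) (p : S)
    (x : chart R[i] n S) (hx : coordinates_at p x)
    (m : nat) (D_ : 'I_m -> set S)
    (hcomp : irreducible_components p D D_)
    (hsmooth : forall i, smooth_hypersurface_at p (D_ i))
    (h_ : 'I_m -> S -> R[i])
    (hdef : forall i, defining_equation p (D_ i) (h_ i))
    (h : S -> R[i]) (hh : h = fun q => \prod_(i < m) h_ i q)
    (hfree : free_divisor_at p x h)
    (hrad : jacobian_ideal p x h = radical p (jacobian_ideal p x h)) :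
  normal_crossings_at p D.
Proof.
have /choice[H hH] : forall i, exists s, rep x (h_ i) s.
  by move=> i; apply/(holoP hx); case: (hdef i).
have Hprime i := let: And3 a _ _ := smooth_component hx (hsmooth i) (hdef i) (hH i) in a.
have H0 i := let: And3 _ a _ := smooth_component hx (hsmooth i) (hdef i) (hH i) in a.
have Hd i := let: And3 _ _ a := smooth_component hx (hsmooth i) (hdef i) (hH i) in a.
have [_ Dsub Dcup] := hcomp.
have Dh i : \forall q \near p, D_ i q <-> h_ i q = 0 by case: (hdef i).
(* Divisibility of the equations means inclusion of the hypersurfaces, which distinct components
   exclude. *)
have Hdist i j d : H j = H i * d -> i = j.
  move=> Hij; apply: Dsub; have hd := repM (hH i) (rep_germ_fun hx d).
  have := near_and (Dh i) (near_and (Dh j) ((germ_eqP hx (hH j) hd).2 Hij)).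
  apply: near_sub => q [[a _] [[_ b] e]] /a hi; apply: b.
  by rewrite e hi mul0r.
have hP : rep x h (\prod_i H i) by rewrite hh; exact: rep_prod.
have [s k [a sk]|A hA] := dual_frame Hprime H0 Hd Hdist.
  have hs := rep_germ_fun hx s; apply/(jacobianP hx hP hs); rewrite hrad; split.
    exact: holo_germ_fun.
  by exists k; apply/(jacobianP hx hP (repX k hs)); exists a.
have [mn [sg [tau [sgK tauK sgc sgH]]]] := coordinates H0 hA.
have [y [hy yF]] := chart_change hx sgK tauK sgc.
exists y, m; split=> //.
(* The product of the first [m] new coordinates has the same series in [x] as [h], so reducedness
   and the zero set can be read on the [H i]. *)
have yP : rep x (fun q => \prod_(i < n | (i < m)%N) Defs.coord y q 0 i) (\prod_i H i).
  have := rep_prod (index_enum 'I_n) (fun i : 'I_n => (i < m)%N) yF.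
  rewrite (big_ord_narrow mn) (_ : \prod_(i < m) _ = \prod_i H i)//.
  by apply: eq_bigr => i _; rewrite sgH.
have yh := (germ_eqP hx yP hP).2 erefl.
split; first by apply/(holoP hx); exists (\prod_i H i).
  split=> [h0|g k /(holoP hx)[s gs] /(holoP hx)[t kt] e].
    have := prod_neq0 Hd; apply/negP; rewrite negbK; apply/eqP.
    by rewrite -(raddf0 (gcst n)); apply: (germ_eqP hx yP (rep_cst x 0)).1 h0.
  apply/(germ_unitP hx gs); apply: (prod_square_free Hprime H0 Hd Hdist (k := t)).
  exact: (germ_eqP hx yP (repM (repX 2 gs) kt)).1 e.
have Dall : \forall q \near p, forall i, D_ i q <-> h_ i q = 0.
  exact: filter_forall (nbhs_filter p) Dh.
have := near_and Dcup (near_and Dall yh); apply: near_sub => q [[a b] [c e]].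
rewrite /= e hh; split=> [/a[i _ /c hi]|/eqP].
  by rewrite (bigD1 i)//= hi mul0r.
by rewrite prodf_seq_eq0 => /hasP[i _ /andP[_ /eqP/c hi]]; apply: b; exists i.
Qed.
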